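(* There is an algorithm which takes as input - a prime number $p$; - an integral domain $R$ of dimension $2$, flat and finitely presented over $\mathbb{Z}$, given by a finite presentation; - effective Weil divisors $\mathcal{D}$ and $\mathcal{E}$ on $\mathcal{C} := \operatorname{Spec} R$ with no common irreducible component in their support, given by finite sets of generators of their defining ideals $I_{\mathcal{D}} = \mathcal{O}_{\mathcal{C}}(-\mathcal{D}) \subseteq R$ and $I_{\mathcal{E}} = \mathcal{O}_{\mathcal{C}}(-\mathcal{E}) \subseteq R$; - a constructible subset $V$ of $\mathcal{C}$, given as a finite disjoint union of intersections of open and closed subsets of $\mathcal{C}$; and which computes the naive intersection number $$\iota^{naive}_V(\mathcal{D},\mathcal{E}) = \sum_{P \in V^0} \operatorname{length}_{\mathcal{O}_{\mathcal{C},P}}\left(\frac{\mathcal{O}_{\mathcal{C},P}}{I_{\mathcal{D},P}+I_{\mathcal{E},P}}\right)\log \# k(P),$$ where $V^0$ denotes the set of closed points of $\mathcal{C}$ that are contained in $V$ and lie over $p$.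
   Context: For a closed point $P$ of $\mathcal{C}=\operatorname{Spec} R$ lying over $p$ (i.e. whose image in $\operatorname{Spec}\mathbb{Z}$ is the point $(p)$), $\mathcal{O}_{\mathcal{C},P}$ denotes the local ring at $P$, $k(P)$ its (finite) residue field, and $I_{\mathcal{D},P} = I_{\mathcal{D}} \otimes_R \mathcal{O}_{\mathcal{C},P}$, $I_{\mathcal{E},P} = I_{\mathcal{E}} \otimes_R \mathcal{O}_{\mathcal{C},P}$ are the localised ideals. The naive intersection number of $\mathcal{D}$ and $\mathcal{E}$ at $P$ is $$\iota^{naive}_P(\mathcal{D},\mathcal{E}) := \operatorname{length}_{\mathcal{O}_{\mathcal{C},P}}\left(\mathcal{O}_{\mathcal{C},P}/(I_{\mathcal{D},P}+I_{\mathcal{E},P})\right)\log\# k(P).$$ For any subset $W \subseteq \mathcal{C}$, $\iota^{naive}_W(\mathcal{D},\mathcal{E}) := \sum_{P\in W^0}\iota^{naive}_P(\mathcal{D},\mathcal{E})$, where $W^0$ is the set of closed points in $W$ lying over $p$. No regularity of $\mathcal{C}$ is assumed. Closed subsets are specified by finite sets of generators of ideals of $R$ and open subsets as complements of such closed subsets. Since each $\#k(P)$ is a power of $p$, $\iota^{naive}_V(\mathcal{D},\mathcal{E})$ is an integer multiple $n\log p$ of $\log p$; computing it means outputting this integer $n$. *)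

(* Defs.v *)
From HB Require Import structures.
From mathcomp Require Import all_boot all_order all_algebra.
(* [mpoly] has to be imported before the files of mathcomp-analysis, otherwise
   their notations clash. *)
From mathcomp Require Import mpoly.
From mathcomp Require Import finmap boolp classical_sets functions cardinality.
From mathcomp Require Import reals ereal esum exp.

Set Implicit Arguments.
Unset Strict Implicit.
Unset Printing Implicit Defensive.

Import Order.TTheory GRing.Theory Num.Theory.
Local Open Scope fset_scope.
Local Open Scope classical_set_scope.
Local Open Scope ring_scope.

(* Algorithms are Kleene's partial recursive functions, given by their graphs. *)

(* h(0, v) = f(v) and h(m + 1, v) = g(m, h(m, v), v) *)
Fixpoint primrec_graph k (f : k.-tuple nat -> nat -> Prop)
    (g : k.+2.-tuple nat -> nat -> Prop) (m : nat) (v : k.-tuple nat)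
    (y : nat) : Prop :=
  if m is m'.+1 then
    exists z, primrec_graph f g m' v z /\ g [tuple of m' :: z :: v] y
  else f v y.

Inductive partial_recursive :
    forall k : nat, (k.-tuple nat -> nat -> Prop) -> Prop :=
| PR_zero k : partial_recursive (fun (_ : k.-tuple nat) y => y = 0%N)
| PR_succ : partial_recursive (fun (v : 1.-tuple nat) y => y = (thead v).+1)
| PR_proj k (i : 'I_k) :
    partial_recursive (fun (v : k.-tuple nat) y => y = tnth v i)
| PR_comp k l (f : l.-tuple nat -> nat -> Prop)
    (g : 'I_l -> k.-tuple nat -> nat -> Prop) :
    partial_recursive f -> (forall i, partial_recursive (g i)) ->
    partial_recursive (fun v y =>
      exists w : l.-tuple nat, (forall i, g i v (tnth w i)) /\ f w y)
| PR_rec k (f : k.-tuple nat -> nat -> Prop)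
    (g : k.+2.-tuple nat -> nat -> Prop) :
    partial_recursive f -> partial_recursive g ->
    partial_recursive (fun v : k.+1.-tuple nat =>
      primrec_graph f g (thead v) [tuple of behead v])
| PR_mu k (f : k.+1.-tuple nat -> nat -> Prop) :
    partial_recursive f ->
    partial_recursive (fun (v : k.-tuple nat) y =>
      f [tuple of y :: v] 0%N /\
      forall z, (z < y)%N -> exists u, f [tuple of z :: v] u.+1).

(* A polynomial is given by a list of terms (coefficient, exponents). *)
Definition poly_data : Type := seq (int * seq nat).

(* Exponents missing from a list are 0, those after the n-th are ignored. *)
Definition poly_of n (s : poly_data) : {mpoly int[n]} :=
  \sum_(t <- s) t.1 *: 'X_[[multinom nth 0%N t.2 i | i < n]].

(* [CodeSeq.code] is the bijection seq nat -> nat of [choice.v]. *)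
Definition enc_int (z : int) : nat :=
  match z with Posz m => m.*2 | Negz m => m.*2.+1 end.
Definition enc_poly (s : poly_data) : nat :=
  CodeSeq.code [seq CodeSeq.code (enc_int t.1 :: t.2) | t <- s].
Definition enc_polys (s : seq poly_data) : nat :=
  CodeSeq.code [seq enc_poly f | f <- s].
Definition enc_input (p n : nat) (rels gD gE : seq poly_data)
    (V : seq (seq poly_data * seq poly_data)) : nat :=
  CodeSeq.code [:: p; n; enc_polys rels; enc_polys gD; enc_polys gE;
    CodeSeq.code
      [seq CodeSeq.code [:: enc_polys t.1; enc_polys t.2] | t <- V]].

Definition has_chain T (lt : T -> T -> Prop) (d : nat) : Prop :=
  exists c : nat -> T, forall i, (i < d)%N -> lt (c i) (c i.+1).

Definition max_chain T (lt : T -> T -> Prop) (d : nat) : Prop :=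
  has_chain lt d /\ ~ has_chain lt d.+1.

Definition psubset T (A B : {pred T}) : Prop :=
  {subset A <= B} /\ ~ {subset B <= A}.

Section GeneratedSubmodule.
Variables (A : comNzRingType) (M : lmodType A) (S : set M).

Definition gen_submod : {pred M} := fun x => `[< exists k (c : 'I_k -> A)
  (m : 'I_k -> M), (forall i, S (m i)) /\ x = \sum_i c i *: m i >].

Lemma gen_submod_closed : submod_closed gen_submod.
Proof.
split=> [|a x y /asboolP[k [c [m [Sm ->]]]] /asboolP[l [d [u [Su ->]]]]].
  apply/asboolP; exists 0%N, (fun=> 0), (fun=> 0); split; first by case.
  by rewrite big_ord0.
apply/asboolP; exists (k + l)%N.
exists (fun i => match fintype.split i with inl j => a * c j | inr j => d j end).
exists (fun i => match fintype.split i with inl j => m j | inr j => u j end).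
split=> [i|]; first by case: (fintype.split i).
rewrite big_split_ord scaler_sumr /=; congr (_ + _); apply: eq_bigr => i _.
  by rewrite (unsplitK (inl i)) scalerA.
by rewrite (unsplitK (inr i)).
Qed.

HB.instance Definition _ := GRing.isZmodClosed.Build M gen_submod
  (GRing.submod_closedB gen_submod_closed).
End GeneratedSubmodule.

(* M / gen_submod S *)
Section QuotientModule.
Variables (A : comNzRingType) (M : lmodType A) (S : set M).
Local Open Scope quotient_scope.
Local Notation N := (gen_submod S).

Definition quot_module : Type := Quotient.quot N.
HB.instance Definition _ := GRing.Zmodule.on quot_module.

Definition quot_scale (a : A) (x : quot_module) : quot_module :=
  \pi_(Quotient.quot N) (a *: repr (x : Quotient.quot N)).

Lemma quot_scale_pi a (m : M) : quot_scale a (\pi_(Quotient.quot N) m) =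
  \pi_(Quotient.quot N) (a *: m).
Proof.
apply/eqP; rewrite -Quotient.idealrBE -scalerBr.
rewrite -[_ *: _]addr0; have [N0 NZ] := gen_submod_closed S; apply: NZ => //.
by rewrite Quotient.idealrBE reprK.
Qed.

Lemma quot_scaleA a b x : quot_scale a (quot_scale b x) =
  quot_scale (a * b) x.
Proof. by rewrite {2}/quot_scale quot_scale_pi scalerA. Qed.

Lemma quot_scale1 : left_id 1 quot_scale.
Proof. by move=> x; rewrite /quot_scale scale1r reprK. Qed.

Lemma quot_scaleDr : right_distributive quot_scale +%R.
Proof.
move=> a x y; rewrite -[x](@reprK _ (Quotient.quot N)).
rewrite -[y](@reprK _ (Quotient.quot N)) -[_ + _](raddfD \pi_(Quotient.quot N)).
by rewrite !quot_scale_pi scalerDr raddfD.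
Qed.

Lemma quot_scaleDl x : {morph quot_scale^~ x : a b / a + b}.
Proof. by move=> a b; rewrite /quot_scale scalerDl raddfD. Qed.

HB.instance Definition _ := GRing.Zmodule_isLmodule.Build A quot_module
  quot_scaleA quot_scale1 quot_scaleDr quot_scaleDl.
End QuotientModule.

Definition module_length (RR : realType) (A : comNzRingType) (M : lmodType A) :
    \bar RR :=
  ereal_sup [set d%:R%:E | d in has_chain (fun S S' : {pred M} =>
    [/\ submod_closed S, submod_closed S' & psubset S S'])].

(* An element \sum_i x_i (x) m_i of N (x)_Z M, given by the list of the pairs
   (x_i, m_i), vanishes iff it is killed by every biadditive map. *)
Definition tensor_eq0 (N M : zmodType) (s : seq (N * M)) : Prop :=
  forall (T : zmodType) (b : N -> M -> T),
    (forall m, {morph b^~ m : x y / x + y}) ->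
    (forall x, {morph b x : m m' / m + m'}) ->
    \sum_(t <- s) b t.1 t.2 = 0.

(* Tensoring with M preserves injectivity. *)
Definition flat_over_Z (M : zmodType) : Prop :=
  forall (N N' : zmodType) (f : {additive N -> N'}), injective f ->
    forall s : seq (N * M),
      tensor_eq0 [seq (f t.1, t.2) | t <- s] -> tensor_eq0 s.

Definition ideal_gen (R : comNzRingType) (gs : seq R) : set R :=
  [set f | exists c : 'I_(size gs) -> R, f = \sum_i c i * gs`_i].

(* phi identifies R with Z[X_1, ..., X_n] / (rels) *)
Definition presents n (rels : seq {mpoly int[n]}) (R : comNzRingType)
    (phi : {rmorphism {mpoly int[n]} -> R}) : Prop :=
  (forall r, exists f, phi f = r) /\
  (forall f, phi f = 0 <-> ideal_gen rels f).

Definition spec (R : comNzRingType) : Type := PrimeIdealr.type R.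
HB.instance Definition _ R := gen_eqMixin (spec R).
HB.instance Definition _ R := gen_choiceMixin (spec R).

Section Spec.
Variable R : comNzRingType.
Implicit Types (P Q : spec R) (gs : seq R).

Definition ideal_of P : {pred R} := fun f => f \in (P : PrimeIdealr.type R).

Definition krull_dim_eq (d : nat) : Prop :=
  max_chain (fun P Q => psubset (ideal_of P) (ideal_of Q)) d.

Definition height_eq P (d : nat) : Prop :=
  max_chain (fun Q Q' => psubset (ideal_of Q) (ideal_of Q') /\
                         {subset ideal_of Q' <= ideal_of P}) d.

Definition zero_locus gs : set (spec R) :=
  [set P | {subset gs <= ideal_of P}].

Definition locally_closed (t : seq R * seq R) : set (spec R) :=
  zero_locus t.1 `&` ~` zero_locus t.2.

(* The closure of {P} is the set of primes containing P. *)
Definition closed_point P : Prop :=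
  forall Q, {subset ideal_of P <= ideal_of Q} -> Q = P.

Definition lies_over (p : nat) P : Prop :=
  forall m : int, (m%:~R \in ideal_of P) = (p%:Z %| m)%Z.

(* Multiplicities of the prime divisors; the spectrum of a Noetherian ring is
   quasi-compact, hence local finiteness is finiteness. *)
Definition weil_divisor (D : spec R -> int) : Prop :=
  finite_set [set P | D P != 0] /\ (forall P, D P != 0 -> height_eq P 1).

Definition effective (D : spec R -> int) : Prop := forall P, 0 <= D P.

Definition ideal_pow P (e : nat) : set R :=
  [set f | exists k (c : 'I_k -> R) (a : 'I_k -> 'I_e -> R),
    (forall i j, a i j \in ideal_of P) /\ f = \sum_i c i * \prod_j a i j].

(* P^e R_P `&` R: when R_P is a discrete valuation ring, the f of valuation at
   least e. *)
Definition symbolic_pow P (e : nat) : set R :=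
  [set f | exists s, s \notin ideal_of P /\ ideal_pow P e (s * f)].

(* O(-D), for D effective. Since R need not be regular in codimension one, the
   condition ord_P f >= D P is imposed as f \in P^(D P) O_P; the two coincide
   if O_P is regular or D P = 1. *)
Definition divisor_ideal (D : spec R -> int) : set R :=
  [set f | forall P, 0 < D P -> symbolic_pow P `|D P|%N f].

End Spec.

Local Notation "x %:F" := (@FracField.tofrac _ x).

Section LocalRing.
Variables (R : idomainType) (P : spec R).

Definition local_pred : {pred {fraction R}} := fun x =>
  `[< exists a s : R, s \notin ideal_of P /\ x = a%:F / s%:F >].

Lemma notin_mul s t : s \notin ideal_of P -> t \notin ideal_of P ->
  s * t \notin ideal_of P.
Proof.
have memE f : (f \in ideal_of P) = (f \in (P : PrimeIdealr.type R)) by [].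
by rewrite !memE prime_idealrM negb_or => -> ->.
Qed.

Lemma notin_neq0 s : s \notin ideal_of P -> s%:F != 0.
Proof.
rewrite tofrac_eq0; apply: contraNneq => ->.
exact: (@rpred0 _ (P : PrimeIdealr.type R)).
Qed.

Lemma local_subring_closed : subring_closed local_pred.
Proof.
split.
- apply/asboolP; exists 1, 1; split; last by rewrite divr1.
  by apply/negP => P1; move: (idealr1 (P : PrimeIdealr.type R)); rewrite P1.
- move=> x y /asboolP[a [s [sP ->]]] /asboolP[b [t [tP ->]]].
  apply/asboolP; exists (a * t - b * s), (s * t).
  split; first exact: notin_mul.
  rewrite rmorphB !rmorphM /= -[- (_ / _)]mulNr addf_div ?notin_neq0 //.
  by rewrite mulNr.
- move=> x y /asboolP[a [s [sP ->]]] /asboolP[b [t [tP ->]]].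
  apply/asboolP; exists (a * b), (s * t).
  split; first exact: notin_mul.
  by rewrite !rmorphM /= mulf_div.
Qed.

HB.instance Definition _ := GRing.isSubringClosed.Build _ local_pred
  local_subring_closed.

(* O_P as a subring of the fraction field of the domain R *)
Record local_ring : Type := LocalRing {
  local_val :> {fraction R};
  _ : local_val \in local_pred }.

HB.instance Definition _ := [isSub for local_val].
HB.instance Definition _ := [Choice of local_ring by <:].
HB.instance Definition _ := [SubChoice_isSubComNzRing of local_ring by <:].

(* The image of I (x)_R O_P in O_P; this map is injective as O_P is flat. *)
Definition localized_ideal (I : set R) : set (local_ring^o) :=
  [set x | exists a s, [/\ I a, s \notin ideal_of P &
                         local_val x = a%:F / s%:F]].

Definition residue_field : choiceType :=
  quot_module (localized_ideal [set f | f \in ideal_of P]).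

End LocalRing.

Arguments localized_ideal {R} P I.

Section Naive.
Variables (RR : realType) (R : idomainType).
Implicit Types (I J : set R) (P : spec R).

Definition naive_at I J P : \bar RR :=
  (module_length RR (quot_module
     (localized_ideal P I `|` localized_ideal P J)) *
   (ln (#|` fset_set [set: residue_field P] |)%:R)%:E)%E.

(* All terms are nonnegative: the sum is the supremum of the finite sums. *)
Definition naive_on (p : nat) (W : set (spec R)) I J : \bar RR :=
  \esum_(P in [set P | [/\ W P, closed_point P & lies_over p P]])
    naive_at I J P.

End Naive.

(* Main.v *)
Require Import Defs.
From HB Require Import structures.
From mathcomp Require Import all_boot all_order all_algebra.
From mathcomp Require Import mpoly.
From mathcomp Require Import finmap boolp classical_sets functions cardinality fsbigop.
From mathcomp Require Import reals ereal esum exp.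
From mathcomp Require Import zify.

Set Implicit Arguments.
Unset Strict Implicit.
Unset Printing Implicit Defensive.

Import Order.TTheory GRing.Theory Num.Theory.

(** Let I = I_D + I_E.  A prime that contains I lies strictly above a component
    of D or of E, so that it is maximal ([intersection_closed]); hence R / I has
    dimension 0.  Its residue fields at the points over p are finite by Zariski's
    lemma, and its p-primary part is a finite ring, the product of the rings
    O_P / I O_P over the finitely many points P above I and p.  A finite module
    over a local ring with residue field of q elements has q ^ length elements
    ([length_exists]), so that the naive intersection number at P is the
    logarithm of the number of elements of O_P / I O_P ([naive_at_above]).  What
    has to be computed is therefore the order of the factor of R / I that belongs
    to V, and this order is a power of p.

    The algorithm searches for a certificate that makes this ring explicit
    ([verify]).  The certificate shows, by explicit linear combinations of the
    given generators, that p ^ k is in I + p ^ (k + 1) R and that every variable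
    satisfies X ^ (a + b) = X ^ a modulo J = I + p ^ (k + 1) R.  The first
    condition says that R / J is the whole p-primary part of R / I; the second
    one makes Z[X] / J a quotient of the finite ring whose elements are the
    polynomials with coefficients below p ^ (k + 1) and exponents below a + b.
    In that finite ring all questions are settled by enumeration, membership
    in J included ([in_idealP]).  For a finite set T of elements let Gamma_T be
    the set of the x in R / J that are killed by a power of each t in T: it is
    the product of the components at the points where T vanishes
    ([torsion_index]).  So the component of a piece, where A vanishes and B does
    not, has order #Gamma_A / #Gamma_(A ++ B), and the certificate is accepted with
    the answer N when the product of these quotients is p ^ N.

    A certificate always exists.  If no p ^ k * (1 - p * r) were in I, then some
    prime above I would be disjoint from the multiplicative set of these elements
    and could not be maximal ([stable_exists]).  If f(x) were outside of J for
    all monic f in Z[T], then some prime above J would be disjoint from the set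
    of the f(x), and x would not be integral over Z in its residue field, against
    [zariski] ([integral_mod_ideal]); monic equations make R / J finite, and then
    the powers of the variables become periodic ([cycle_exists]).

    Total functions that are partial recursive are handled through codes of
    structured data ([computable]), so that the program is an ordinary function
    on lists, and the search is one application of minimization
    ([search_certificate]). *)

(** * Total recursive functions *)


Definition total_pr k (f : k.-tuple nat -> nat) : Prop :=
  partial_recursive (fun v y => y = f v).
Definition unary (f : nat -> nat) : Prop :=
  total_pr (fun v : 1.-tuple nat => f (thead v)).
Definition binary (f : nat -> nat -> nat) : Prop :=
  total_pr (fun v : 2.-tuple nat => f (tnth v ord0) (tnth v ord_max)).

Lemma pr_ext k (P Q : k.-tuple nat -> nat -> Prop) :
  (forall v y, P v y <-> Q v y) -> partial_recursive P -> partial_recursive Q.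
Proof.
move=> PQ; suff -> : P = Q by [].
by apply/funext => v; apply/funext => y; apply/propext.
Qed.

Lemma total_ext k (f g : k.-tuple nat -> nat) : f =1 g -> total_pr f -> total_pr g.
Proof. by move=> fg; apply: pr_ext => v y; rewrite fg. Qed.

Lemma total_comp k l (f : l.-tuple nat -> nat) (g : 'I_l -> k.-tuple nat -> nat) :
  total_pr f -> (forall i, total_pr (g i)) ->
  total_pr (fun v => f [tuple g i v | i < l]).
Proof.
move=> prf prg; apply: pr_ext (PR_comp prf prg) => v y; split.
  case=> w [wE ->]; congr f; apply/eq_from_tnth => i.
  by rewrite tnth_mktuple wE.
by move=> ->; exists [tuple g i v | i < l]; split=> // i; rewrite tnth_mktuple.
Qed.

Lemma total_proj k (i : 'I_k) : total_pr (fun v => tnth v i).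
Proof. exact: PR_proj. Qed.

Lemma total_unary k (f : nat -> nat) (g : k.-tuple nat -> nat) :
  unary f -> total_pr g -> total_pr (fun v => f (g v)).
Proof.
move=> uf tg; have := total_comp uf (fun=> tg).
by apply: total_ext => v; congr f; rewrite /thead tnth_mktuple.
Qed.

Lemma total_binary k (f : nat -> nat -> nat) (g h : k.-tuple nat -> nat) :
  binary f -> total_pr g -> total_pr h -> total_pr (fun v => f (g v) (h v)).
Proof.
move=> bf tg th.
have := total_comp (g := fun i v => if i == ord0 then g v else h v) bf _.
have tgh (i : 'I_2) : total_pr (fun v => if i == ord0 then g v else h v).
  by case: (i == ord0).
by move=> /(_ tgh); apply: total_ext => v; rewrite !tnth_mktuple.
Qed.

Lemma binary_rec (h : nat -> nat -> nat) (f : nat -> nat)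
    (g : nat -> nat -> nat -> nat) :
  unary f ->
  total_pr (fun v : 3.-tuple nat => g (tnth v ord0)
     (tnth v (lift ord0 ord0)) (tnth v ord_max)) ->
  (forall x, h 0 x = f x) -> (forall n x, h n.+1 x = g n (h n x) x) -> binary h.
Proof.
move=> uf tg h0 hS; apply: pr_ext (PR_rec uf tg) => v y.
have -> : tnth v ord_max = thead [tuple of behead v].
  by rewrite /thead tnth_behead; congr tnth; apply: val_inj; rewrite /= inordK.
rewrite -/(thead v); elim: (thead v) y => [|m IH] y.
  by rewrite h0.
rewrite hS; set w := [tuple of behead v]; rewrite -/w in IH *.
have gE r : g (tnth [tuple of [:: m, r & w]] ord0)
    (tnth [tuple of [:: m, r & w]] (lift ord0 ord0))
    (tnth [tuple of [:: m, r & w]] ord_max) = g m r (thead w).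
  by rewrite /thead !(tnth_nth 0).
split; first by move=> [z [/IH -> ->]]; rewrite gE.
by move=> ->; exists (h m (thead w)); split; [exact/IH | rewrite gE].
Qed.

Lemma unary_id : unary id.
Proof. exact: total_proj. Qed.

Lemma unary_succ : unary S.
Proof. exact: PR_succ. Qed.

Lemma total_const k c : total_pr (fun _ : k.-tuple nat => c).
Proof.
elim: c => [|c IH]; first exact: PR_zero.
exact: total_unary unary_succ IH.
Qed.

Lemma unary_const c : unary (fun=> c).
Proof. exact: total_const. Qed.

Lemma unary_comp f g : unary f -> unary g -> unary (f \o g).
Proof. exact: total_unary. Qed.

Lemma unary_binary f g h : binary f -> unary g -> unary h ->
  unary (fun x => f (g x) (h x)).
Proof. exact: total_binary. Qed.

Lemma binary_swap f : binary f -> binary (fun x y => f y x).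
Proof.
by move=> bf; apply: total_binary bf _ _; apply: total_proj.
Qed.

Lemma binary_add : binary addn.
Proof.
apply: (@binary_rec _ id (fun _ r _ => r.+1)) => //; first exact: unary_id.
by apply: total_unary; [exact: unary_succ | exact: total_proj].
Qed.

Lemma binary_mul : binary muln.
Proof.
apply: (@binary_rec _ (fun=> 0) (fun _ r x => x + r)) => //.
- exact: unary_const.
- by apply: total_binary binary_add _ _; apply: total_proj.
Qed.

Lemma unary_pred : unary predn.
Proof.
have: binary (fun n _ => n.-1).
  apply: (@binary_rec _ (fun=> 0) (fun n _ _ => n)) => //.
    exact: unary_const.
  exact: total_proj.
by move/unary_binary; apply; apply: unary_id.
Qed.

Lemma binary_sub : binary subn.
Proof.
suff: binary (fun n x => x - n) by exact: binary_swap.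
apply: (@binary_rec _ id (fun _ r _ => r.-1)) => [||x|n x].
- exact: unary_id.
- by apply: total_unary; [exact: unary_pred | exact: total_proj].
- by rewrite subn0.
- by rewrite subnS.
Qed.

Lemma unary_odd : unary (fun x => odd x).
Proof.
have: binary (fun n _ => odd n).
  apply: (@binary_rec _ (fun=> 0) (fun _ r _ => 1 - r)) => [|||n x] //=.
  - exact: unary_const.
  - by apply: total_binary binary_sub _ _; [exact: total_const|exact: total_proj].
  - by case: (odd n).
by move/unary_binary; apply; apply: unary_id.
Qed.

Lemma unary_half : unary half.
Proof.
have: binary (fun n _ => n./2).
  apply: (@binary_rec _ (fun=> 0) (fun n r _ => odd n + r)) => [|||n x] //=.
  - exact: unary_const.
  - apply: total_binary binary_add _ _; last exact: total_proj.
    by apply: total_unary unary_odd _; apply: total_proj.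
  - by rewrite uphalf_half.
by move/unary_binary; apply; apply: unary_id.
Qed.

Lemma unary_exp2 : unary (expn 2).
Proof.
have: binary (fun n _ => 2 ^ n).
  apply: (@binary_rec _ (fun=> 1) (fun n r _ => r + r)) => [|||n x] //=.
  - exact: unary_const.
  - by apply: total_binary binary_add _ _; apply: total_proj.
  - by rewrite expnS mul2n addnn.
by move/unary_binary; apply; apply: unary_id.
Qed.

(* The case distinction is written with truncated subtraction. *)
Lemma unary_if (c f g : nat -> nat) : unary c -> unary f -> unary g ->
  unary (fun x => if c x is 0 then f x else g x).
Proof.
move=> uc uf ug.
suff: unary (fun x => (1 - c x) * f x + (1 - (1 - c x)) * g x).
  apply: total_ext => v; case: (c (thead v)) => [|n].
    by rewrite subnn mul0n addn0 mul1n.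
  by rewrite subSS sub0n mul0n mul1n.
have u1 : unary (fun x => 1 - c x).
  by apply: unary_binary binary_sub _ _ => //; apply: unary_const.
apply: unary_binary binary_add _ _.
  exact: unary_binary binary_mul u1 uf.
apply: unary_binary binary_mul _ ug.
by apply: unary_binary binary_sub _ u1; apply: unary_const.
Qed.

(** * Pairing, iteration and lists on codes *)

(** This bijection is chosen so that the successor of a pair is the code of a
   nonempty list: see [code_cons]. *)
Definition cpair a b := (2 ^ a * b.*2.+1).-1.
Definition cfst z := head 0 (CodeSeq.decode z.+1).
Definition csnd z := CodeSeq.code (behead (CodeSeq.decode z.+1)).

Lemma cpairS a b : (cpair a b).+1 = 2 ^ a * b.*2.+1.
Proof. by rewrite prednK // muln_gt0 expn_gt0. Qed.

Lemma code_cons a s : CodeSeq.code (a :: s) = (cpair a (CodeSeq.code s)).+1.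
Proof. by rewrite cpairS. Qed.

Lemma decode_cpair a b :
  CodeSeq.decode (cpair a b).+1 = a :: CodeSeq.decode b.
Proof. by rewrite -{1}[b]CodeSeq.decodeK -code_cons CodeSeq.codeK. Qed.

Lemma cpairK1 a b : cfst (cpair a b) = a.
Proof. by rewrite /cfst decode_cpair. Qed.

Lemma cpairK2 a b : csnd (cpair a b) = b.
Proof. by rewrite /csnd decode_cpair /= CodeSeq.decodeK. Qed.

Lemma cpairK z : cpair (cfst z) (csnd z) = z.
Proof.
apply: succn_inj; rewrite -code_cons -[RHS]CodeSeq.decodeK /cfst.
by case: CodeSeq.decode (CodeSeq.decodeK z.+1).
Qed.

Lemma binary_cpair : binary cpair.
Proof.
apply: total_unary unary_pred _; apply: total_binary binary_mul _ _.
  by apply: total_unary unary_exp2 _; apply: total_proj.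
apply: total_unary unary_succ _.
apply: total_ext (_ : total_pr (fun v => tnth v ord_max + tnth v ord_max)).
  by move=> v; rewrite addnn.
by apply: total_binary binary_add _ _; apply: total_proj.
Qed.

(** The pair (a, b) has code z with z + 1 = 2 ^ a * (2 * b + 1): iterated halving
   of z + 1 recovers its odd part, and the number of halvings recovers a. *)
Definition halve x := if odd x then x else x./2.

Lemma unary_halve : unary halve.
Proof.
have := unary_if unary_odd unary_half unary_id.
by apply: total_ext => v; rewrite /halve; case: (odd _).
Qed.

Lemma iter_halve i a b :
  iter i halve (2 ^ a * b.*2.+1) = 2 ^ (a - i) * b.*2.+1.
Proof.
elim: i => [|i IH]; first by rewrite subn0.
rewrite iterS {}IH subnS /halve; case: (a - i) => [|c].
  by rewrite mul1n /= odd_double.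
by rewrite expnS -mulnA mul2n odd_double doubleK.
Qed.

Lemma binary_iter f : unary f -> binary (fun n x => iter n f x).
Proof.
move=> uf; apply: (@binary_rec _ id (fun _ r _ => f r)) => //.
  exact: unary_id.
by apply: total_unary uf _; apply: total_proj.
Qed.

Lemma csndE z : csnd z = (iter z halve z.+1)./2.
Proof.
rewrite -(cpairK z); set a := cfst z; set b := csnd z.
rewrite cpairK2 cpairS iter_halve.
have: a <= cpair a b.
  by rewrite -ltnS cpairS (leq_trans (ltn_expl a (isT : 1 < 2))) // leq_pmulr.
by move/eqP => ->; rewrite mul1n /= uphalf_double.
Qed.

Lemma unary_csnd : unary csnd.
Proof.
apply: total_ext (_ : total_pr (fun v => (iter (thead v) halve (thead v).+1)./2)).
  by move=> v; rewrite csndE.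
apply: total_unary unary_half _.
apply: total_binary (binary_iter unary_halve) _ _; first exact: total_proj.
by apply: total_unary unary_succ _; apply: total_proj.
Qed.

(* The number of halvings that are possible is the exponent of 2. *)
Fixpoint halvings i x := if i is j.+1 then
  (1 - odd (iter j halve x)) + halvings j x else 0.

Lemma halvingsE i a b : halvings i (2 ^ a * b.*2.+1) = minn i a.
Proof.
elim: i => [|i IH] /=; first by rewrite min0n.
rewrite iter_halve {}IH oddM oddX /= odd_double andbT.
by case: (ltngtP a i); lia.
Qed.

Lemma unary_cfst : unary cfst.
Proof.
have bh : binary halvings.
  apply: (@binary_rec _ (fun=> 0)
     (fun n r x => (1 - odd (iter n halve x)) + r)) => //.
    exact: unary_const.
  apply: total_binary binary_add _ _; last exact: total_proj.
  apply: total_binary binary_sub _ _; first exact: total_const.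
  apply: total_unary unary_odd _.
  by apply: total_binary (binary_iter unary_halve) _ _; apply: total_proj.
apply: total_ext (_ : total_pr (fun v => halvings (thead v) (thead v).+1)).
  move=> v; rewrite -(cpairK (thead v)); move: (cfst _) (csnd _) => a b.
  rewrite cpairK1 cpairS halvingsE; apply/minn_idPr.
  by rewrite -ltnS cpairS (leq_trans (ltn_expl a (isT : 1 < 2))) // leq_pmulr.
apply: total_binary bh _ _; first exact: total_proj.
by apply: total_unary unary_succ _; apply: total_proj.
Qed.

Lemma unary_pair f g : unary f -> unary g -> unary (fun x => cpair (f x) (g x)).
Proof. exact: unary_binary binary_cpair. Qed.

Lemma unary_iter f n i : unary f -> unary n -> unary i ->
  unary (fun x => iter (n x) f (i x)).
Proof. by move=> uf; apply: unary_binary (binary_iter uf). Qed.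

(** * Computable functions between encoded types *)

Class Enc (A : Type) := enc : A -> nat.

#[export] Instance enc_nat : Enc nat := id.
#[export] Instance enc_bool : Enc bool := nat_of_bool.
#[export] Instance enc_pair A B {EA : Enc A} {EB : Enc B} : Enc (A * B) :=
  fun t => cpair (enc t.1) (enc t.2).
#[export] Instance enc_seq A {EA : Enc A} : Enc (seq A) :=
  fun s => CodeSeq.code (map enc s).

Lemma enc_cons A {EA : Enc A} (a : A) (s : seq A) :
  enc (a :: s) = (cpair (enc a) (enc s)).+1.
Proof. exact: code_cons. Qed.

(** The code of f(a) is obtained from the code of a by a total recursive
   function; nothing is required of numbers that are not codes. *)
Definition computable A B {EA : Enc A} {EB : Enc B} (f : A -> B) : Prop :=
  exists2 g, unary g & forall a, g (enc a) = enc (f a).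

Section Combinators.
Context {E : Type} {EE : Enc E}.

Lemma comp_id : computable (fun e : E => e).
Proof. by exists id => //; apply: unary_id. Qed.

Lemma comp_const {A} {EA : Enc A} (a : A) : computable (fun _ : E => a).
Proof. by exists (fun=> enc a) => //; apply: unary_const. Qed.

Lemma comp_pair {A B} {EA : Enc A} {EB : Enc B} (f : E -> A) (g : E -> B) :
  computable f -> computable g -> computable (fun e => (f e, g e)).
Proof.
move=> [f' uf fE] [g' ug gE]; exists (fun x => cpair (f' x) (g' x)).
  exact: unary_pair.
by move=> a; rewrite fE gE.
Qed.

Lemma comp_comp {A B} {EA : Enc A} {EB : Enc B} (f : A -> B) (g : E -> A) :
  computable f -> computable g -> computable (fun e => f (g e)).
Proof.
move=> [f' uf fE] [g' ug gE]; exists (f' \o g'); first exact: unary_comp.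
by move=> a; rewrite /= gE fE.
Qed.

Lemma comp_fst {A B} {EA : Enc A} {EB : Enc B} (f : E -> A * B) :
  computable f -> computable (fun e => (f e).1).
Proof.
move=> cf; apply: (comp_comp (f := fst)) cf; exists cfst; first exact: unary_cfst.
by case=> a b; rewrite cpairK1.
Qed.

Lemma comp_snd {A B} {EA : Enc A} {EB : Enc B} (f : E -> A * B) :
  computable f -> computable (fun e => (f e).2).
Proof.
move=> cf; apply: (comp_comp (f := snd)) cf; exists csnd; first exact: unary_csnd.
by case=> a b; rewrite cpairK2.
Qed.

Lemma comp_unary (f : nat -> nat) (g : E -> nat) :
  unary f -> computable g -> computable (fun e => f (g e)).
Proof. by move=> uf; apply: comp_comp; exists f. Qed.

Lemma comp_binary (f : nat -> nat -> nat) (g h : E -> nat) :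
  binary f -> computable g -> computable h -> computable (fun e => f (g e) (h e)).
Proof.
move=> bf [g' ug gE] [h' uh hE]; exists (fun x => f (g' x) (h' x)).
  exact: unary_binary.
by move=> a; rewrite gE hE.
Qed.

Lemma comp_natb (b : E -> bool) :
  computable b -> computable (fun e => b e : nat).
Proof. by move=> [b' ub bE]; exists b'. Qed.

Lemma comp_gt0 (f : E -> nat) : computable f -> computable (fun e => 0 < f e).
Proof.
move=> [f' uf fE]; exists (fun x => 1 - (1 - f' x)).
  apply: unary_binary binary_sub _ _; first exact: unary_const.
  by apply: unary_binary binary_sub _ uf; apply: unary_const.
by move=> a; rewrite fE; case: (f a) => //= n; rewrite /enc /enc_nat /= subSS.
Qed.

Lemma comp_eq (f g : E -> nat) :
  computable f -> computable g -> computable (fun e => f e == g e).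
Proof.
move=> cf cg.
have [h uh hE] : computable (fun e => 1 - ((f e - g e) + (g e - f e))).
  apply: comp_binary binary_sub _ _; first exact: comp_const.
  by apply: comp_binary binary_add _ _; apply: comp_binary binary_sub _ _.
exists h => // a; rewrite hE /enc /enc_nat /enc_bool.
by case: (ltngtP (f a) (g a)) => /=; lia.
Qed.

Lemma comp_if {A} {EA : Enc A} (b : E -> bool) (f g : E -> A) :
  computable b -> computable f -> computable g ->
  computable (fun e => if b e then f e else g e).
Proof.
move=> [b' ub bE] [f' uf fE] [g' ug gE].
exists (fun x => if b' x is 0 then g' x else f' x); first exact: unary_if.
by move=> a; rewrite bE fE gE; case: (b a).
Qed.

Lemma comp_and (b c : E -> bool) :
  computable b -> computable c -> computable (fun e => b e && c e).
Proof.
by move=> cb cc; apply: comp_if cb cc _; apply: comp_const.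
Qed.

Lemma comp_cons {A} {EA : Enc A} (f : E -> A) (g : E -> seq A) :
  computable f -> computable g -> computable (fun e => f e :: g e).
Proof.
move=> [f' uf fE] [g' ug gE]; exists (fun x => (cpair (f' x) (g' x)).+1).
  by apply: unary_comp unary_succ _; apply: unary_pair.
by move=> a; rewrite fE gE enc_cons.
Qed.

Lemma comp_behead {A} {EA : Enc A} (f : E -> seq A) :
  computable f -> computable (fun e => behead (f e)).
Proof.
move=> [f' uf fE]; exists (fun x => if f' x is 0 then 0 else csnd (f' x).-1).
  apply: (unary_if uf); first exact: unary_const.
  exact: unary_comp unary_csnd (unary_comp unary_pred uf).
move=> a; rewrite fE; case: (f a) => //= x s.
by rewrite enc_cons /= cpairK2.
Qed.

(** The default value has to be the one of code 0, as the empty list. *)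
Lemma comp_head {A} {EA : Enc A} (x0 : A) (f : E -> seq A) :
  enc x0 = 0 -> computable f -> computable (fun e => head x0 (f e)).
Proof.
move=> x00 [f' uf fE]; exists (fun x => if f' x is 0 then 0 else cfst (f' x).-1).
  apply: (unary_if uf); first exact: unary_const.
  exact: unary_comp unary_cfst (unary_comp unary_pred uf).
move=> a; rewrite fE; case: (f a) => //= x s.
by rewrite enc_cons /= cpairK1.
Qed.

(* The iterated state is the code of the pair of e and the current value. *)
Lemma comp_iter {C} {EC : Enc C} (n : E -> nat) (i : E -> C) (b : E -> C -> C) :
  computable n -> computable i -> computable (fun t : E * C => b t.1 t.2) ->
  computable (fun e => iter (n e) (b e) (i e)).
Proof.
move=> [n' un nE] [i' ui iE] [b' ub bE].
pose step s := cpair (cfst s) (b' s).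
have ustep : unary step by exact: unary_pair unary_cfst ub.
exists (fun x => csnd (iter (n' x) step (cpair x (i' x)))).
  apply: unary_comp unary_csnd _; apply: (unary_iter ustep un).
  exact: unary_pair unary_id ui.
move=> e; rewrite nE iE.
have -> m : iter m step (cpair (enc e) (enc (i e))) =
    cpair (enc e) (enc (iter m (b e) (i e))).
  elim: m => //= m ->; rewrite /step cpairK1.
  by have /= <- := bE (e, iter m (b e) (i e)).
by rewrite cpairK2.
Qed.

(* The state is the code of (e, (accumulator, list to be read)); the number of
   steps only has to be at least the length of the list. *)
Lemma comp_foldl {A C} {EA : Enc A} {EC : Enc C} (l : E -> seq A) (i : E -> C)
    (b : E -> A -> C -> C) :
  computable l -> computable i ->
  computable (fun t : E * (A * C) => b t.1 t.2.1 t.2.2) ->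
  computable (fun e => foldl (fun c a => b e a c) (i e) (l e)).
Proof.
move=> [l' ul lE] [i' ui iE] [b' ub bE].
pose rest s := csnd (csnd s).
pose step s := if rest s is 0 then s else
  cpair (cfst s)
    (cpair (b' (cpair (cfst s) (cpair (cfst (rest s).-1) (cfst (csnd s)))))
           (csnd (rest s).-1)).
have urest : unary rest by exact: unary_comp unary_csnd unary_csnd.
have urestp : unary (fun s => (rest s).-1) by exact: unary_comp unary_pred urest.
have ustep : unary step.
  apply: unary_if urest unary_id _; apply: unary_pair unary_cfst _.
  apply: unary_pair; last exact: unary_comp unary_csnd urestp.
  apply: unary_comp ub _; apply: unary_pair unary_cfst _.
  apply: unary_pair; first exact: unary_comp unary_cfst urestp.
  exact: unary_comp unary_cfst unary_csnd.
exists (fun x => cfst (csnd (iter (l' x) step (cpair x (cpair (i' x) (l' x)))))).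
  apply: unary_comp unary_cfst _; apply: unary_comp unary_csnd _.
  apply: (unary_iter ustep ul); apply: unary_pair unary_id _.
  exact: unary_pair ui ul.
move=> e.
have size_enc (s : seq A) : size s <= enc s.
  elim: s => //= a s IH; rewrite enc_cons ltnS (leq_trans IH) //.
  rewrite -ltnS cpairS; have := expn_gt0 2 (enc a); nia.
have step_nil c m : iter m step (cpair (enc e) (cpair (enc c) 0)) =
    cpair (enc e) (cpair (enc c) 0).
  by elim: m => // m IHm; rewrite iterS IHm /step /rest !cpairK2.
have stepE c a (s : seq A) :
    step (cpair (enc e) (cpair (enc c) (enc (a :: s)))) =
    cpair (enc e) (cpair (enc (b e a c)) (enc s)).
  rewrite /step /rest !cpairK2 enc_cons /= !(cpairK1, cpairK2).
  by have /= <- := bE (e, (a, c)).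
have loop n (s : seq A) c : size s <= n ->
    cfst (csnd (iter n step (cpair (enc e) (cpair (enc c) (enc s))))) =
    enc (foldl (fun c a => b e a c) c s).
  elim: n s c => [|n IH] [|a s] c //= le; first by rewrite cpairK2 cpairK1.
    by rewrite -iterS step_nil cpairK2 cpairK1.
  by rewrite -iterS iterSr stepE IH.
by rewrite lE iE loop ?size_enc.
Qed.

End Combinators.

(** * Computable operations on lists *)

Lemma comp_rev {E} {EE : Enc E} {A} {EA : Enc A} (l : E -> seq A) :
  computable l -> computable (fun e => rev (l e)).
Proof.
move=> cl.
have -> : (fun e => rev (l e)) = fun e => foldl (fun c a => a :: c) [::] (l e).
  apply/funext => e; rewrite /rev; elim: (l e) [::] => //= x s IH acc.
apply: (comp_foldl (b := fun _ a c => a :: c)) => //; first exact: comp_const.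
by apply: comp_cons; [apply: comp_fst|apply: comp_snd]; apply: comp_snd;
  apply: comp_id.
Qed.

Lemma comp_foldr {E} {EE : Enc E} {A C} {EA : Enc A} {EC : Enc C} (l : E -> seq A) (i : E -> C)
    (b : E -> A -> C -> C) :
  computable l -> computable i ->
  computable (fun t : E * (A * C) => b t.1 t.2.1 t.2.2) ->
  computable (fun e => foldr (b e) (i e) (l e)).
Proof.
move=> cl ci cb.
have -> : (fun e => foldr (b e) (i e) (l e)) =
    fun e => foldl (fun c a => b e a c) (i e) (rev (l e)).
  by apply/funext => e; rewrite foldl_rev.
exact: comp_foldl (comp_rev cl) ci cb.
Qed.

Lemma comp_map {E} {EE : Enc E} {A B} {EA : Enc A} {EB : Enc B} (l : E -> seq A) (f : E -> A -> B) :
  computable l -> computable (fun t : E * A => f t.1 t.2) ->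
  computable (fun e => map (f e) (l e)).
Proof.
move=> cl cf; have -> : (fun e => map (f e) (l e)) =
    fun e => foldr (fun x acc => f e x :: acc) [::] (l e).
  by apply/funext => e; elim: (l e) => //= x s ->.
apply: (comp_foldr (b := fun e x acc => f e x :: acc)) => //.
  exact: comp_const.
apply: comp_cons; last by apply: comp_snd; apply: comp_snd; apply: comp_id.
apply: (comp_comp (f := fun t => f t.1 t.2) (g := fun t => (t.1, t.2.1))) cf _.
by apply: comp_pair; [| apply: comp_fst; apply: comp_snd]; [apply: comp_fst|];
  apply: comp_id.
Qed.

Lemma comp_cat {E} {EE : Enc E} {A} {EA : Enc A} (f g : E -> seq A) :
  computable f -> computable g -> computable (fun e => f e ++ g e).
Proof.
move=> cf cg; have -> : (fun e => f e ++ g e) =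
    fun e => foldr cons (g e) (f e).
  by apply/funext => e; elim: (f e) => //= x s ->.
apply: (comp_foldr (b := fun _ => cons)) => //.
by apply: comp_cons; [apply: comp_fst|apply: comp_snd]; apply: comp_snd;
  apply: comp_id.
Qed.

Lemma comp_flatten {E} {EE : Enc E} {A} {EA : Enc A} (f : E -> seq (seq A)) :
  computable f -> computable (fun e => flatten (f e)).
Proof.
move=> cf; apply: (comp_foldr (b := fun _ => cat)) => //; first exact: comp_const.
by apply: comp_cat; [apply: comp_fst|apply: comp_snd]; apply: comp_snd;
  apply: comp_id.
Qed.

Lemma comp_size {E} {EE : Enc E} {A} {EA : Enc A} (f : E -> seq A) :
  computable f -> computable (fun e => size (f e)).
Proof.
move=> cf; have -> : (fun e => size (f e)) =
    fun e => foldr (fun _ n => n.+1) 0 (f e).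
  by apply/funext => e; elim: (f e) => //= x s ->.
apply: (comp_foldr (b := fun _ _ n => n.+1)) => //; first exact: comp_const.
apply: comp_unary; first exact: unary_succ.
by do 2!apply: comp_snd; apply: comp_id.
Qed.

Lemma comp_sumn {E} {EE : Enc E} (f : E -> seq nat) :
  computable f -> computable (fun e => sumn (f e)).
Proof.
move=> cf; apply: (comp_foldr (b := fun _ => addn)) => //; first exact: comp_const.
by apply: comp_binary binary_add _ _; [apply: comp_fst|apply: comp_snd];
  apply: comp_snd; apply: comp_id.
Qed.

Lemma comp_prodn {E} {EE : Enc E} (f : E -> seq nat) :
  computable f -> computable (fun e => foldr muln 1 (f e)).
Proof.
move=> cf; apply: (comp_foldr (b := fun _ => muln)) => //; first exact: comp_const.
by apply: comp_binary binary_mul _ _; [apply: comp_fst|apply: comp_snd];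
  apply: comp_snd; apply: comp_id.
Qed.

Lemma comp_all {E} {EE : Enc E} {A} {EA : Enc A} (l : E -> seq A) (f : E -> A -> bool) :
  computable l -> computable (fun t : E * A => f t.1 t.2) ->
  computable (fun e => all (f e) (l e)).
Proof.
move=> cl cf; have -> : (fun e => all (f e) (l e)) =
    fun e => sumn (map (fun x => if f e x then 0 else 1) (l e)) == 0.
  apply/funext => e; elim: (l e) => //= x s ->.
  by case: (f e x).
apply: comp_eq; last exact: comp_const.
apply: comp_sumn; apply: (comp_map (f := fun e x => if f e x then 0 else 1)) => //.
by apply: (comp_if cf); apply: comp_const.
Qed.

Lemma comp_has {E} {EE : Enc E} {A} {EA : Enc A} (l : E -> seq A) (f : E -> A -> bool) :
  computable l -> computable (fun t : E * A => f t.1 t.2) ->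
  computable (fun e => has (f e) (l e)).
Proof.
move=> cl cf; have -> : (fun e => has (f e) (l e)) =
    fun e => 0 < sumn (map (fun x => f e x : nat) (l e)).
  by apply/funext => e; elim: (l e) => //= x s ->; case: (f e x).
apply: comp_gt0; apply: comp_sumn.
by apply: (comp_map (f := fun e x => f e x : nat)) => //; apply: comp_natb.
Qed.

Lemma comp_count {E} {EE : Enc E} {A} {EA : Enc A} (l : E -> seq A) (f : E -> A -> bool) :
  computable l -> computable (fun t : E * A => f t.1 t.2) ->
  computable (fun e => count (f e) (l e)).
Proof.
move=> cl cf; have -> : (fun e => count (f e) (l e)) =
    fun e => sumn (map (fun x => f e x : nat) (l e)).
  by apply/funext => e; elim: (l e) => //= x s ->.
apply: comp_sumn.
by apply: (comp_map (f := fun e x => f e x : nat)) => //; apply: comp_natb.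
Qed.

Lemma comp_nth {E} {EE : Enc E} {A} {EA : Enc A} (x0 : A) (l : E -> seq A) (i : E -> nat) :
  enc x0 = 0 -> computable l -> computable i ->
  computable (fun e => nth x0 (l e) (i e)).
Proof.
move=> x00 cl ci; have -> : (fun e => nth x0 (l e) (i e)) =
    fun e => head x0 (iter (i e) behead (l e)).
  apply/funext => e; rewrite -nth0 -drop_behead nth_drop addn0.
  by [].
apply: comp_head x00 _; apply: (comp_iter (b := fun _ => behead)) => //.
by apply: comp_behead; apply: comp_snd; apply: comp_id.
Qed.

Lemma comp_nseq {E} {EE : Enc E} {A} {EA : Enc A} (n : E -> nat) (x : E -> A) :
  computable n -> computable x -> computable (fun e => nseq (n e) (x e)).
Proof.
move=> cn cx; apply: (comp_iter (b := fun e => cons (x e))) => //.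
  exact: comp_const.
apply: comp_cons; last by apply: comp_snd; apply: comp_id.
by apply: (comp_comp cx); apply: comp_fst; apply: comp_id.
Qed.

Lemma comp_rcons {E} {EE : Enc E} {A} {EA : Enc A} (l : E -> seq A) (x : E -> A) :
  computable l -> computable x -> computable (fun e => rcons (l e) (x e)).
Proof.
move=> cl cx; have -> : (fun e => rcons (l e) (x e)) = fun e => l e ++ [:: x e].
  by apply/funext => e; rewrite cats1.
by apply: comp_cat cl _; apply: comp_cons cx _; apply: comp_const.
Qed.

Lemma comp_iota {E} {EE : Enc E} (n : E -> nat) :
  computable n -> computable (fun e => iota 0 (n e)).
Proof.
move=> cn; have -> : (fun e => iota 0 (n e)) =
    fun e => iter (n e) (fun s => rcons s (size s)) [::].
  apply/funext => e; elim: (n e) => // k IH.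
  by rewrite -addn1 iotaD add0n cats1 addn1 iterS -IH size_iota.
apply: (comp_iter (b := fun _ s => rcons s (size s))) => //.
  exact: comp_const.
apply: comp_rcons; last apply: comp_size; by apply: comp_snd; apply: comp_id.
Qed.

Lemma comp_exp {E} {EE : Enc E} (f g : E -> nat) :
  computable f -> computable g -> computable (fun e => f e ^ g e).
Proof.
move=> cf cg; have -> : (fun e => f e ^ g e) =
    fun e => iter (g e) (muln (f e)) 1.
  by apply/funext => e; rewrite iter_muln_1.
apply: (comp_iter (b := fun e => muln (f e))) => //; first exact: comp_const.
apply: comp_binary binary_mul _ _; last by apply: comp_snd; apply: comp_id.
by apply: (comp_comp cf); apply: comp_fst; apply: comp_id.
Qed.

(* The remainders of 0, 1, 2, ... modulo d are counted up to d and reset. *)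
Lemma comp_mod {E} {EE : Enc E} (f g : E -> nat) :
  computable f -> computable g -> computable (fun e => f e %% g e).
Proof.
move=> cf cg; have -> : (fun e => f e %% g e) =
    fun e => iter (f e) (fun r => if r.+1 == g e then 0 else r.+1) 0.
  apply/funext => e; move: (f e) (g e) => x d; elim: x => [|x IH] /=.
    by rewrite mod0n.
  rewrite -IH; case: d {IH} => [|d]; first by rewrite !modn0.
  have -> : ((x %% d.+1).+1 == d.+1) = (d.+1 %| x.+1).
    rewrite {2}(divn_eq x d.+1) -addnS dvdn_addr ?dvdn_mull //.
    have := ltn_pmod x (isT : 0 < d.+1); rewrite -ltnS ltnS leq_eqVlt.
    case/orP => [/eqP ->|lt]; first by rewrite eqxx dvdnn.
    by rewrite gtnNdvd // ltn_eqF.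
  by rewrite modnS.
apply: (comp_iter (b := fun e r => if r.+1 == g e then 0 else r.+1)) => //.
  exact: comp_const.
have cS : computable (fun t : E * nat => t.2.+1).
  by apply: comp_unary unary_succ _; apply: comp_snd; apply: comp_id.
apply: comp_if; [|exact: comp_const|exact: cS].
by apply: (comp_eq cS); apply: (comp_comp cg); apply: comp_fst; apply: comp_id.
Qed.

Lemma comp_leq {E} {EE : Enc E} (f g : E -> nat) :
  computable f -> computable g -> computable (fun e => f e <= g e).
Proof.
move=> cf cg; apply: (comp_eq (f := fun e => f e - g e)); last exact: comp_const.
exact: comp_binary binary_sub cf cg.
Qed.

(** * The program *)

(** Polynomials are lists of terms (coefficient, exponents) with natural
   coefficients, which are read modulo m = p ^ (k + 1); a term may be repeated. *)
Definition tpoly : Type := seq (nat * seq nat).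

(** The exponent of a power of an element x with x ^ (a + b) = x ^ a.  For b = 0
   it is e itself, since e %% 0 = e; so b = 0 stands for exact exponents. *)
Definition red a b e := if e < a + b then e else a + (e - a) %% b.

Definition same_mon n a b (e e' : seq nat) :=
  all (fun i => red a b (nth 0 e i) == red a b (nth 0 e' i)) (iota 0 n).

Definition ncoef n a b (e : seq nat) (s : tpoly) : nat :=
  sumn (map (fun t => if same_mon n a b t.2 e then t.1 else 0) s).

(** All coefficients are 0 modulo m once the terms are collected along [red]. *)
Definition vanishes n m a b (s : tpoly) :=
  all (fun t => ncoef n a b t.2 s %% m == 0) s.

Definition mul_term n (t u : nat * seq nat) : nat * seq nat :=
  (t.1 * u.1, map (fun i => nth 0 t.2 i + nth 0 u.2 i) (iota 0 n)).

Definition mul_tpoly n (s s' : tpoly) : tpoly :=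
  flatten (map (fun t => map (fun u => mul_term n t u) s') s).

Definition exp_tpoly n k (s : tpoly) : tpoly :=
  iter k (fun r => mul_tpoly n s r) [:: (1, [::])].

Definition lincomb n (cs G : seq tpoly) : tpoly :=
  flatten (map (fun i => mul_tpoly n (nth [::] cs i) (nth [::] G i))
    (iota 0 (size G))).

(** The Cartesian product of the lists in ls *)
Definition choices T (ls : seq (seq T)) : seq (seq T) :=
  foldr (fun l L => flatten (map (fun x => map (fun s => x :: s) L) l))
    [:: [::]] ls.

Definition normal_forms n m a b : seq tpoly :=
  choices (map (fun e => map (fun c => (c, e)) (iota 0 m))
    (choices (nseq n (iota 0 (a + b))))).

Definition combinations n (G Q : seq tpoly) : seq tpoly :=
  map flatten (choices (map (fun g => map (fun q => mul_tpoly n q g) Q) G)).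

(* S is closed under negation modulo the relations, so that f + s can replace
   f - s. *)
Definition in_ideal n m a b (S : seq tpoly) (f : tpoly) :=
  has (fun s => vanishes n m a b (f ++ s)) S.

(** The number of normal forms that are killed by a power of every element of T.
   The exponent #Q is large enough, as a ring of at most #Q elements has no
   longer strictly decreasing chain of powers. *)
Definition torsion_count n m a b (S Q T : seq tpoly) : nat :=
  count (fun q => all (fun t =>
    in_ideal n m a b S (mul_tpoly n (exp_tpoly n (size Q) t) q)) T) Q.

(* From [enc_int], where 2 * h encodes h and 2 * h + 1 encodes -(h + 1), to a
   natural number congruent modulo m *)
Definition residue m c := if odd c then c./2.+1 * m.-1 else c./2.

Definition to_tpoly m (r : seq (seq nat)) : tpoly :=
  map (fun t => (residue m (head 0 t), behead t)) r.

Definition polys : Type := seq (seq (seq nat)).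

Definition input : Type :=
  nat * (nat * (polys * (polys * (polys * seq (seq polys))))).
(** The answer N, then k, a, b and the coefficients of the linear combinations *)
Definition certificate : Type :=
  nat * (nat * (nat * (nat * seq (seq tpoly)))).

(** The combinations show that p ^ k and X_j ^ (a + b) - X_j ^ a, for every j, are
   in the ideal generated by G and m.  Only linear combinations with sum 0 are
   needed, since the coefficients absorb signs. *)
Definition finite_index n m a b k p (cof : seq (seq tpoly)) (G : seq tpoly) :=
  vanishes n m 0 0 ((p ^ k, [::]) :: lincomb n (nth [::] cof 0) G) &&
  all (fun j => vanishes n m 0 0
        ((1, rcons (nseq j 0) (a + b)) :: (m.-1, rcons (nseq j 0) a) ::
         lincomb n (nth [::] cof j.+1) G)) (iota 0 n).

(** For a piece where A vanishes and B does not, the points where A vanishes are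
   the disjoint union of the piece and of the points where A ++ B vanishes; so
   the order of the component of the piece is a quotient of two counts. *)
Definition counts_agree n m a b p N (S Q : seq tpoly) (V : seq (seq (seq tpoly))) :=
  foldr muln 1
    (map (fun t => torsion_count n m a b S Q (nth [::] t 0)) V) ==
  p ^ N * foldr muln 1
    (map (fun t => torsion_count n m a b S Q (nth [::] t 0 ++ nth [::] t 1)) V).

Definition generators m (x : input) : seq tpoly :=
  map (to_tpoly m) (x.2.2.1 ++ (x.2.2.2.1 ++ x.2.2.2.2.1)).

Definition verify_with (x : input) (c : certificate) m (G : seq tpoly)
    (Q : seq tpoly) : bool :=
  (0 < c.2.2.2.1) &&
  (finite_index x.2.1 m c.2.2.1 c.2.2.2.1 c.2.1 x.1 c.2.2.2.2 G &&
   counts_agree x.2.1 m c.2.2.1 c.2.2.2.1 x.1 c.1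
     (combinations x.2.1 G Q) Q
     (map (fun t => map (fun T => map (to_tpoly m) T) t) x.2.2.2.2.2)).

Definition verify (x : input) (c : certificate) : bool :=
  let m := x.1 ^ c.2.1.+1 in
  verify_with x c m (generators m x)
    (normal_forms x.2.1 m c.2.2.1 c.2.2.2.1).

Lemma comp_odd {E} {EE : Enc E} (f : E -> nat) :
  computable f -> computable (fun e => odd (f e)).
Proof.
move=> cf; apply: (comp_comp (f := odd)) cf; exists (fun x => odd x) => //.
exact: unary_odd.
Qed.

(* [comp_step] reads the head symbol of the body of a function; [comp_user] is
   extended with every definition once that definition is known computable. *)
Ltac comp_user := fail.
Ltac comp_step := cbv beta; lazymatch goal with
  | |- computable (fun e => e) => exact comp_id
  | |- computable (fun _ => ?c) => exact (comp_const c)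
  | |- computable (fun e => fst (@?f e)) => apply (comp_fst (f := f))
  | |- computable (fun e => snd (@?f e)) => apply (comp_snd (f := f))
  | |- computable (fun e => pair (@?f e) (@?g e)) => apply (comp_pair (f := f) (g := g))
  | |- computable (fun e => andb (@?b e) (@?c e)) => apply (comp_and (b := b) (c := c))
  | |- computable (fun e => addn (@?f e) (@?g e)) => apply (comp_binary binary_add (g := f) (h := g))
  | |- computable (fun e => muln (@?f e) (@?g e)) => apply (comp_binary binary_mul (g := f) (h := g))
  | |- computable (fun e => subn (@?f e) (@?g e)) => apply (comp_binary binary_sub (g := f) (h := g))
  | |- computable (fun e => expn (@?f e) (@?g e)) => apply (comp_exp (f := f) (g := g))
  | |- computable (fun e => modn (@?f e) (@?g e)) => apply (comp_mod (f := f) (g := g))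
  | |- computable (fun e => S (@?f e)) => apply (comp_unary unary_succ (g := f))
  | |- computable (fun e => predn (@?f e)) => apply (comp_unary unary_pred (g := f))
  | |- computable (fun e => half (@?f e)) => apply (comp_unary unary_half (g := f))
  | |- computable (fun e => odd (@?f e)) => apply (comp_odd (f := f))
  | |- computable (fun e => leq (S O) (@?f e)) => apply (comp_gt0 (f := f))
  | |- computable (fun e => leq (@?f e) (@?g e)) => apply (comp_leq (f := f) (g := g))
  | |- computable (fun e => eq_op (@?f e) (@?g e)) => apply (comp_eq (f := f) (g := g))
  | |- computable (fun e => cons (@?f e) (@?g e)) => apply (comp_cons (f := f) (g := g))
  | |- computable (fun e => behead (@?f e)) => apply (comp_behead (f := f))
  | |- computable (fun e => head ?x (@?f e)) => apply (comp_head (x0 := x) (f := f)); [reflexivity|]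
  | |- computable (fun e => nth ?x (@?l e) (@?i e)) =>
      apply (comp_nth (x0 := x) (l := l) (i := i)); [reflexivity| |]
  | |- computable (fun e => cat (@?f e) (@?g e)) => apply (comp_cat (f := f) (g := g))
  | |- computable (fun e => flatten (@?f e)) => apply (comp_flatten (f := f))
  | |- computable (fun e => size (@?f e)) => apply (comp_size (f := f))
  | |- computable (fun e => sumn (@?f e)) => apply (comp_sumn (f := f))
  | |- computable (fun e => iota 0 (@?f e)) => apply (comp_iota (n := f))
  | |- computable (fun e => nseq (@?n e) (@?f e)) => apply (comp_nseq (n := n) (x := f))
  | |- computable (fun e => rcons (@?n e) (@?f e)) => apply (comp_rcons (l := n) (x := f))
  | |- computable (fun e => foldr muln 1 (@?f e)) => apply (comp_prodn (f := f))
  | |- computable (fun e => foldr (@?b e) (@?i e) (@?l e)) =>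
     apply (comp_foldr (b := b) (i := i) (l := l))
  | |- computable (fun e => iter (@?n e) (@?b e) (@?i e)) =>
     apply (comp_iter (n := n) (b := b) (i := i))
  | |- computable (fun e => map (@?f e) (@?l e)) => apply (comp_map (f := f) (l := l))
  | |- computable (fun e => all (@?f e) (@?l e)) => apply (comp_all (f := f) (l := l))
  | |- computable (fun e => has (@?f e) (@?l e)) => apply (comp_has (f := f) (l := l))
  | |- computable (fun e => count (@?f e) (@?l e)) => apply (comp_count (f := f) (l := l))
  | |- computable ?f => first [assumption | comp_user | apply: comp_if]
  end.
Ltac comp := repeat comp_step.

Lemma computable_red : computable (fun t : nat * (nat * nat) => red t.1 t.2.1 t.2.2).
Proof. by rewrite /red; comp. Qed.

Ltac comp_user ::= lazymatch goal with
  | |- computable (fun e => red (@?a e) (@?b e) (@?c e)) =>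
    apply (comp_comp (f := fun t => red t.1 t.2.1 t.2.2)
     (g := fun e => (a e, (b e, c e))) computable_red) end.

Lemma computable_same_mon :
  computable (fun t : nat * (nat * (nat * (seq nat * seq nat))) =>
     same_mon t.1 t.2.1 t.2.2.1 t.2.2.2.1 t.2.2.2.2).
Proof. by rewrite /same_mon; comp. Qed.

Ltac comp_user ::= lazymatch goal with
  | |- computable (fun e => same_mon (@?n e) (@?a e) (@?b e) (@?c e) (@?d e)) =>
    apply (comp_comp (f := fun t => same_mon t.1 t.2.1 t.2.2.1 t.2.2.2.1 t.2.2.2.2)
     (g := fun e => (n e, (a e, (b e, (c e, d e))))) computable_same_mon) end.

Lemma computable_vanishes :
  computable (fun t : nat * (nat * (nat * (nat * tpoly))) =>
     vanishes t.1 t.2.1 t.2.2.1 t.2.2.2.1 t.2.2.2.2).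
Proof. by rewrite /vanishes /ncoef; comp. Qed.

Lemma computable_mul_tpoly :
  computable (fun t : nat * (tpoly * tpoly) => mul_tpoly t.1 t.2.1 t.2.2).
Proof. by rewrite /mul_tpoly /mul_term; comp. Qed.

Lemma computable_normal_forms :
  computable (fun t : nat * (nat * (nat * nat)) =>
    normal_forms t.1 t.2.1 t.2.2.1 t.2.2.2).
Proof. by rewrite /normal_forms /choices; comp. Qed.

Ltac comp_poly := lazymatch goal with
  | |- computable (fun e => vanishes (@?n e) (@?m e) (@?a e) (@?b e) (@?s e)) =>
    apply (comp_comp (f := fun t => vanishes t.1 t.2.1 t.2.2.1 t.2.2.2.1 t.2.2.2.2)
     (g := fun e => (n e, (m e, (a e, (b e, s e))))) computable_vanishes)
  | |- computable (fun e => mul_tpoly (@?n e) (@?s e) (@?r e)) =>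
    apply (comp_comp (f := fun t => mul_tpoly t.1 t.2.1 t.2.2)
     (g := fun e => (n e, (s e, r e))) computable_mul_tpoly)
  | |- computable (fun e => normal_forms (@?n e) (@?m e) (@?a e) (@?b e)) =>
    apply (comp_comp (f := fun t => normal_forms t.1 t.2.1 t.2.2.1 t.2.2.2)
     (g := fun e => (n e, (m e, (a e, b e)))) computable_normal_forms)
  end.
Ltac comp_user ::= comp_poly.

Lemma computable_exp_tpoly :
  computable (fun t : nat * (nat * tpoly) => exp_tpoly t.1 t.2.1 t.2.2).
Proof. by rewrite /exp_tpoly; comp. Qed.

Lemma computable_lincomb :
  computable (fun t : nat * (seq tpoly * seq tpoly) => lincomb t.1 t.2.1 t.2.2).
Proof. by rewrite /lincomb; comp. Qed.

Lemma computable_combinations :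
  computable (fun t : nat * (seq tpoly * seq tpoly) =>
    combinations t.1 t.2.1 t.2.2).
Proof. by rewrite /combinations /choices; comp. Qed.

Lemma computable_in_ideal :
  computable (fun t : nat * (nat * (nat * (nat * (seq tpoly * tpoly)))) =>
     in_ideal t.1 t.2.1 t.2.2.1 t.2.2.2.1 t.2.2.2.2.1 t.2.2.2.2.2).
Proof. by rewrite /in_ideal; comp. Qed.

Ltac comp_ideal := lazymatch goal with
  | |- computable (fun e => exp_tpoly (@?n e) (@?k e) (@?s e)) =>
    apply (comp_comp (f := fun t => exp_tpoly t.1 t.2.1 t.2.2)
     (g := fun e => (n e, (k e, s e))) computable_exp_tpoly)
  | |- computable (fun e => lincomb (@?n e) (@?k e) (@?s e)) =>
    apply (comp_comp (f := fun t => lincomb t.1 t.2.1 t.2.2)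
     (g := fun e => (n e, (k e, s e))) computable_lincomb)
  | |- computable (fun e => combinations (@?n e) (@?k e) (@?s e)) =>
    apply (comp_comp (f := fun t => combinations t.1 t.2.1 t.2.2)
     (g := fun e => (n e, (k e, s e))) computable_combinations)
  | |- computable (fun e => in_ideal (@?n e) (@?m e) (@?a e) (@?b e) (@?s e) (@?r e)) =>
    apply (comp_comp
     (f := fun t => in_ideal t.1 t.2.1 t.2.2.1 t.2.2.2.1 t.2.2.2.2.1 t.2.2.2.2.2)
     (g := fun e => (n e, (m e, (a e, (b e, (s e, r e)))))) computable_in_ideal)
  end.
Ltac comp_user ::= first [comp_poly | comp_ideal].

Lemma computable_torsion_count :
  computable (fun t : nat * (nat * (nat * (nat * (seq tpoly * (seq tpoly * seq tpoly))))) =>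
     torsion_count t.1 t.2.1 t.2.2.1 t.2.2.2.1 t.2.2.2.2.1 t.2.2.2.2.2.1
       t.2.2.2.2.2.2).
Proof. by rewrite /torsion_count; comp. Qed.

Lemma computable_finite_index :
  computable (fun t : nat * (nat * (nat * (nat * (nat * (nat * (seq (seq tpoly) * seq tpoly)))))) =>
     finite_index t.1 t.2.1 t.2.2.1 t.2.2.2.1 t.2.2.2.2.1 t.2.2.2.2.2.1
       t.2.2.2.2.2.2.1 t.2.2.2.2.2.2.2).
Proof. by rewrite /finite_index; comp. Qed.

Lemma computable_to_tpoly :
  computable (fun t : nat * seq (seq nat) => to_tpoly t.1 t.2).
Proof. by rewrite /to_tpoly /residue; comp. Qed.

Ltac comp_count := lazymatch goal with
  | |- computable (fun e => torsion_count (@?n e) (@?m e) (@?a e) (@?b e) (@?s e) (@?r e) (@?u e)) =>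
    apply (comp_comp
     (f := fun t => torsion_count t.1 t.2.1 t.2.2.1 t.2.2.2.1 t.2.2.2.2.1 t.2.2.2.2.2.1
       t.2.2.2.2.2.2)
     (g := fun e => (n e, (m e, (a e, (b e, (s e, (r e, u e))))))) computable_torsion_count)
  | |- computable (fun e => finite_index (@?n e) (@?m e) (@?a e) (@?b e) (@?k e) (@?p e) (@?c e) (@?s e)) =>
    apply (comp_comp
     (f := fun t => finite_index t.1 t.2.1 t.2.2.1 t.2.2.2.1 t.2.2.2.2.1 t.2.2.2.2.2.1
       t.2.2.2.2.2.2.1 t.2.2.2.2.2.2.2)
     (g := fun e => (n e, (m e, (a e, (b e, (k e, (p e, (c e, s e)))))))) computable_finite_index)
  | |- computable (fun e => to_tpoly (@?n e) (@?k e)) =>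
    apply (comp_comp (f := fun t => to_tpoly t.1 t.2)
     (g := fun e => (n e, k e)) computable_to_tpoly)
  end.
Ltac comp_user ::= first [comp_poly | comp_ideal | comp_count].

Lemma computable_verify_with :
  computable (fun t : input * (certificate * (nat * (seq tpoly * seq tpoly))) =>
    verify_with t.1 t.2.1 t.2.2.1 t.2.2.2.1 t.2.2.2.2).
Proof. by rewrite /verify_with /counts_agree; comp. Qed.

Lemma computable_generators :
  computable (fun t : nat * input => generators t.1 t.2).
Proof. by rewrite /generators; comp. Qed.

Lemma computable_verify : computable (fun t : certificate * input => verify t.2 t.1).
Proof.
have cx : computable (fun t : certificate * input => t.2) by comp.
have cc : computable (fun t : certificate * input => t.1) by comp.
have cm : computable (fun t : certificate * input => t.2.1 ^ t.1.2.1.+1) by comp.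
apply: (comp_comp (g := fun t => (t.2, (t.1, (t.2.1 ^ t.1.2.1.+1,
  (generators (t.2.1 ^ t.1.2.1.+1) t.2,
   normal_forms t.2.2.1 (t.2.1 ^ t.1.2.1.+1) t.1.2.2.1 t.1.2.2.2.1)))))
  computable_verify_with).
do 3 apply: comp_pair => //; apply: comp_pair; last by comp.
exact: (comp_comp computable_generators (comp_pair cm cx)).
Qed.

(** * Search for a certificate *)

Definition enc_onto A {EA : Enc A} : Prop := forall z, exists a : A, enc a = z.

Lemma enc_onto_nat : enc_onto (A := nat).
Proof. by move=> z; exists z. Qed.

Lemma enc_onto_pair A B {EA : Enc A} {EB : Enc B} :
  enc_onto (A := A) -> enc_onto (A := B) -> enc_onto (A := A * B).
Proof.
move=> oA oB z; have [a aE] := oA (cfst z); have [b bE] := oB (csnd z).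
by exists (a, b); rewrite /enc /enc_pair /= aE bE cpairK.
Qed.

Lemma enc_onto_seq A {EA : Enc A} : enc_onto (A := A) -> enc_onto (A := seq A).
Proof.
move=> oA z; rewrite -[z]CodeSeq.decodeK.
elim: (CodeSeq.decode z) => [|x s [t tE]]; first by exists [::].
by have [a aE] := oA x; exists (a :: t); rewrite enc_cons aE tE code_cons.
Qed.

Lemma certificate_onto : enc_onto (A := certificate).
Proof.
do 4 (apply: enc_onto_pair; first exact: enc_onto_nat).
do 3 apply: enc_onto_seq; apply: enc_onto_pair; first exact: enc_onto_nat.
apply: enc_onto_seq; exact: enc_onto_nat.
Qed.

(** Every number is the code of some a, so that minimization over all numbers
   finds the least code of an a that passes the check. *)
Lemma search_certificate A B {EA : Enc A} {EB : Enc B} (conv : nat -> nat)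
    (check : A -> B -> bool) (out : A -> nat) :
  unary conv -> computable (fun t : A * B => check t.1 t.2) -> computable out ->
  enc_onto (A := A) ->
  exists F : 1.-tuple nat -> nat -> Prop, partial_recursive F /\
    forall z b, conv z = enc b -> (exists a, check a b) ->
    exists2 a, check a b & F [tuple z] (out a).
Proof.
move=> uconv [g ug gE] [o uo oE] onto.
pose f (w : 2.-tuple nat) := 1 - g (cpair (tnth w ord0) (conv (tnth w ord_max))).
have tf : total_pr f.
  apply: (total_binary binary_sub); first exact: total_const.
  apply: (total_unary ug); apply: (total_binary binary_cpair).
    exact: total_proj.
  by apply: (total_unary uconv); exact: total_proj.
have fE z y b a : conv z = enc b -> y = enc a ->
    f [tuple of y :: [tuple z]] = ~~ check a b.
  move=> zb ya; rewrite /f !(tnth_nth 0) /= zb ya.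
  by have /= -> := gE (a, b); rewrite /enc /enc_bool; case: (check a b).
pose mu (v : 1.-tuple nat) y := 0 = f [tuple of y :: v] /\
  forall x, x < y -> exists u, u.+1 = f [tuple of x :: v].
exists (fun v y => exists w : 1.-tuple nat,
  (forall i : 'I_1, mu v (tnth w i)) /\ y = o (thead w)); split.
  exact: PR_comp uo (fun=> PR_mu tf).
move=> z b zb [a0 ca0].
have ex : exists y, f [tuple of y :: [tuple z]] == 0.
  by exists (enc a0); rewrite (fE _ _ b a0) // ca0.
have [y /eqP fy ymin] := ex_minnP ex; have [a ya] := onto y.
exists a; first by move: fy; rewrite (fE z y b a) //; case: (check a b).
exists [tuple y]; split; last by rewrite /thead (tnth_nth 0) /= -ya oE.
move=> i; rewrite (ord1 i); split=> [|x xy]; first by rewrite fy.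
have [a' xa'] := onto x; rewrite (fE _ _ b a') //.
case cab: (check a' b); last by exists 0.
by move: (ymin x); rewrite (fE _ _ b a') // cab leqNgt xy => /(_ isT).
Qed.

Definition raw (s : poly_data) : seq (seq nat) :=
  map (fun t => enc_int t.1 :: t.2) s.

Definition raw_input p n (rels gD gE : seq poly_data)
    (V : seq (seq poly_data * seq poly_data)) : input :=
  (p, (n, (map raw rels, (map raw gD, (map raw gE,
   map (fun t => [:: map raw t.1; map raw t.2]) V))))).

Lemma enc_seq_nat (l : seq nat) : enc l = CodeSeq.code l.
Proof. by rewrite /enc /enc_seq map_id. Qed.

Lemma enc_polyE s : enc_poly s = enc (raw s).
Proof.
rewrite /enc_poly /enc /enc_seq -map_comp; congr CodeSeq.code.
by apply: eq_map => t /=; rewrite enc_seq_nat.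
Qed.

Lemma enc_polysE s : enc_polys s = enc (map raw s).
Proof.
rewrite /enc_polys /enc /enc_seq -map_comp; congr CodeSeq.code.
by apply: eq_map => t /=; rewrite enc_polyE.
Qed.

(* Reads a list of six numbers as nested pairs. *)
Definition pairs_of_list z :=
  let hd z := cfst z.-1 in let tl z := csnd z.-1 in
  cpair (hd z) (cpair (hd (tl z)) (cpair (hd (tl (tl z)))
    (cpair (hd (tl (tl (tl z)))) (cpair (hd (tl (tl (tl (tl z)))))
      (hd (tl (tl (tl (tl (tl z)))))))))).

Lemma unary_pairs_of_list : unary pairs_of_list.
Proof.
have uh f : unary f -> unary (fun z => cfst (f z).-1).
  by move=> uf; exact: unary_comp unary_cfst (unary_comp unary_pred uf).
have ut f : unary f -> unary (fun z => csnd (f z).-1).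
  by move=> uf; exact: unary_comp unary_csnd (unary_comp unary_pred uf).
have u0 := unary_id; have u1 := ut _ u0; have u2 := ut _ u1; have u3 := ut _ u2.
have u4 := ut _ u3; have u5 := ut _ u4.
by do 5 (apply: unary_pair; first exact: uh); exact: uh.
Qed.

Lemma pairs_of_listE p n rels gD gE V :
  pairs_of_list (enc_input p n rels gD gE V) = enc (raw_input p n rels gD gE V).
Proof.
rewrite /pairs_of_list /enc_input !enc_polysE.
have -> : [seq CodeSeq.code [:: enc_polys t.1; enc_polys t.2] | t <- V] =
    map enc (map (fun t => [:: map raw t.1; map raw t.2]) V).
  by rewrite -map_comp; apply: eq_map => t /=; rewrite !enc_polysE.
by rewrite 6!code_cons !succnK !(cpairK1, cpairK2, succnK).
Qed.

Theorem intersection_algorithm :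
  exists F : 1.-tuple nat -> nat -> Prop, partial_recursive F /\
    forall p n rels gD gE V,
    (exists c, verify (raw_input p n rels gD gE V) c) ->
    exists2 c : certificate, verify (raw_input p n rels gD gE V) c &
      F [tuple enc_input p n rels gD gE V] c.1.
Proof.
have cout : computable (fun c : certificate => c.1) by comp.
have [F [prF FE]] := search_certificate (check := fun c x => verify x c)
  unary_pairs_of_list computable_verify cout certificate_onto.
exists F; split=> // p n rels gD gE V.
exact/FE/pairs_of_listE.
Qed.

Local Open Scope classical_set_scope.
Local Open Scope ring_scope.

(** * Indices of subgroups *)

Section Index.
Variable U : zmodType.
Implicit Types (H K : set U) (s : seq U).

Definition subgroup H := H 0 /\ forall x y, H x -> H y -> H (x - y).

Lemma subgroupN H x : subgroup H -> H x -> H (- x).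
Proof. by move=> [H0 HB] Hx; rewrite -sub0r; apply: HB. Qed.

Lemma subgroupD H x y : subgroup H -> H x -> H y -> H (x + y).
Proof.
by move=> gH Hx Hy; rewrite -[y]opprK; apply: gH.2 => //; apply: subgroupN.
Qed.

Lemma subgroup_sym H x y : subgroup H -> H (x - y) -> H (y - x).
Proof. by move=> gH /(subgroupN gH); rewrite opprB. Qed.

Lemma subgroup_trans H y x z : subgroup H -> H (x - y) -> H (y - z) -> H (x - z).
Proof. by move=> gH Hxy Hyz; rewrite -(subrKA y); apply: subgroupD. Qed.

Definition coset_reps H K s :=
  [/\ uniq s, {in s, forall x, H x}, {in s &, forall x y, K (x - y) -> x = y}
    & forall x, H x -> exists2 y, y \in s & K (x - y)].

(** Indices are a relation, which gives sense to finite indices of subgroups of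
   infinite groups without forming quotients. *)
Definition has_index H K n := K `<=` H /\ exists2 s, coset_reps H K s & size s = n.

End Index.

Lemma coset_reps_leq (U W : zmodType) (H K : set U) (H' K' : set W) s s'
    (f : U -> W) :
  subgroup K' -> coset_reps H K s -> coset_reps H' K' s' ->
  (forall x, H x -> H' (f x)) ->
  (forall x y, H x -> H y -> K' (f x - f y) -> K (x - y)) -> (size s <= size s')%N.
Proof.
move=> gK' [us sH sK _] [us' _ _ s'c] fH fK.
have /choice [g gP] : forall x, exists y, x \in s -> y \in s' /\ K' (f x - y).
  move=> x; case: (boolP (x \in s)) => [xs|]; last by exists 0.
  by have [y ys Ky] := s'c _ (fH _ (sH _ xs)); exists y.
rewrite -(size_map g); apply: uniq_leq_size; last first.
  by move=> _ /mapP[x xs ->]; have [] := gP _ xs.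
rewrite map_inj_in_uniq // => x y xs ys gxy.
apply: sK => //; apply: fK; [exact: sH | exact: sH |].
have [_ Kx] := gP _ xs; have [_ Ky] := gP _ ys.
by apply: subgroup_trans Kx _ => //; rewrite gxy; apply: subgroup_sym.
Qed.

Lemma index_unique (U : zmodType) (H K : set U) m n :
  subgroup K -> has_index H K m -> has_index H K n -> m = n.
Proof.
move=> gK [_ [s ts <-]] [_ [t tt <-]]; apply/eqP; rewrite eqn_leq.
by rewrite (coset_reps_leq (f := id) gK ts tt) ?(coset_reps_leq (f := id) gK tt ts).
Qed.

(** f induces an isomorphism from H / K to H' / K'. *)
Lemma index_transfer (U W : zmodType) (H K : set U) (H' K' : set W) n (f : U -> W) :
  subgroup K' -> K' `<=` H' -> K 0 ->
  (forall x, H x -> H' (f x)) ->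
  (forall x y, H x -> H y -> K' (f x - f y) <-> K (x - y)) ->
  (forall y, H' y -> exists2 x, H x & K' (y - f x)) ->
  has_index H K n -> has_index H' K' n.
Proof.
move=> gK' K'H' K0 fH fK fc [KH [s [us sH sK sc] <-]]; split=> //.
exists (map f s); last by rewrite size_map.
have finj : {in s &, injective f}.
  move=> x y xs ys fxy; apply: sK => //; apply/fK; [exact: sH|exact: sH|].
  by rewrite fxy subrr; apply: gK'.1.
split.
- by rewrite map_inj_in_uniq.
- by move=> _ /mapP[x xs ->]; apply/fH/sH.
- move=> _ _ /mapP[x xs ->] /mapP[y ys ->] /fK Kxy.
  by congr f; apply: sK => //; apply: Kxy; exact: sH.
- move=> y /fc[x Hx Kx]; have [z zs Kz] := sc x Hx.
  exists (f z); first exact: map_f.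
  by apply: subgroup_trans Kx _ => //; apply/fK => //; apply: sH.
Qed.

Section IndexTheory.
Variable U : zmodType.
Implicit Types (H K : set U) (s : seq U).

(** The sums of representatives of H / K and of K / L represent H / L. *)
Lemma index_mul (H K L : set U) m n : subgroup H -> subgroup K -> subgroup L ->
  has_index H K m -> has_index K L n -> has_index H L (m * n).
Proof.
move=> gH gK gL [KH [s [us sH sK sc] <-]] [LK [t [ut tK tL tc] <-]].
split; first by move=> x /LK/KH.
exists [seq x + y | x <- s, y <- t]; last by rewrite size_allpairs.
have eqs x x' y y' : x \in s -> x' \in s -> y \in t -> y' \in t ->
    L (x + y - (x' + y')) -> x = x' /\ y = y'.
  move=> xs xs' yt yt' Lxy.
  have xx' : x = x'.
    apply: sK => //.
    have -> : x - x' = x + y - (x' + y') - (y - y').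
      by rewrite (opprD x') addrACA addrK.
    by apply: gK.2; [exact: LK | apply: gK.2; apply: tK].
  split=> //; apply: tL => //; move: Lxy.
  by rewrite xx' opprD addrACA subrr add0r.
split.
- apply: allpairs_uniq => // -[x y] [x' y'] /= /allpairsP[[a b] /= [as_ bt [-> ->]]].
  move=> /allpairsP[[a' b'] /= [as' bt' [-> ->]]] e.
  have [] // := eqs a a' b b' => //; last by move=> -> ->.
  by rewrite e subrr; apply: gL.1.
- move=> _ /allpairsP[[x y] /= [xs yt ->]]; apply: subgroupD => //; first exact: sH.
  by apply/KH/tK.
- move=> _ _ /allpairsP[[x y] /= [xs yt ->]] /allpairsP[[x' y'] /= [xs' yt' ->]].
  by move=> /eqs[] // -> ->.
- move=> z /sc[x xs] /tc[y yt]; rewrite -addrA -opprD => Lz.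
  by exists (x + y) => //; apply/allpairsP; exists (x, y).
Qed.

Lemma index_exists H K s : subgroup H -> subgroup K -> K `<=` H ->
  (forall x, H x -> exists2 y, y \in s & K (x - y)) -> exists n, has_index H K n.
Proof.
move=> gH gK KH sc.
have [t tH tc] : exists2 t : seq U, {in t, forall x, H x} &
    forall x, H x -> exists2 y, y \in t & K (x - y).
  suff [t tH tc] : exists2 t : seq U, {in t, forall x, H x} & forall x, H x ->
      forall y, y \in s -> K (x - y) -> exists2 z, z \in t & K (x - z).
    by exists t => // x Hx; have [y ys Ky] := sc x Hx; apply: tc Hx y ys Ky.
  elim: {sc}s => [|y s [t tH tc]]; first by exists [::].
  have [[a [Ha Ka]]|no] := pselect (exists a, H a /\ K (a - y)).
    exists (a :: t) => [x|x Hx z]; first by rewrite inE => /predU1P[->|/tH].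
    rewrite inE => /predU1P[->|zs] Kx.
      exists a; first exact: mem_head.
      by apply: subgroup_trans Kx _ => //; apply: subgroup_sym.
    by have [w wt Kw] := tc x Hx z zs Kx; exists w => //; rewrite inE wt orbT.
  exists t => // x Hx z; rewrite inE => /predU1P[-> Kx|]; last exact: tc.
  by case: no; exists x.
suff [r [ur rH rK rc]] : exists r : seq U, [/\ uniq r, {in r, forall x, H x},
   {in r &, forall x y, K (x - y) -> x = y} &
   {in t, forall x, exists2 y, y \in r & K (x - y)}].
  exists (size r); split=> //; exists r => //; split=> // x Hx.
  have [y yt Ky] := tc x Hx; have [z zr Kz] := rc y yt.
  by exists z => //; apply: subgroup_trans Ky Kz.
elim: {tc}t tH => [|y t IH] tH; first by exists [::].
have [|r [ur rH rK rc]] := IH; first by move=> x xt; apply: tH; rewrite inE xt orbT.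
have [[z zr Kz]|no] := pselect (exists2 z, z \in r & K (y - z)).
  exists r; split=> // x; rewrite inE => /predU1P[->|/rc //]; by exists z.
have Hy : H y by apply: tH; exact: mem_head.
exists (y :: r); split.
- rewrite /= ur andbT; apply/negP => yr; apply: no; exists y => //.
  by rewrite subrr; apply: gK.1.
- by move=> x; rewrite inE => /predU1P[->|/rH].
- move=> x x'; rewrite !inE => /predU1P[->|xr] /predU1P[->|xr'] //.
  + by move=> Kx; case: no; exists x'.
  + by move=> Kx; case: no; exists x => //; apply: subgroup_sym.
  + exact: rK.
- move=> x; rewrite inE => /predU1P[->|/rc[z zr Kz]].
    by exists y; [exact: mem_head | rewrite subrr; apply: gK.1].
  by exists z => //; rewrite inE zr orbT.
Qed.

Lemma index_between (H K H' K' : set U) n : has_index H K n ->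
  subgroup H' -> subgroup K' -> K `<=` K' -> K' `<=` H' -> H' `<=` H ->
  exists m, has_index H' K' m.
Proof.
move=> [_ [s [_ _ _ sc] _]] gH' gK' KK' K'H' H'H.
apply: (index_exists (s := s)) => // x /H'H/sc[y ys /KK']; by exists y.
Qed.

Lemma index_gt0 H K n : subgroup H -> has_index H K n -> (0 < n)%N.
Proof.
move=> [H0 _] [_ [s [_ _ _ sc] <-]]; have [y] := sc 0 H0.
by case: s {sc}.
Qed.

Lemma index_refl H : subgroup H -> has_index H H 1.
Proof.
move=> gH; split=> //; exists [:: 0] => //; split=> //.
- by move=> x; rewrite inE => /eqP ->; apply: gH.1.
- by move=> x y; rewrite !inE => /eqP -> /eqP ->.
- by move=> x Hx; exists 0; rewrite ?mem_head // subr0.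
Qed.

Lemma index1_sub H K : subgroup H -> subgroup K -> has_index H K 1 -> H `<=` K.
Proof.
move=> gH gK [KH [[|a [|b s]] // [_ _ _ sc] _]] x Hx.
have [y] := sc x Hx; rewrite inE => /eqP -> Kxa.
have [z] := sc 0 gH.1; rewrite inE => /eqP ->; rewrite sub0r => KNa.
by rewrite -[x](subrK a); apply: subgroupD => //; rewrite -[a]opprK; apply: subgroupN.
Qed.

(** A system of representatives of H / K contains one of every intermediate
   L / K: this turns indices into counts of list elements. *)
Lemma coset_reps_filter H K (L : set U) s :
  K `<=` L -> L `<=` H -> subgroup L -> coset_reps H K s ->
  coset_reps L K [seq x <- s | `[< L x >]].
Proof.
move=> KL LH gL [us sH sK sc]; split.
- exact: filter_uniq.
- by move=> x; rewrite mem_filter => /andP[/asboolP].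
- by move=> x y; rewrite !mem_filter => /andP[_ xs] /andP[_ ys]; apply: sK.
- move=> x Lx; have [y ys Kxy] := sc x (LH _ Lx); exists y => //.
  rewrite mem_filter ys andbT; apply/asboolP.
  by rewrite -[y](subKr x); apply: gL.2 => //; apply: KL.
Qed.

End IndexTheory.

(** * Length of finite modules over a local ring *)

Section Length.
Variables (A : comNzRingType) (M : lmodType A).
Implicit Types (H : set M) (P : set A).

Definition submodule H := [/\ H 0, forall x y, H x -> H y -> H (x + y)
  & forall a x, H x -> H (a *: x)].

Lemma submodule_subgroup H : submodule H -> subgroup H.
Proof.
move=> [H0 HD HZ]; split=> // x y Hx Hy; apply: HD => //.
by rewrite -scaleN1r; apply: HZ.
Qed.

(* H + A x *)
Definition add_cyclic H x : set M := [set y | exists a, H (y - a *: x)].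

Lemma add_cyclic_submodule H x : submodule H -> submodule (add_cyclic H x).
Proof.
move=> [H0 HD HZ]; split.
- by exists 0; rewrite scale0r subr0.
- move=> y z [a Ha] [b Hb]; exists (a + b).
  by rewrite scalerDl opprD addrACA; apply: HD.
- by move=> c y [a Ha]; exists (c * a); rewrite -scalerA -scalerBr; apply: HZ.
Qed.

Lemma add_cyclic_sub H x : H `<=` add_cyclic H x.
Proof. by move=> y Hy; exists 0; rewrite scale0r subr0. Qed.

Lemma add_cyclic_min H H' x : submodule H' -> H `<=` H' -> H' x ->
  add_cyclic H x `<=` H'.
Proof.
move=> [_ HD HZ] HH' Hx y [a Ha]; rewrite -[y](subrK (a *: x)).
by apply: HD; [apply: HH' | apply: HZ].
Qed.

Lemma add_cyclic_mem H x : submodule H -> add_cyclic H x x.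
Proof. by move=> [H0 _ _]; exists 1; rewrite scale1r subrr. Qed.

Variables (P : set A) (q : nat) (B : set M).
Hypothesis idealP : forall a b, P b -> P (a * b).
Hypothesis subgroupP : subgroup P.
Hypothesis indexP : has_index [set: A] P q.
Hypothesis maximalP : forall a, ~ P a -> exists t, P (1 - a * t).
(* Elements of 1 + P act on M / B as units: this replaces the assumption that
   A is local, so that A can be R itself, or the integers when p ^ j kills
   M / B. *)
Hypothesis localB : forall a, P a -> exists t, forall x, B (x - (t * (1 - a)) *: x).
Hypothesis q_gt1 : (1 < q)%N.

Lemma local_absorb H a x : submodule H -> B `<=` H -> P a ->
  H (x - a *: x) -> H x.
Proof.
move=> [H0 HD HZ] BH Pa Hax; have [t Bt] := localB Pa.
rewrite -[x](subrK ((t * (1 - a)) *: x)); apply: HD; first exact/BH/Bt.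
by rewrite -scalerA scalerBl scale1r; apply: HZ.
Qed.

(** Among the x in H' outside H, one with the least index of H in H + A x is
   killed by P modulo H, so that (H + A x) / H is isomorphic to A / P. *)
Lemma simple_step H H' n : submodule H -> submodule H' -> B `<=` H ->
  has_index H' H n -> (1 < n)%N ->
  exists H'', [/\ submodule H'', H `<=` H'', H'' `<=` H' & has_index H'' H q].
Proof.
move=> mH mH' BH iH n_gt1.
have [gH gH'] := (submodule_subgroup mH, submodule_subgroup mH').
have [HH' _] := iH.
have ix x : H' x -> exists m, has_index (add_cyclic H x) H m.
  move=> H'x; apply: (index_between iH) => //.
  - exact/submodule_subgroup/add_cyclic_submodule.
  - exact: add_cyclic_sub.
  - exact: add_cyclic_min.
have ex : exists m, `[< exists x, [/\ H' x, ~ H x & has_index (add_cyclic H x) H m] >].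
  have [x [H'x nHx]] : exists x, H' x /\ ~ H x.
    apply: contrapT => no.
    have H'H : H' `<=` H.
      by move=> x H'x; apply: contrapT => nHx; apply: no; exists x.
    have HE : H' = H by apply/seteqP.
    rewrite HE in iH.
    by move: n_gt1; rewrite (index_unique gH iH (index_refl gH)).
  by have [m im] := ix x H'x; exists m; apply/asboolP; exists x.
have [m /asboolP[x [H'x nHx im]] mmin] := ex_minnP ex.
have Px a : P a -> H (a *: x).
  move=> Pa; apply: contrapT => nHax.
  have H'ax : H' (a *: x) by case: mH' => _ _; apply.
  have [k ik] := ix _ H'ax.
  have le_mk : (m <= k)%N by apply: mmin; apply/asboolP; exists (a *: x).
  have mHx := add_cyclic_submodule x mH.
  have mHax := add_cyclic_submodule (a *: x) mH.
  have gHx := submodule_subgroup mHx; have gHax := submodule_subgroup mHax.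
  have sub : add_cyclic H (a *: x) `<=` add_cyclic H x.
    apply: add_cyclic_min => //; first exact: add_cyclic_sub.
    by case: mHx => _ _; apply; apply: add_cyclic_mem.
  have [l il] : exists l, has_index (add_cyclic H x) (add_cyclic H (a *: x)) l.
    by apply: (index_between im) => //; exact: add_cyclic_sub.
  have mE := index_unique gH im (index_mul gHx gHax gH il ik).
  have k0 := index_gt0 gHax ik; have l0 := index_gt0 gHx il.
  have l1 : l = 1%N by nia.
  rewrite l1 in il.
  have [b Hb] := index1_sub gHx gHax il (add_cyclic_mem x mH).
  by apply: nHx; apply: (@local_absorb H (b * a)); rewrite // -?scalerA //; apply: idealP.
exists (add_cyclic H x); split.
- exact: add_cyclic_submodule.
- exact: add_cyclic_sub.
- exact: add_cyclic_min.
apply: (index_transfer (f := fun a => a *: x)) indexP => //.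
- exact: add_cyclic_sub.
- exact: subgroupP.1.
- by move=> a _; exists a; rewrite subrr; apply: gH.1.
- move=> a b _ _; rewrite -scalerBl; split; last exact: Px.
  move=> Hab; apply: contrapT => nPab; have [t Pt] := maximalP nPab.
  apply: nHx; apply: (local_absorb mH BH Pt).
  rewrite scalerBl scale1r subKr mulrC -scalerA.
  by case: mH => _ _; apply.
- by move=> y [a Ha]; exists a.
Qed.

(** By induction on the index, with a simple step at the bottom: a composition
   series of length d gives n = q ^ d. *)
Lemma length_exists H H' n : submodule H -> submodule H' -> B `<=` H ->
  has_index H' H n ->
  exists d (c : nat -> set M), [/\ n = (q ^ d)%N, c 0%N = H, c d = H' &
   forall i, submodule (c i)] /\ forall i, (i < d)%N -> has_index (c i.+1) (c i) q.
Proof.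
elim/ltn_ind: n H => n IH H mH mH' BH iH.
have [gH gH'] := (submodule_subgroup mH, submodule_subgroup mH').
have n0 := index_gt0 gH' iH.
case: (ltngtP n 1) => n1; first by lia.
  have [H'' [mH'' HH'' H''H' iH'']] := simple_step mH mH' BH iH n1.
  have gH'' := submodule_subgroup mH''.
  have [l il] : exists l, has_index H' H'' l by apply: (index_between iH).
  have nE := index_unique gH iH (index_mul gH' gH'' gH il iH'').
  have l0 := index_gt0 gH' il.
  have ltn : (l < n)%N by rewrite nE; nia.
  have [|d [c [[lE c0 cd mc] ci]]] := IH l ltn H'' mH'' mH' _ il.
    by move=> x /BH/HH''.
  exists d.+1, (fun i => if i is j.+1 then c j else H).
  split; last by case=> [|i] /= lt; [rewrite c0 | apply: ci].
  by split=> //; [rewrite nE lE expnS mulnC | case].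
rewrite n1 in iH; have HE : H = H'.
  by apply/seteqP; split; [exact: iH.1 | exact: index1_sub].
exists 0%N, (fun=> H); split=> //; split=> //; by rewrite n1.
Qed.

Lemma strict_index_ge H H' n : submodule H -> submodule H' -> B `<=` H ->
  has_index H' H n -> ~ H' `<=` H -> (q <= n)%N.
Proof.
move=> mH mH' BH iH nsub; have gH := submodule_subgroup mH.
have [d [c [[nE c0 cd mc] ci]]] := length_exists mH mH' BH iH.
case: d nE cd ci => [|d] nE cd ci; first by case: nsub; rewrite -cd c0.
by rewrite nE expnS leq_pmulr // expn_gt0; lia.
Qed.

(** Every strict inclusion has index at least q. *)
Lemma chain_length H' n d (c : nat -> set M) : submodule H' -> has_index H' B n ->
  submodule B ->
  (forall i, (i <= d)%N -> [/\ submodule (c i), B `<=` c i & c i `<=` H']) ->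
  (forall i, (i < d)%N -> c i `<=` c i.+1 /\ ~ c i.+1 `<=` c i) ->
  (q ^ d <= n)%N.
Proof.
move=> mH' iH mB cP cs.
have gB := submodule_subgroup mB; have gH' := submodule_subgroup mH'.
suff bound i : (i <= d)%N -> exists2 m, has_index (c i) B m & (q ^ i <= m)%N.
  have [m im le] := bound d (leqnn d).
  have [md Bcd cdH'] := cP d (leqnn d).
  have [l il] : exists l, has_index H' (c d) l.
    by apply: (index_between iH) => //; exact: submodule_subgroup.
  have gd := submodule_subgroup md.
  rewrite (index_unique gB iH (index_mul gH' gd gB il im)).
  by apply: (leq_trans le); rewrite leq_pmull // (index_gt0 gH' il).
elim: i => [|i IHi] id.
  have [m0 B0 c0H'] := cP 0%N id.
  have [m im] : exists m, has_index (c 0%N) B m.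
    by apply: (index_between iH) => //; exact: submodule_subgroup.
  exists m => //; rewrite expn0; apply: index_gt0 im; exact: submodule_subgroup.
have [m im le] := IHi (ltnW id).
have [mi Bi ciH'] := cP i (ltnW id); have [mi1 Bi1 ci1H'] := cP i.+1 id.
have [gi gi1] := (submodule_subgroup mi, submodule_subgroup mi1).
have [sub nsub] := cs i id.
have [l il] : exists l, has_index (c i.+1) (c i) l by apply: (index_between iH).
exists (l * m)%N; first exact: index_mul il im.
by rewrite expnS leq_mul // (strict_index_ge mi mi1 Bi il).
Qed.

End Length.

(** * Ideals and prime avoidance *)

Section PrimeOfSet.
Variables (R : comNzRingType) (A : set R).

Definition pred_of_ideal (_ : idealr_closed (fun x => `[< A x >]))
  (_ : prime_idealr_closed (fun x => `[< A x >])) : {pred R} := fun x => `[< A x >].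

Variables (iA : idealr_closed (fun x => `[< A x >]))
  (pA : prime_idealr_closed (fun x => `[< A x >])).

HB.instance Definition _ := isIdealr.Build R (pred_of_ideal iA pA) iA.
HB.instance Definition _ :=
  isPrimeIdealrClosed.Build R (pred_of_ideal iA pA) pA.

Definition spec_of_set : spec R := PrimeIdealr.clone R (pred_of_ideal iA pA) _.

End PrimeOfSet.

(** The structure of a prime ideal on a predicate consists of proofs. *)
Lemma spec_ext (R : comNzRingType) (P Q : spec R) :
  (forall x, (x \in ideal_of P) = (x \in ideal_of Q)) -> P = Q.
Proof.
move=> PQ; have : (P : R -> bool) = (Q : R -> bool).
  by apply/funext => x; exact: PQ.
case: P Q {PQ} => [P cP] [Q cQ] /= PQ; move: cP cQ; rewrite PQ => cP cQ.
congr PrimeIdealr.Pack.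
case: cP cQ => [[a1] [a2] [a3] [a4]] [[b1] [b2] [b3] [b4]].
by congr PrimeIdealr.Class; [congr Algebra.isOppClosed.Axioms_ |
  congr Algebra.isAddClosed.Axioms_ | congr isProperIdeal.Axioms_ |
  congr isPrimeIdealrClosed.Axioms_]; apply: Prop_irrelevance.
Qed.

Section Ideals.
Variable R : comNzRingType.
Implicit Types (I J : set R) (P Q : spec R).

Definition ideal I := [/\ I 0, forall x y, I x -> I y -> I (x + y)
  & forall a x, I x -> I (a * x)].

Lemma ideal_subgroup I : ideal I -> subgroup I.
Proof. exact: (@submodule_subgroup R R^o). Qed.

Lemma idealB I x y : ideal I -> I x -> I y -> I (x - y).
Proof. by move=> iI Ix Iy; apply: (ideal_subgroup iI).2. Qed.

Lemma ideal_mulr I x a : ideal I -> I x -> I (x * a).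
Proof. by move=> [_ _ IM] Ix; rewrite mulrC; apply: IM. Qed.

Lemma ideal_sum I (T : Type) (r : seq T) (F : T -> R) : ideal I ->
  (forall i, I (F i)) -> I (\sum_(i <- r) F i).
Proof. by move=> [I0 ID _] IF; apply: big_ind => // i _; apply: IF. Qed.

Definition prime_set P : set R := [set x | x \in ideal_of P].

Lemma prime_mul P x y :
  (x * y \in ideal_of P) = (x \in ideal_of P) || (y \in ideal_of P).
Proof. exact: (@prime_idealrM _ (P : PrimeIdealr.type R)). Qed.

Lemma prime_set_ideal P : ideal (prime_set P).
Proof.
split.
- exact: (@rpred0 _ (P : PrimeIdealr.type R)).
- exact: (@rpredD _ (P : PrimeIdealr.type R)).
- by move=> a x; rewrite /prime_set /= prime_mul => ->; rewrite orbT.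
Qed.

Lemma prime1 P : 1 \notin ideal_of P.
Proof. by apply/negP => P1; move: (idealr1 (P : PrimeIdealr.type R)); rewrite P1. Qed.

Lemma prime_exp P x n : x ^+ n \in ideal_of P -> x \in ideal_of P.
Proof.
elim: n => [|n IH]; first by rewrite expr0 (negbTE (prime1 P)).
by rewrite exprS prime_mul => /orP[].
Qed.

Lemma idealD I J : ideal I -> ideal J ->
  ideal [set x | exists y z, [/\ I y, J z & x = y + z]].
Proof.
move=> [I0 ID IM] [J0 JD JM]; split.
- by exists 0, 0; rewrite addr0.
- move=> _ _ [a [b [Ia Jb ->]]] [c [d [Ic Jd ->]]]; exists (a + c), (b + d).
  by rewrite addrACA; split=> //; [apply: ID|apply: JD].
- move=> c _ [a [b [Ia Jb ->]]]; exists (c * a), (c * b).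
  by rewrite mulrDr; split=> //; [apply: IM|apply: JM].
Qed.

Definition principal u : set R := [set x | exists a, x = a * u].

Lemma principal_ideal u : ideal (principal u).
Proof.
split; first by exists 0; rewrite mul0r.
- by move=> _ _ [a ->] [b ->]; exists (a + b); rewrite mulrDl.
- by move=> c _ [a ->]; exists (c * a); rewrite mulrA.
Qed.

Definition ideal_add I J : set R :=
  [set x | exists y z, [/\ I y, J z & x = y + z]].

Lemma ideal_addl I J : ideal J -> I `<=` ideal_add I J.
Proof. by move=> [J0 _ _] x Ix; exists x, 0; rewrite addr0. Qed.

Lemma ideal_addr I J : ideal I -> J `<=` ideal_add I J.
Proof. by move=> [I0 _ _] x Jx; exists 0, x; rewrite add0r. Qed.

(** An ideal containing J, disjoint from S and maximal as such, is prime. *)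
Lemma prime_avoidance (J S : set R) : ideal J -> S 1 ->
  (forall x y, S x -> S y -> S (x * y)) -> (forall x, J x -> ~ S x) ->
  exists P : spec R, J `<=` prime_set P /\ forall x, S x -> x \notin ideal_of P.
Proof.
move=> iJ S1 SM JS.
pose good (A : set R) := [/\ ideal A, J `<=` A & forall x, A x -> ~ S x].
(* The empty set is admitted for the sake of the empty chain. *)
have [F Fgood totF|A [gA Amax]] := @Zorn_bigcup R (fun A => A = set0 \/ good A).
  have [[B [FB gB]]|no] := pselect (exists B, F B /\ good B); last first.
    left; apply/seteqP; split=> // x [B FB Bx].
    by case: (Fgood _ FB) => [B0|gB]; [move: Bx; rewrite B0 | apply: no; exists B].
  right; have gF C x : F C -> C x -> good C.
    by move=> FC Cx; case: (Fgood _ FC) => // C0; move: Cx; rewrite C0.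
  split; first split.
  - by exists B => //; case: gB => -[].
  - move=> x y [C FC Cx] [D FD Dy].
    have [[_ CD _] _ _] := gF _ _ FC Cx; have [[_ DD _] _ _] := gF _ _ FD Dy.
    by case: (totF _ _ FC FD) => [/(_ _ Cx)|/(_ _ Dy)] h;
      [exists D => //; apply: DD | exists C => //; apply: CD].
  - move=> a x [C FC Cx]; exists C => //.
    by have [[_ _ CM] _ _] := gF _ _ FC Cx; apply: CM.
  - by move=> x Jx; exists B => //; case: gB => _ JB _; apply: JB.
  - by move=> x [C FC Cx]; case: (gF _ _ FC Cx) => _ _; apply.
have {gA} [iA JA AS] : good A.
  case: gA => // A0; case: (Amax J); last by right; split.
  by rewrite A0; split=> //; move=> /(_ 0) []; case: iJ.
have grow u : ~ A u -> exists s a b, [/\ S s, A a & s = a + b * u].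
  move=> nAu; apply: contrapT => no.
  apply: (Amax (ideal_add A (principal u))).
    split; first exact: ideal_addl (principal_ideal u).
    move=> /(_ u) h; apply/nAu/h/(ideal_addr iA).
    by exists 1; rewrite mul1r.
  right; split; first exact: idealD iA (principal_ideal u).
    by move=> x /JA; apply: ideal_addl (principal_ideal u) x.
  by move=> _ [a [_ [Aa [b ->] ->]]] Ss; apply: no; exists (a + b * u), a, b.
have iA' : idealr_closed (fun x => `[< A x >]).
  case: (iA) => A0 AD AM; split.
  - exact/asboolP.
  - by apply/negP => /asboolP /AS.
  - by move=> a x y /asboolP Ax /asboolP Ay; apply/asboolP/AD => //; apply: AM.
have pA' : prime_idealr_closed (fun x => `[< A x >]).
  move=> u v /asboolP Auv; apply/orP; apply: contrapT => /not_orP[nu nv].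
  have [s [a [b [Ss Aa sE]]]] : exists s a b, [/\ S s, A a & s = a + b * u].
    by apply: grow => Au; apply: nu; apply/asboolP.
  have [t [c [d [St Ac tE]]]] : exists s a b, [/\ S s, A a & s = a + b * v].
    by apply: grow => Au; apply: nv; apply/asboolP.
  apply: (AS (s * t)); last exact: SM.
  rewrite sE tE mulrDl; case: (iA) => _ AD AM.
  apply: (AD); first exact: ideal_mulr.
  rewrite mulrDr; apply: (AD); first exact: AM.
  by rewrite mulrACA; apply: AM.
exists (spec_of_set iA' pA'); split=> x; first by move=> Jx; apply/asboolP/JA.
by move=> Sx; apply/asboolP => /AS.
Qed.

Lemma maximal_above (J : set R) : ideal J -> ~ J 1 ->
  exists P : spec R, J `<=` prime_set P.
Proof.
move=> iJ nJ1; have [||x Jx x1|P [JP _]] := @prime_avoidance J [set 1] iJ.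
- by [].
- by move=> _ _ -> ->; rewrite mulr1.
- by apply: nJ1; rewrite -[1]x1.
- by exists P.
Qed.

End Ideals.

(** * Zariski's lemma *)

Section Zariski.
Variable K : fieldType.

Lemma commr_field (A : comNzRingType) (f : {rmorphism A -> K}) x : commr_rmorph f x.
Proof. by move=> a; apply: mulrC. Qed.

(* The ring map A[X] -> K that extends f and maps X to x. *)
Definition adjoin (A : comNzRingType) (f : {rmorphism A -> K}) x :
  {rmorphism {poly A} -> K} := horner_morph (commr_field f x).

Lemma adjoinE (A : comNzRingType) (f : {rmorphism A -> K}) x p :
  adjoin f x p = (map_poly f p).[x].
Proof. by []. Qed.

Lemma adjoinC (A : comNzRingType) (f : {rmorphism A -> K}) x a :
  adjoin f x a%:P = f a.
Proof. by rewrite adjoinE map_polyC hornerC. Qed.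

Lemma adjoinX (A : comNzRingType) (f : {rmorphism A -> K}) x :
  adjoin f x 'X = x.
Proof. by rewrite adjoinE map_polyX hornerX. Qed.

Lemma integral_incl (A B : comNzRingType) (f : {rmorphism A -> K})
    (g : {rmorphism B -> K}) y :
  (forall a, integralOver g (f a)) -> integralOver f y -> integralOver g y.
Proof.
move=> fg [p mp py]; apply: integral_root_monic py _; first exact: monic_map.
by apply/integral_poly => i; rewrite coef_map; apply: fg.
Qed.

Lemma integral_adjoin (A B : comNzRingType) (f : {rmorphism A -> K})
    (g : {rmorphism B -> K}) x p :
  (forall a, integralOver g (f a)) -> integralOver g x ->
  integralOver g (adjoin f x p).
Proof.
move=> fg gx; rewrite adjoinE; apply: integral_horner gx.
by apply/integral_poly => i; rewrite coef_map; apply: fg.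
Qed.

Lemma clear_denominators (A : comNzRingType) (f : {rmorphism A -> K}) l b :
  f l != 0 -> exists N c, (f l) ^+ N * adjoin f (f l)^-1 b = f c.
Proof.
move=> fl0; elim/poly_ind: b => [|b a [N [c E]]].
  by exists 0%N, 0; rewrite !rmorph0 mulr0.
exists N.+1, (c + l ^+ N.+1 * a).
rewrite [adjoin _ _ _]rmorphD /= rmorphM /= adjoinX adjoinC mulrDr.
rewrite exprS -mulrA [X in _ * X]mulrA E mulrCA divff // mulr1.
by rewrite rmorphD rmorphM rmorphXn exprS.
Qed.

(** If 1 / f(a) is a root of a monic polynomial of degree d + 1 over f(A), then
   multiplication by f(a) ^ d solves the equation for 1 / f(a). *)
Lemma inverse_integral (A : comNzRingType) (f : {rmorphism A -> K}) a :
  f a != 0 -> integralOver f (f a)^-1 -> exists b, (f a)^-1 = f b.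
Proof.
move=> fa0 [p mp rp].
have E i : exists b, (f a) ^+ i.+1 * \sum_(j < i.+1) f p`_j * (f a)^-1 ^+ j = f a * f b.
  elim: i => [|i [b E]].
    by exists p`_0; rewrite big_ord1 expr0 mulr1 expr1.
  exists (a * b + p`_i.+1); rewrite big_ord_recr /= mulrDr exprS -mulrA E.
  rewrite rmorphD rmorphM mulrDr; congr (_ + _).
  by rewrite -mulrA; congr (_ * _); rewrite mulrCA -exprMn divff // expr1n mulr1.
have sp : (0 < size (map_poly f p))%N.
  by rewrite size_poly_gt0; apply: monic_neq0; apply: monic_map.
case: (ltngtP (size p) 1) => s1.
- move: (monic_neq0 mp); rewrite -size_poly_gt0; lia.
- set d := (size p).-2; have sd : size p = d.+2 by lia.
  have [b Eb] := E d; exists (- b).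
  have sE : size (map_poly f p) = size p.
    by apply: size_map_poly_id0; move/monicP: mp => ->; rewrite rmorph1 oner_neq0.
  move: rp; rewrite /root horner_coef sE sd big_ord_recr /= !coef_map /=.
  have -> : p`_d.+1 = 1 by move/monicP: mp; rewrite lead_coefE sd.
  rewrite rmorph1 mul1r addr_eq0 => /eqP E1.
  have : (f a) ^+ d.+1 * \sum_(j < d.+1) f p`_j * (f a)^-1 ^+ j = - 1.
    under eq_bigr do rewrite -coef_map.
    by rewrite E1 mulrN -exprMn divff // expr1n.
  by rewrite Eb rmorphN => E2; apply: (mulfI fa0); rewrite divff // mulrN E2 opprK.
- have p1 : p = 1.
    by rewrite (size1_polyC (eq_leq s1)); move/monicP: mp; rewrite lead_coefE s1 => ->.
  by move: rp; rewrite p1 rmorph1 /root hornerC oner_eq0.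
Qed.

Lemma monic_const_neq0 (A : comNzRingType) (f : {rmorphism A -> K}) z :
  z != 0 -> integralOver f z ->
  exists p : {poly A}, [/\ p \is monic, root (map_poly f p) z & f p`_0 != 0].
Proof.
move=> z0 [p mp rp]; have [n] := ubnP (size p).
elim: n p mp rp => // n IH p mp rp sp.
have [fp0|fp0] := eqVneq (f p`_0) 0; last by exists p.
pose q := drop_poly 1 p.
have pE : p = q * 'X + (p`_0)%:P.
  apply/polyP => i; rewrite coefD coefMX coefC.
  by case: i => [|i]; rewrite ?add0r // addr0 coef_drop_poly addn1.
have sq : size q = (size p).-1 by rewrite size_drop_poly subn1.
have s1 : (1 < size p)%N.
  rewrite ltnNge; apply/negP => s1; have := monic_neq0 mp.
  rewrite -size_poly_gt0 => s0; have sE : size p = 1%N by lia.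
  have p1 : p`_0 = 1 by move/monicP: mp; rewrite lead_coefE sE.
  by move: fp0; rewrite p1 rmorph1 => /eqP; rewrite oner_eq0.
apply: (IH q); last by rewrite sq; lia.
- apply/monicP; move/monicP: mp => <-; rewrite !lead_coefE sq coef_drop_poly.
  by congr (_`_ _); lia.
- move: rp; rewrite {1}pE rmorphD /= rmorphM /= map_polyX map_polyC /= fp0.
  by rewrite /root hornerD hornerMX hornerC addr0 mulf_eq0 (negbTE z0) orbF.
Qed.

(** Modulo 1 + X U the element X U is -1, so that 1 + X U would divide a power
   of -1. *)
Lemma power_not_multiple (U H : {poly K}) N :
  U != 0 -> U ^+ N = (1 + 'X * U) * H -> False.
Proof.
move=> U0 E; set G := 'X * U.
have dvdG : (1 + G) %| G ^+ N by rewrite exprMn E mulrCA dvdp_mulr.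
have dvdN : (1 + G) %| (G ^+ N - (-1) ^+ N).
  by rewrite subrXX; apply: dvdp_mulr; rewrite opprK addrC.
have dvd1 : (1 + G) %| (-1) ^+ N by rewrite -(dvdp_subr _ dvdG).
have s1 : size ((-1) ^+ N : {poly K}) = 1%N.
  by rewrite -signr_odd; case: odd; rewrite ?expr1 ?expr0 ?size_polyN size_poly1.
have N0 : (-1) ^+ N != 0 :> {poly K} by rewrite -size_poly_gt0 s1.
have := dvdp_leq N0 dvd1; rewrite s1.
have sG : (1 < size G)%N by rewrite /G mulrC size_mulX // ltnS size_poly_gt0.
by rewrite addrC size_polyDl ?size_poly1 // leqNgt sG.
Qed.

(** From integrality of K over a localization of f(A) at one element, one can
   descend to integrality over the prime ring. *)
Definition descends (A : comNzRingType) (f : {rmorphism A -> K}) : Prop :=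
  forall u, f u != 0 -> (forall y, integralOver (adjoin f (f u)^-1) y) ->
  forall y, integralOver (intr : int -> K) y.

Lemma descends_int p : prime p -> p%:R = 0 :> K ->
  descends (intr : {rmorphism int -> K}).
Proof.
move=> pp p0 u u0 intK y; apply: integral_incl (intK y) => b.
apply: integral_adjoin => [a|]; first exact: integral_id.
have cop : coprimez u p.
  rewrite coprimez_sym coprimezE /= prime_coprime //.
  apply/negP => pu; have /dvdzP[k uE] : (p %| u)%Z by [].
  by move: u0; rewrite uE rmorphM /= -[p%:Z%:~R]/(p%:R) p0 mulr0 eqxx.
have [[s t] /= st] := coprimezP _ _ cop.
have -> : (u%:~R : K)^-1 = s%:~R.
  apply: (mulfI u0); rewrite divff // mulrC.
  rewrite -[LHS]/(1%:~R : K) -st rmorphD /= !rmorphM /=.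
  by rewrite -[p%:Z%:~R]/(p%:R) p0 mulr0 addr0.
exact: integral_id.
Qed.

(** K is integral over f(A)[x, 1 / g(u)].  Then x is algebraic over f(A):
   otherwise 1 + x g(u), which is a unit of this ring, would contradict
   [power_not_multiple].  With the leading coefficient f(l) of an equation of x
   inverted, x and hence g(u) are integral; with the constant coefficient f(c)
   of an equation of g(u) inverted too, 1 / g(u) is integral as well.  So K is
   integral over f(A)[1 / f(l c)]. *)
Lemma descends_adjoin (A : comNzRingType) (f : {rmorphism A -> K}) x :
  descends f -> descends (adjoin f x).
Proof.
move=> df u gu0 intK; set g := adjoin f x in gu0 intK.
have [p [p0 px]] : exists p, map_poly f p != 0 /\ g p = 0.
  apply: contrapT => no.
  have inj p : g p = 0 -> map_poly f p = 0.
    by move=> gp; apply/eqP/negPn/negP => p0; apply: no; exists p.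
  have U0 : map_poly f u != 0.
    by apply: contra gu0 => /eqP U0; rewrite /g adjoinE U0 horner0.
  pose v := 1 + 'X * u.
  have gv0 : g v != 0.
    apply/eqP => /inj; rewrite rmorphD rmorph1 rmorphM /= map_polyX.
    move=> /(congr1 (fun q : {poly K} => q`_0)).
    by rewrite coefD coef1 coefXM coef0 /= addr0 => /eqP; rewrite oner_eq0.
  set h := adjoin g (g u)^-1 in intK.
  have hv : h v%:P = g v by rewrite /h adjoinC.
  have [|b Eb] := @inverse_integral _ h v%:P _ (intK _); first by rewrite hv.
  have [N [c Ec]] := clear_denominators b gu0.
  rewrite -/h -Eb hv in Ec.
  apply: (@power_not_multiple (map_poly f u) (map_poly f c) N U0).
  have : g (u ^+ N - v * c) = 0.
    by rewrite rmorphB rmorphM rmorphXn -Ec mulrCA divff // mulr1 subrr.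
  move/inj; rewrite rmorphB => /eqP; rewrite subr_eq0 => /eqP.
  by rewrite rmorphXn rmorphM rmorphD rmorph1 rmorphM /= map_polyX.
set P := map_poly f p in p0; pose l := p`_(size P).-1.
have fl0 : f l != 0 by rewrite -coef_map -lead_coefE lead_coef_eq0.
pose fl := adjoin f (f l)^-1.
have fl_f a : integralOver fl (f a) by rewrite -(adjoinC f (f l)^-1); apply: integral_id.
have fl_inv : integralOver fl (f l)^-1 by rewrite -[X in integralOver _ X](adjoinX f (f l)^-1); apply: integral_id.
have int_x : integralOver fl x.
  apply: (@integral_root_monic _ _ fl x ((f l)^-1 *: P)).
  - by rewrite monicE lead_coefZ lead_coefE coef_map mulVf.
  - by rewrite rootZ ?invr_eq0 //; apply/eqP.
  - apply/integral_poly => i; rewrite coefZ coef_map /=.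
    exact: integral_mul.
have int_u : integralOver fl (g u) by apply: integral_adjoin.
have [q [mq rq q0]] := monic_const_neq0 gu0 int_u.
have [N [c Ec]] := clear_denominators q`_0 fl0; rewrite -/fl in Ec.
have fc0 : f c != 0 by rewrite -Ec mulf_neq0 // expf_neq0.
apply: (df (l * c)); first by rewrite rmorphM mulf_neq0.
set h := adjoin f _.
have h_f a : integralOver h (f a) by rewrite -(adjoinC f (f (l * c))^-1); apply: integral_id.
have h_lc : integralOver h (f (l * c))^-1.
  by rewrite -[X in integralOver _ X](adjoinX f (f (l * c))^-1); apply: integral_id.
have h_l : integralOver h (f l)^-1.
  have -> : (f l)^-1 = f c * (f (l * c))^-1.
    by rewrite rmorphM invfM mulrCA divff // mulr1.
  exact: integral_mul.
have h_c : integralOver h (f c)^-1.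
  have -> : (f c)^-1 = f l * (f (l * c))^-1.
    by rewrite rmorphM invfM mulrA divff // mul1r.
  exact: integral_mul.
have h_fl a : integralOver h (fl a) by apply: integral_adjoin.
have h_x : integralOver h x by apply: integral_incl int_x.
have h_u : integralOver h (g u)^-1.
  pose Q := drop_poly 1 (map_poly fl q).
  have QE : map_poly fl q = Q * 'X + (fl q`_0)%:P.
    apply/polyP => i; rewrite coefD coefMX coefC coef_map.
    by case: i => [|i]; rewrite ?add0r // addr0 coef_drop_poly addn1 coef_map.
  have : Q.[g u] * g u + fl q`_0 = 0.
    by move/rootP: rq; rewrite QE hornerD hornerMX hornerC.
  move/eqP; rewrite addr_eq0 => /eqP EQ.
  have -> : (g u)^-1 = - (Q.[g u]) * ((f l) ^+ N * (f c)^-1).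
    apply: (mulfI gu0); rewrite divff // mulrA mulrN [g u * _]mulrC EQ opprK.
    by rewrite mulrA [fl _ * _]mulrC Ec divff.
  apply: integral_mul.
    apply: integral_opp; apply: integral_horner; last exact: integral_incl int_u.
    by apply/integral_poly => i; rewrite coef_drop_poly coef_map; apply: h_fl.
  by apply: integral_mul h_c; rewrite -rmorphXn.
move=> y; apply: integral_incl (intK y) => b; apply: integral_adjoin => // a.
exact: integral_adjoin.
Qed.

(** Zariski's lemma, by descent along the tower of the subrings that the first
   elements of xs generate *)
Lemma zariski p (xs : seq K) : prime p -> p%:R = 0 :> K ->
  (forall (B : comNzRingType) (g : {rmorphism B -> K}),
     (forall x, x \in xs -> exists b, g b = x) -> forall y, exists b, g b = y) ->
  forall y, integralOver (intr : int -> K) y.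
Proof.
move=> pp p0 gen.
have [B [g [dg gxs]]] : exists (B : comNzRingType) (g : {rmorphism B -> K}),
    descends g /\ forall x, x \in xs -> exists b, g b = x.
  elim: {gen}xs => [|x xs [B [g [dg gxs]]]].
    by exists int, intr; split; [apply: (descends_int pp) |].
  exists {poly B}, (adjoin g x); split; first exact: descends_adjoin.
  move=> z; rewrite inE => /predU1P[->|/gxs[b <-]].
    by exists 'X; rewrite adjoinX.
  by exists b%:P; rewrite adjoinC.
apply: (dg 1) => [|y]; first by rewrite rmorph1 oner_neq0.
have [b <-] := gen B g gxs y; rewrite -(adjoinC g (g 1)^-1 b); exact: integral_id.
Qed.
End Zariski.

(** * Residue fields at closed points *)

Definition maximal (R : comNzRingType) (P : spec R) : Prop :=
  forall x, x \notin ideal_of P -> exists y, 1 - x * y \in ideal_of P.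

Lemma closed_maximal (R : comNzRingType) (P : spec R) : closed_point P -> maximal P.
Proof.
move=> cP x nPx; have iP := prime_set_ideal P.
have iJ := idealD iP (principal_ideal x).
have [[y [z [Py [a ->] E]]]|nJ1] := pselect (ideal_add (prime_set P) (principal x) 1).
  by exists a; rewrite E [x * a]mulrC addrK.
have [Q JQ] := maximal_above iJ nJ1.
have PQ : {subset ideal_of P <= ideal_of Q}.
  by move=> y Py; apply: JQ; apply: (ideal_addl (principal_ideal x)).
move: nPx; rewrite -(cP Q PQ) => /negP[]; apply: JQ.
by apply: (ideal_addr iP); exists 1; rewrite mul1r.
Qed.

Section ResidueField.
Variables (R : comNzRingType) (P : spec R).
Local Open Scope quotient_scope.

Definition residue_ring (_ : maximal P) : Type :=
  {ideal_quot (P : PrimeIdealr.type R)}.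

Variable maxP : maximal P.
Local Notation k := (residue_ring maxP).

HB.instance Definition _ := GRing.ComNzRing.on k.

Lemma residue_inverse (x : k) :
  exists y, (x != 0 -> y * x = 1) /\ (x = 0 -> y = 0).
Proof.
have [->|x0] := eqVneq x 0; first by exists 0.
have rP : repr x \notin ideal_of P.
  apply: contra x0 => xP; rewrite -[x]reprK -[0](rmorph0 \pi_k).
  by rewrite -Quotient.idealrBE subr0.
have [y Py] := maxP rP; exists (\pi_k y); split=> [_|/eqP]; last by rewrite (negbTE x0).
rewrite -[x]reprK -rmorphM -[1](rmorph1 \pi_k); apply/eqP.
by rewrite eq_sym -Quotient.idealrBE mulrC.
Qed.

Definition residue_inv (x : k) : k := sval (cid (residue_inverse x)).

Lemma residue_mulVf x : x != 0 -> residue_inv x * x = 1.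
Proof. by rewrite /residue_inv; case: cid => /= y []. Qed.

Lemma residue_inv0 : residue_inv 0 = 0.
Proof. by rewrite /residue_inv; case: cid => /= y [_ ->]. Qed.

HB.instance Definition _ :=
  GRing.ComNzRing_isField.Build k residue_mulVf residue_inv0.

Definition residue_map : {rmorphism R -> k} := \pi_{ideal_quot (P : PrimeIdealr.type R)}.

Lemma residue_map_eq0 x : (residue_map x == 0) = (x \in ideal_of P).
Proof.
rewrite -[0](rmorph0 residue_map) -[RHS]/(x \in (P : PrimeIdealr.type R)).
by rewrite -Quotient.idealrBE subr0.
Qed.

Lemma residue_map_onto y : exists x, residue_map x = y.
Proof. by exists (repr y); apply: reprK. Qed.

End ResidueField.

Definition zpoly_at (R : comNzRingType) (q : {poly int}) (x : R) : R :=
  (map_poly intr q).[x].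

Lemma mpolyC_int n (c : int) : c%:MP = c%:~R :> {mpoly int[n]}.
Proof. by rewrite -[in LHS](intz c) rmorph_int. Qed.

(** Zariski's lemma for the residue field at P, which is generated by the
   images of the variables *)
Lemma integral_mod_maximal (R : comNzRingType) n
    (phi : {rmorphism {mpoly int[n]} -> R}) (P : spec R) p x :
  (forall r, exists f, phi f = r) -> maximal P -> prime p ->
  p%:R \in ideal_of P ->
  exists2 q : {poly int}, q \is monic & zpoly_at q x \in ideal_of P.
Proof.
move=> onto maxP pp pP; pose K := residue_ring maxP.
pose psi : {rmorphism R -> K} := residue_map maxP.
have p0 : p%:R = 0 :> K.
  by rewrite -(rmorph_nat psi); apply/eqP; rewrite residue_map_eq0.
have [|q mq rq] := @zariski K p [seq psi (phi 'X_i) | i <- enum 'I_n] pp p0 _ (psi x).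
  move=> B g gxs y; have [r <-] := residue_map_onto y; have [f <-] := onto r.
  rewrite -/psi [f]mpolyE !rmorph_sum /=.
  apply: (big_ind (fun y => exists b, g b = y)).
  - by exists 0; rewrite rmorph0.
  - by move=> _ _ [b <-] [c <-]; exists (b + c); rewrite rmorphD.
  move=> m _; rewrite -mul_mpolyC !rmorphM /= mpolyXE_id !rmorph_prod /=.
  have [b bE] : exists b, g b = psi (phi (f@_m)%:MP).
    by exists (f@_m)%:~R; rewrite mpolyC_int !rmorph_int.
  have [c cE] : exists c, g c = \prod_(i < n) psi (phi ('X_i ^+ m i)).
    apply: (big_ind (fun y => exists b, g b = y)).
    - by exists 1; rewrite rmorph1.
    - by move=> _ _ [b1 <-] [c <-]; exists (b1 * c); rewrite rmorphM.
    move=> i _; have [|c cE] := gxs (psi (phi 'X_i)).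
      by apply: map_f; rewrite mem_enum.
    by exists (c ^+ m i); rewrite rmorphXn cE !rmorphXn.
  by exists (b * c); rewrite rmorphM bE cE.
exists q => //; rewrite -(residue_map_eq0 maxP) -/psi /zpoly_at.
rewrite -horner_map /= -map_poly_comp; suff -> : map_poly (psi \o intr) q = map_poly intr q by [].
by apply: eq_map_poly => z; exact: (rmorph_int psi z).
Qed.

(** Otherwise a prime above J avoids the values at x of monic polynomials, which
   form a multiplicative set. *)
Lemma integral_mod_ideal (R : comNzRingType) n
    (phi : {rmorphism {mpoly int[n]} -> R}) (J : set R) p e x :
  (forall r, exists f, phi f = r) -> prime p -> ideal J -> J (p%:R ^+ e) ->
  (forall P : spec R, J `<=` prime_set P -> maximal P) ->
  exists2 q : {poly int}, q \is monic & J (zpoly_at q x).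
Proof.
move=> onto pp iJ Jp maxJ; apply: contrapT => no.
pose S : set R := [set y | exists2 q : {poly int}, q \is monic & y = zpoly_at q x].
have [| | |P [JP PS]] := @prime_avoidance R J S iJ.
- by exists 1; rewrite ?monic1 // /zpoly_at rmorph1 hornerC.
- move=> _ _ [q mq ->] [r mr ->]; exists (q * r); first by rewrite monicMl.
  by rewrite /zpoly_at rmorphM hornerM.
- by move=> y Jy [q mq yE]; apply: no; exists q => //; rewrite -yE.
have pP : p%:R \in ideal_of P by apply: prime_exp (JP _ Jp).
have [q mq qP] := integral_mod_maximal x onto (maxJ P JP) pp pP.
by have /negP := PS (zpoly_at q x) (ex_intro2 _ _ q mq erefl).
Qed.

(** * The components of R / I above p *)

Section Components.
Variables (R : comNzRingType) (I : set R) (p k c0 c : nat).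
Hypothesis idealI : ideal I.
Hypothesis maxI : forall P : spec R, I `<=` prime_set P -> closed_point P.

Definition with_power : set R := ideal_add I (principal (p%:R ^+ k.+1)).
Local Notation J := with_power.

(* Equivalently p ^ k is in [with_power]: the powers of p have become stationary
   in R / I. *)
Hypothesis stable : exists r, I (p%:R ^+ k * (1 - p%:R * r)).
Hypothesis indexJ : has_index [set: R] J c0.
Hypothesis index_le : (c0 <= c)%N.

Definition point_above (P : spec R) : Prop :=
  I `<=` prime_set P /\ p%:R \in ideal_of P.

(* The kernel of R -> R_P / I R_P. *)
Definition local_kernel (P : spec R) : set R :=
  [set x | exists2 s, s \notin ideal_of P & I (s * x)].

Lemma with_power_ideal : ideal J.
Proof. by apply: idealD => //; apply: principal_ideal. Qed.

Lemma sub_with_power : I `<=` J.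
Proof. exact: ideal_addl (principal_ideal _). Qed.

Lemma with_power_mem : J (p%:R ^+ k.+1).
Proof. by apply: (ideal_addr idealI); exists 1; rewrite mul1r. Qed.

Lemma prime_above P : J `<=` prime_set P -> point_above P.
Proof.
move=> JP; split; first by move=> x /sub_with_power/JP.
exact: prime_exp (JP _ with_power_mem).
Qed.

Lemma notin_mul_prime (P : spec R) s t :
  s \notin ideal_of P -> t \notin ideal_of P -> s * t \notin ideal_of P.
Proof. by rewrite prime_mul negb_or => -> ->. Qed.

Lemma notin_one_sub (P : spec R) x y : x \in ideal_of P ->
  1 - x * y \notin ideal_of P.
Proof.
move=> xP; apply: contra (prime1 P) => h.
have iP := prime_set_ideal P; have [_ PD _] := iP.
rewrite -[1](subrK (x * y)); apply: PD => //; exact: (ideal_mulr _ iP).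
Qed.

Lemma local_kernel_ideal P : ideal (local_kernel P).
Proof.
have [I0 ID IM] := idealI; split.
- by exists 1; rewrite ?prime1 // mul1r.
- move=> x y [s sP Is] [t tP It]; exists (s * t); first exact: notin_mul_prime.
  rewrite mulrDr; apply: ID; last by rewrite -mulrA; apply: IM.
  by rewrite mulrAC; apply: ideal_mulr.
- by move=> a x [s sP Is]; exists s => //; rewrite mulrCA; apply: IM.
Qed.

Lemma local_kernel_saturated P s x : s \notin ideal_of P ->
  local_kernel P (s * x) -> local_kernel P x.
Proof.
by move=> sP [t tP It]; exists (t * s); [exact: notin_mul_prime | rewrite -mulrA].
Qed.

Lemma sub_local_kernel P : I `<=` local_kernel P.
Proof. by move=> x Ix; exists 1; rewrite ?prime1 // mul1r. Qed.

Lemma with_power_local P : point_above P -> J `<=` local_kernel P.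
Proof.
move=> [IP pP] _ [y [_ [Iy [a ->] ->]]]; have [_ LD LM] := local_kernel_ideal P.
apply: LD; first exact: sub_local_kernel.
apply: LM; have [r Ir] := stable; exists (1 - p%:R * r); first exact: notin_one_sub.
rewrite exprSr mulrA; apply: ideal_mulr => //.
by rewrite mulrC.
Qed.

Lemma local_kernel_sub P : I `<=` prime_set P -> local_kernel P `<=` prime_set P.
Proof.
by move=> IP x [s sP /IP]; rewrite /prime_set /= prime_mul (negbTE sP).
Qed.

(** Two of the c + 1 first powers of t are congruent modulo J. *)
Lemma power_cycle t : exists r, J (t ^+ c * (1 - t * r)).
Proof.
have [_ [s [_ _ _ sc] sz]] := indexJ.
have /choice [g gP] : forall i : 'I_c.+1, exists y, y \in s /\ J (t ^+ i - y).
  by move=> i; have [y ys Jy] := sc (t ^+ i) Logic.I; exists y.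
have ninj : ~ injective g.
  move=> ginj; have : (#|'I_c.+1| <= size s)%N.
    rewrite cardE -(size_map g); apply: uniq_leq_size.
      by rewrite map_inj_uniq // enum_uniq.
    by move=> _ /mapP[i _ ->]; have [] := gP i.
  by rewrite card_ord sz ltnNge index_le.
have [i [j [lt_ij gij]]] : exists i j : 'I_c.+1, (i < j)%N /\ g i = g j.
  apply: contrapT => no; apply: ninj => i j gij; apply/val_inj/eqP.
  rewrite eqn_leq leqNgt [(j <= i)%N]leqNgt; apply/andP.
  by split; apply/negP => lt; apply: no; [exists j, i | exists i, j].
have gJ := ideal_subgroup with_power_ideal.
have Jij : J (t ^+ i - t ^+ j).
  have [_ Ji] := gP i; have [_ Jj] := gP j.
  by apply: subgroup_trans Ji _ => //; rewrite gij; apply: subgroup_sym.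
exists (t ^+ (j - i).-1); rewrite -exprS prednK ?subn_gt0 //.
have -> : t ^+ c = t ^+ (c - i) * t ^+ i by rewrite -exprD subnK // -ltnS.
rewrite -mulrA mulrBr mulr1 -exprD subnKC ?(ltnW lt_ij) //.
by have [_ _ JM] := with_power_ideal; apply: JM.
Qed.

Lemma local_unit P s : point_above P -> s \notin ideal_of P ->
  exists t, local_kernel P (1 - s * t).
Proof.
move=> aP sP; have [r Jr] := power_cycle s; exists r.
apply: (@local_kernel_saturated P (s ^+ c)); last exact: with_power_local.
by apply: contra sP; apply: prime_exp.
Qed.

Lemma local_nilpotent P z : point_above P -> z \in ideal_of P ->
  local_kernel P (z ^+ c).
Proof.
move=> aP zP; have [r Jr] := power_cycle z.
apply: (@local_kernel_saturated P (1 - z * r)); first exact: notin_one_sub.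
by rewrite mulrC; apply: with_power_local.
Qed.

Lemma local_index P : point_above P ->
  exists m, has_index [set: R] (local_kernel P) m.
Proof.
move=> aP; apply: (index_between indexJ) => //.
- exact: ideal_subgroup (local_kernel_ideal P).
- exact: with_power_local.
Qed.

(** The elements whose components vanish outside of the zero locus of T *)
Definition torsion (T : seq R) : set R :=
  [set x | forall t, t \in T -> J (t ^+ c * x)].

Definition contained (T : seq R) (P : spec R) : bool := all (fun t => t \in ideal_of P) T.

(** For the converse implication, the ideal of the a with a t ^ c x in J lies in
   no prime P: for T in P because of [power_cycle], and otherwise because x
   vanishes in the component at P. *)
Lemma torsionE (T : seq R) x :
  torsion T x <-> forall P, point_above P -> ~~ contained T P -> local_kernel P x.
Proof.
split=> [Tx P aP /allPn[t tT tP]|loc t tT].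
  apply: (@local_kernel_saturated P (t ^+ c)); last exact/(with_power_local aP)/Tx.
  by apply: contra tP; apply: prime_exp.
apply: contrapT => nJ; set z := t ^+ c * x in nJ.
have [J0 JD JM] := with_power_ideal.
pose A : set R := [set a | J (a * z)].
have iA : ideal A.
  split; first by rewrite /A /= mul0r.
  - by move=> a b Aa Ab; rewrite /A /= mulrDl; apply: JD.
  - by move=> a b Ab; rewrite /A /= -mulrA; apply: JM.
have [|P AP] := maximal_above iA; first by rewrite /A /= mul1r.
have JP : J `<=` prime_set P.
  by move=> a Ja; apply: AP; rewrite /A /=; apply: ideal_mulr with_power_ideal Ja.
have aP := prime_above JP.
have [cTP|ncTP] := boolP (contained T P).
  have [r Jr] := power_cycle t.
  have tP : t \in ideal_of P by move/allP: cTP; apply.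
  have /negP := notin_one_sub r tP; apply; apply: AP.
  by rewrite /A /= /z mulrCA mulrA; apply: ideal_mulr with_power_ideal Jr.
have [s sP Is] := loc P aP ncTP.
have /negP := sP; apply; apply: AP; rewrite /A /= /z mulrCA.
by apply: JM; apply: sub_with_power.
Qed.

Definition joint_kernel (Y : seq (spec R)) : set R :=
  [set x | forall P, P \in Y -> local_kernel P x].

Lemma joint_kernel_ideal Y : ideal (joint_kernel Y).
Proof.
split.
- by move=> P _; case: (local_kernel_ideal P).
- by move=> x y Yx Yy P PY; case: (local_kernel_ideal P) => _ LD _;
    apply: LD; [exact: Yx | exact: Yy].
- by move=> a x Yx P PY; case: (local_kernel_ideal P) => _ _ LM; apply: LM; apply: Yx.
Qed.

(** At a point Q other than P, a power of some z in P and not in Q is a unit at Q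
   and vanishes at P. *)
Lemma comaximal (P : spec R) (Y : seq (spec R)) :
  point_above P -> (forall Q, Q \in Y -> point_above Q) -> P \notin Y ->
  exists2 y, joint_kernel Y y & local_kernel P (1 - y).
Proof.
move=> aP; elim: Y => [|Q Y IH] aY PY.
  by exists 1 => //; rewrite subrr; case: (local_kernel_ideal P).
move: PY; rewrite inE negb_or => /andP[PQ PY].
have [|y Yy Py] := IH _ PY.
  by move=> Q' Q'Y; apply: aY; rewrite inE Q'Y orbT.
have aQ : point_above Q by apply: aY; exact: mem_head.
have [z zP zQ] : exists2 z, z \in ideal_of P & z \notin ideal_of Q.
  apply: contrapT => no; move: PQ => /eqP; apply.
  have cP := maxI aP.1; apply/esym/cP => z zP.
  by apply: contrapT => /negP zQ; apply: no; exists z.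
have zcQ : z ^+ c \notin ideal_of Q by apply: contra zQ; apply: prime_exp.
have [t Qt] := local_unit aQ zcQ.
exists (y * (1 - z ^+ c * t)).
  move=> Q'; rewrite inE => /predU1P[->|Q'Y].
    by case: (local_kernel_ideal Q) => _ _; apply.
  by apply: (ideal_mulr _ (local_kernel_ideal Q')); apply: Yy.
have [_ PD PM] := local_kernel_ideal P.
rewrite mulrBr mulr1 opprB addrCA; apply: PD; last exact: Py.
by rewrite mulrCA; apply: ideal_mulr (local_kernel_ideal P) (local_nilpotent aP zP).
Qed.

Lemma joint_index (P : spec R) (Y : seq (spec R)) m :
  point_above P -> (forall Q, Q \in Y -> point_above Q) -> P \notin Y ->
  has_index [set: R] (local_kernel P) m ->
  has_index (joint_kernel Y) (joint_kernel (P :: Y)) m.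
Proof.
move=> aP aY PY iP; have [y Yy Py] := comaximal aP aY PY.
have iK := local_kernel_ideal; have [_ _ YM] := joint_kernel_ideal Y.
apply: (index_transfer (f := fun x => x * y)) iP => //.
- exact: ideal_subgroup (joint_kernel_ideal _).
- by move=> x Yx Q QY; apply: Yx; rewrite inE QY orbT.
- by case: (iK P).
- by move=> x _; apply: YM.
- move=> x x' _ _; rewrite -mulrBl; split=> [/(_ P (mem_head _ _))|] Px.
    rewrite -[x - x']mulr1 -[1](subrK y) mulrDr.
    by have [_ PD PM] := iK P; apply: PD; [exact: PM | exact: Px].
  move=> Q; rewrite inE => /predU1P[->|QY]; first exact: ideal_mulr (iK P) Px.
  by have [_ _ QM] := iK Q; apply: QM; apply: Yy.
- move=> z Yz; exists z => //; rewrite -{1}[z]mulr1 -mulrBr => Q.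
  rewrite inE => /predU1P[->|QY]; first by have [_ _ PM] := iK P; apply: PM.
  by apply: ideal_mulr (iK Q) _; apply: Yz.
Qed.

(** Chinese remainder theorem, in the form of indices *)
Lemma joint_index_prod (m : spec R -> nat) (Z Y : seq (spec R)) :
  (forall Q, Q \in Z ++ Y -> point_above Q) -> uniq (Z ++ Y) ->
  (forall P, P \in Z -> has_index [set: R] (local_kernel P) (m P)) ->
  has_index (joint_kernel Y) (joint_kernel (Z ++ Y)) (\prod_(P <- Z) m P).
Proof.
elim: Z => [|P Z IH] aZ uZ mZ.
  by rewrite big_nil; apply: index_refl; apply: ideal_subgroup (joint_kernel_ideal _).
move: uZ => /= /andP[PZ uZ]; rewrite big_cons mulnC.
have gK Y' := ideal_subgroup (joint_kernel_ideal Y').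
apply: (index_mul (K := joint_kernel (Z ++ Y))) => //.
  apply: IH => // [Q QZ|Q QZ]; first by apply: aZ; rewrite /= inE QZ orbT.
  by apply: mZ; rewrite inE QZ orbT.
apply: joint_index => //.
- by apply: aZ; exact: mem_head.
- by move=> Q QZ; apply: aZ; rewrite /= inE QZ orbT.
- by apply: mZ; exact: mem_head.
Qed.

(** A prime above J is determined by its trace on representatives of R / J. *)
Lemma finite_points : exists2 X : seq (spec R), uniq X &
  forall P, P \in X <-> point_above P.
Proof.
have [_ [s [_ _ _ sc] _]] := indexJ.
pose sig (P : spec R) : (size s).-tuple bool := map_tuple (fun x => x \in ideal_of P) (in_tuple s).
have sig_inj P Q : point_above P -> point_above Q -> sig P = sig Q -> P = Q.
  move=> aP aQ sPQ; have sub (P' Q' : spec R) : point_above P' -> point_above Q' ->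
    sig P' = sig Q' -> forall x, x \in ideal_of P' -> x \in ideal_of Q'.
    move=> aP' aQ' sE x xP'; have [y ys Jy] := sc x Logic.I.
    have JP (S : spec R) : point_above S -> x - y \in ideal_of S.
      by move=> aS; apply: (local_kernel_sub aS.1); apply: with_power_local.
    have [_ PD _] := prime_set_ideal Q'.
    rewrite -[x](subrK y); apply: PD; first exact: JP.
    have yP' : y \in ideal_of P'.
      rewrite -[y](subKr x); apply: (idealB (prime_set_ideal P')) => //; exact: JP.
    have : map (fun x => x \in ideal_of P') s = map (fun x => x \in ideal_of Q') s.
      by move/(congr1 val): sE.
    by move/eq_in_map/(_ y ys) => E; rewrite /prime_set /= -E.
  by apply: spec_ext => x; apply/idP/idP; apply: sub.
have /choice [g gP] : forall t : (size s).-tuple bool, exists o : option (spec R),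
    if o is Some P then point_above P /\ sig P = t
    else ~ exists P, point_above P /\ sig P = t.
  move=> t; have [[P PP]|no] := pselect (exists P, point_above P /\ sig P = t).
    by exists (Some P).
  by exists None.
exists (undup (pmap g (enum {: (size s).-tuple bool}))); first exact: undup_uniq.
move=> P; rewrite mem_undup mem_pmap; split.
  by move=> /mapP[t _ gt]; have := gP t; rewrite -gt => -[].
move=> aP; apply/mapP; exists (sig P); first by rewrite mem_enum.
have := gP (sig P); case: (g (sig P)) => [Q [aQ sQ]|[]]; last by exists P.
by congr Some; apply: sig_inj.
Qed.

Lemma torsion_index (X : seq (spec R)) (m : spec R -> nat) (T : seq R) :
  uniq X -> (forall P, P \in X <-> point_above P) ->
  (forall P, P \in X -> has_index [set: R] (local_kernel P) (m P)) ->
  has_index (torsion T) J (\prod_(P <- X | contained T P) m P).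
Proof.
move=> uX XP mX; rewrite -big_filter.
pose Z := [seq P <- X | contained T P]; rewrite -/Z; pose Y := [seq P <- X | ~~ contained T P].
have memZY P : (P \in Z ++ Y) = (P \in X).
  by rewrite mem_cat !mem_filter; case: (contained T P); rewrite /= ?orbF.
have -> : torsion T = joint_kernel Y.
  apply/seteqP; split=> x.
    move=> /torsionE Tx P; rewrite mem_filter => /andP[ncT /XP aP]; exact: Tx.
  by move=> Yx; apply/torsionE => P aP ncT; apply: Yx; rewrite mem_filter ncT; apply/XP.
have -> : J = joint_kernel (Z ++ Y).
  apply/seteqP; split=> x.
    by move=> Jx P; rewrite memZY => /XP aP; apply: with_power_local.
  move=> Yx; have : torsion [:: 1] x.
    by apply/torsionE => P aP _; apply: Yx; rewrite memZY; apply/XP.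
  by move/(_ 1 (mem_head _ _)); rewrite expr1n mul1r.
apply: joint_index_prod.
- by move=> Q; rewrite memZY => /XP.
- by rewrite (perm_uniq (permEl (perm_filterC (contained T) X))).
- by move=> P; rewrite mem_filter => /andP[_ /mX].
Qed.

End Components.

(** * The naive intersection number at a point *)

Local Notation "x %:F" := (@FracField.tofrac _ x).

(* S generates the extension of the ideal I to the local ring A.  The case of
   two localized ideals gives the length, that of the maximal ideal the residue
   field. *)
Section LocalQuotient.
Variables (R : idomainType) (P : spec R) (I : set R).
Local Notation A := (local_ring P).
Variable S : set (A^o).
Hypothesis idealI : ideal I.
Hypothesis S_fraction : forall z, S z -> exists x s,
  [/\ I x, s \notin ideal_of P & local_val z = x%:F / s%:F].
Hypothesis fraction_S : forall (z : A) x s, I x -> s \notin ideal_of P ->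
  local_val z = x%:F / s%:F -> (z : A^o) \in gen_submod S.
Hypothesis unitP : forall s, s \notin ideal_of P -> exists t, local_kernel I P (1 - s * t).

Local Notation N := (gen_submod S).
Local Notation M := (quot_module S).
Local Open Scope quotient_scope.

Lemma fraction_local (a s : R) : s \notin ideal_of P ->
  (a%:F / s%:F) \in @local_pred R P.
Proof. by move=> sP; apply/asboolP; exists a, s. Qed.

Definition fraction (a s : R) (sP : s \notin ideal_of P) : A :=
  LocalRing (fraction_local a sP).

Definition to_local (a : R) : A := fraction a (prime1 P).

Lemma to_localE a : local_val (to_local a) = a%:F.
Proof. by rewrite /= rmorph1 divr1. Qed.

Lemma local_val_inj : injective (@local_val R P).
Proof. exact: val_inj. Qed.

Lemma local_valB (x y : A) : local_val (x - y) = local_val x - local_val y.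
Proof. by []. Qed.

Lemma local_valM (x y : A) : local_val (x * y) = local_val x * local_val y.
Proof. by []. Qed.

Lemma to_localB a b : to_local (a - b) = to_local a - to_local b.
Proof. by apply: local_val_inj; rewrite local_valB !to_localE rmorphB. Qed.

Lemma to_localM a b : to_local (a * b) = to_local a * to_local b.
Proof. by apply: local_val_inj; rewrite local_valM !to_localE rmorphM. Qed.

Lemma fraction_of (z : A) : exists a s (sP : s \notin ideal_of P), z = fraction a sP.
Proof.
case: z => z zP; have /asboolP[a [s [sP zE]]] := zP.
by exists a, s, sP; apply: local_val_inj.
Qed.

Lemma genNZ (a : A) (x : A^o) : x \in N -> a *: x \in N.
Proof.
have [N0 NZ] := gen_submod_closed S.
by move=> xN; rewrite -[a *: x]addr0; apply: NZ.
Qed.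

Lemma gen_fraction (z : A^o) : z \in N -> exists x s,
  [/\ I x, s \notin ideal_of P & local_val z = x%:F / s%:F].
Proof.
have [I0 ID IM] := idealI.
move=> /asboolP[n [c [m [Sm ->]]]].
apply: (big_ind (fun z : A^o => exists x s,
  [/\ I x, s \notin ideal_of P & local_val z = x%:F / s%:F])).
- by exists 0, 1; rewrite prime1 rmorph0 mul0r.
- move=> z1 z2 [x [s [Ix sP zE]]] [y [t [Iy tP tE]]].
  exists (x * t + y * s), (s * t); split; last 1 first.
  + have -> : local_val (z1 + z2) = local_val z1 + local_val z2 by [].
    rewrite zE tE addf_div; [|exact: notin_neq0 sP|exact: notin_neq0 tP].
    by rewrite rmorphD !rmorphM.
  + by apply: ID; apply: ideal_mulr.
  + exact: notin_mul.
- move=> i _; have [x [s [Ix sP zE]]] := S_fraction (Sm i).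
  have [a [t [tP ->]]] := fraction_of (c i).
  exists (a * x), (t * s); split; [exact: IM | exact: notin_mul |].
  have -> : local_val (fraction a tP *: m i) = local_val (fraction a tP) * local_val (m i).
    by [].
  by rewrite zE /= mulf_div !rmorphM.
Qed.

Lemma to_local_gen a : ((to_local a : A^o) \in N) <-> local_kernel I P a.
Proof.
split=> [/gen_fraction[x [s [Ix sP]]]|[s sP Is]].
  rewrite to_localE => E; exists s => //.
  suff -> : s * a = x by [].
  apply/eqP; rewrite -tofrac_eq rmorphM /= E mulrCA divff ?mulr1 //.
  exact: notin_neq0 sP.
apply: (@fraction_S _ (s * a) s) => //.
by rewrite to_localE rmorphM /= mulrC mulKf // (notin_neq0 sP).
Qed.

Definition to_quotient (a : R) : M := \pi_(Quotient.quot N) (to_local a : A^o).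

Lemma pi_eq (x y : A^o) :
  (\pi_(Quotient.quot N) x = \pi_(Quotient.quot N) y) <-> x - y \in N.
Proof.
by split=> [/eqP|h]; [rewrite -Quotient.idealrBE | apply/eqP; rewrite -Quotient.idealrBE].
Qed.

Lemma to_quotient_eq a b : to_quotient a = to_quotient b <-> local_kernel I P (a - b).
Proof. by rewrite -to_local_gen to_localB -pi_eq. Qed.

(** A fraction a / s is congruent to a t when s t is 1 modulo the kernel. *)
Lemma to_local_dense (z : A) : exists a, (z - to_local a : A^o) \in N.
Proof.
have [a [s [sP ->]]] := fraction_of z; have [t Kt] := unitP sP.
exists (a * t).
have -> : fraction a sP - to_local (a * t) = fraction a sP * to_local (1 - s * t).
  apply: local_val_inj; rewrite local_valB local_valM !to_localE /=.
  rewrite rmorphB rmorph1 mulrBr mulr1 !rmorphM /=; congr (_ - _).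
  by rewrite [RHS]mulrA mulfVK // (notin_neq0 sP).
by apply: genNZ; apply/to_local_gen.
Qed.

Lemma to_quotient_onto (y : M) : exists a, y = to_quotient a.
Proof.
have [a Na] := to_local_dense (repr y : A^o); exists a.
by rewrite -[LHS]reprK; apply/pi_eq.
Qed.

Lemma to_quotientB a b : to_quotient (a - b) = to_quotient a - to_quotient b.
Proof.
rewrite /to_quotient to_localB.
exact: (raddfB (\pi_(Quotient.quot N) : A^o -> _)).
Qed.

Lemma to_quotient0 : to_quotient 0 = 0.
Proof. by rewrite -[X in to_quotient X](subrr 0) to_quotientB subrr. Qed.

Lemma to_quotientD a b : to_quotient (a + b) = to_quotient a + to_quotient b.
Proof.
by rewrite -{1}[b]opprK -[- b]sub0r !to_quotientB to_quotient0 sub0r opprK.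
Qed.

Lemma scale_to_quotient (z : A) a : exists b, z *: to_quotient a = to_quotient (b * a).
Proof.
have [b Nb] := to_local_dense z; exists b.
rewrite [LHS](@quot_scale_pi A A^o S z (to_local a)); apply/pi_eq.
rewrite to_localM.
have -> : z *: (to_local a : A^o) - to_local b * to_local a =
  to_local a *: (z - to_local b : A^o).
  by rewrite -[LHS]/(z * _ - _) -mulrBl mulrC.
exact: genNZ.
Qed.

(** Chains of submodules of A / (S) correspond to chains of ideals of R above
   the kernel of R -> A / (S). *)
Definition strict_chain d : Prop := exists c : nat -> set R,
  (forall i, (i <= d)%N -> ideal (c i) /\ local_kernel I P `<=` c i) /\
  (forall i, (i < d)%N -> c i `<=` c i.+1 /\ ~ c i.+1 `<=` c i).

Lemma submod_closedP (T : {pred M}) : submod_closed T ->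
  [/\ 0 \in T, forall x y, x \in T -> y \in T -> x + y \in T &
   forall (z : A) x, x \in T -> z *: x \in T].
Proof.
move=> [T0 TZ]; split=> // [x y xT yT|z x xT].
  by rewrite -[x]scale1r; apply: TZ.
by rewrite -[z *: x]addr0; apply: TZ.
Qed.

Lemma chain_of_quotient d :
  has_chain (fun T T' : {pred M} =>
    [/\ submod_closed T, submod_closed T' & psubset T T']) d ->
  (0 < d)%N -> strict_chain d.
Proof.
move=> [c cP] d0.
have cl i : (i <= d)%N -> submod_closed (c i).
  rewrite leq_eqVlt => /predU1P[->|/cP[] //].
  by rewrite -(prednK d0); case: (cP d.-1); rewrite ?prednK.
exists (fun i => [set a | to_quotient a \in c i]); split=> i id.
  have [c0 cD cZ] := submod_closedP (cl i id).
  split; first split.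
  - by rewrite /= to_quotient0.
  - by move=> a b /= aT bT; rewrite to_quotientD; apply: cD.
  - move=> a b /= bT; have := cZ (to_local a) _ bT.
    suff -> : to_local a *: to_quotient b = to_quotient (a * b) by [].
    rewrite [LHS](@quot_scale_pi A A^o S (to_local a) (to_local b)).
    by rewrite /to_quotient to_localM.
  - move=> a Ka /=; suff -> : to_quotient a = to_quotient 0 by rewrite to_quotient0.
    by apply/to_quotient_eq; rewrite subr0.
have [_ _ [sub nsub]] := cP i id; split=> [a /=|sub']; first exact: sub.
by apply: nsub => y; have [a ->] := to_quotient_onto y; apply: sub'.
Qed.

Lemma quotient_of_chain d : strict_chain d ->
  has_chain (fun T T' : {pred M} =>
    [/\ submod_closed T, submod_closed T' & psubset T T']) d.
Proof.
move=> [c [cI cS]].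
pose T i : {pred M} := fun y => `[< exists2 a, c i a & y = to_quotient a >].
have Tmem i a : (i <= d)%N -> (to_quotient a \in T i) <-> c i a.
  move=> id; have [[_ cD _] Kc] := cI i id; split=> [/asboolP[b cb /to_quotient_eq Kab]|ca].
    by rewrite -[a](subrK b); apply: cD; first exact: Kc.
  by apply/asboolP; exists a.
have Tc i : (i <= d)%N -> submod_closed (T i).
  move=> id; have [[c0 cD cM] Kc] := cI i id; split.
    by apply/asboolP; exists 0; rewrite ?to_quotient0.
  move=> z x y /asboolP[a ca ->] /asboolP[b cb ->].
  have [e ->] := scale_to_quotient z a.
  by rewrite -to_quotientD; apply/(Tmem i _ id)/cD => //; apply: cM.
exists T => i id; split; [exact: Tc (ltnW id) | exact: Tc |].
have [sub nsub] := cS i id; split=> [y|sub'].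
  by have [a ->] := to_quotient_onto y; move=> /(Tmem _ _ (ltnW id))/sub ca; apply/Tmem.
by apply: nsub => a ca; apply/(Tmem _ _ (ltnW id))/sub'/Tmem.
Qed.

Lemma quotient_length (RR : realType) n :
  (forall d, strict_chain d <-> (d <= n)%N) ->
  module_length RR M = (n%:R)%:E.
Proof.
move=> cE; apply/eqP; rewrite eq_le; apply/andP; split.
  apply: ge_ereal_sup => _ [d ch <-]; rewrite lee_fin ler_nat.
  by case: d ch => // d ch; apply/cE/chain_of_quotient.
by apply: ereal_sup_ubound; exists n => //; apply: quotient_of_chain; apply/cE.
Qed.

Lemma quotient_card n : has_index [set: R] (local_kernel I P) n ->
  #|` fset_set [set: M] | = n.
Proof.
move=> [_ [s [us _ sK sc] <-]].
have inj : {in s &, injective to_quotient}.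
  by move=> a b as_ bs /to_quotient_eq; apply: sK.
have -> : [set: M] = [set` [fset y in map to_quotient s]%fset].
  apply/seteqP; split=> y // _; have [a ->] := to_quotient_onto y.
  have [b bs Kb] := sc a Logic.I; rewrite /= inE /=.
  by apply/mapP; exists b => //; apply/to_quotient_eq.
rewrite set_fsetK card_fseq undup_id ?size_map //.
by rewrite map_inj_in_uniq.
Qed.

End LocalQuotient.

Section NaiveAt.
Variables (RR : realType) (R : idomainType) (ID IE : set R) (P : spec R).
Local Notation I := (ideal_add ID IE).
Local Notation A := (local_ring P).
Hypotheses (idD : ideal ID) (idE : ideal IE).

Lemma gen_submod_mem (S : set A^o) (z : A^o) : S z -> z \in gen_submod S.
Proof.
move=> Sz; apply/asboolP; exists 1%N, (fun=> 1), (fun=> z); split=> //.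
by rewrite big_ord1 scale1r.
Qed.

Lemma sum_generators (z : A^o) : (localized_ideal P ID `|` localized_ideal P IE) z ->
  exists x s, [/\ I x, s \notin ideal_of P & local_val z = x%:F / s%:F].
Proof.
case=> -[x [s [Ix sP zE]]]; exists x, s; split=> //.
  exact: ideal_addl idE _ Ix.
exact: ideal_addr idD _ Ix.
Qed.

Lemma sum_fractions (z : A) x s : I x -> s \notin ideal_of P ->
  local_val z = x%:F / s%:F ->
  (z : A^o) \in gen_submod (localized_ideal P ID `|` localized_ideal P IE).
Proof.
move=> [a [b [Da Eb ->]]] sP zE.
have -> : z = fraction a sP + fraction b sP.
  apply: local_val_inj; rewrite zE.
  by rewrite -[RHS]/(a%:F / s%:F + b%:F / s%:F) rmorphD mulrDl.
apply: (@rpredD _ (gen_submod (localized_ideal P ID `|` localized_ideal P IE))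
  (fraction a sP : A^o) (fraction b sP)).
  by apply: gen_submod_mem; left; exists a, s.
by apply: gen_submod_mem; right; exists b, s.
Qed.

Lemma residue_card q : maximal P -> has_index [set: R] (prime_set P) q ->
  #|` fset_set [set: residue_field P] | = q.
Proof.
move=> maxP iq; have iP := prime_set_ideal P.
have kE : local_kernel (prime_set P) P = prime_set P.
  apply/seteqP; split=> x.
    by move=> [s sP]; rewrite /prime_set /= prime_mul (negbTE sP).
  by move=> xP; exists 1; rewrite ?prime1 // mul1r.
apply: (quotient_card (I := prime_set P)) => //.
- by move=> z x s Px sP zE; apply: gen_submod_mem; exists x, s.
- by move=> s /maxP[y Py]; exists y; rewrite kE.
- by rewrite kE.
Qed.

Hypothesis idealI : ideal I.

(** The length L satisfies n = q ^ L, where q is the order of the residue field.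
   *)
Lemma naive_at_above q n : maximal P -> has_index [set: R] (prime_set P) q ->
  has_index [set: R] (local_kernel I P) n ->
  (forall s, s \notin ideal_of P -> exists t, local_kernel I P (1 - s * t)) ->
  naive_at RR ID IE P = (ln (n%:R : RR))%:E.
Proof.
move=> maxP iq iN unitP; rewrite /naive_at (residue_card maxP iq).
have iK := local_kernel_ideal idealI P.
have gP := ideal_subgroup (prime_set_ideal P).
have gR : subgroup [set: R] by [].
have q1 : (1 < q)%N.
  rewrite ltn_neqAle (index_gt0 gR iq) andbT; apply/eqP => q1.
  rewrite -q1 in iq; have /(_ 1 Logic.I) := index1_sub gR gP iq.
  by rewrite /prime_set /= (negbTE (prime1 P)).
have maxP' a : ~ prime_set P a -> exists t, prime_set P (1 - a * t).
  by move=> /negP /maxP.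
have locP a : prime_set P a ->
    exists t, forall x : R^o, local_kernel I P (x - (t * (1 - a)) *: x).
  move=> aP; have [|t Kt] := unitP (1 - a * 1); first exact: notin_one_sub.
  exists t => x; rewrite -[X in X - _]mul1r -mulrBl.
  by rewrite mulr1 in Kt; rewrite [t * _]mulrC; apply: (ideal_mulr x iK Kt).
have mulP a b : prime_set P b -> prime_set P (a * b).
  by case: (prime_set_ideal P) => _ _; apply.
have mK : @submodule R R^o (local_kernel I P) by [].
have mT : @submodule R R^o [set: R] by [].
have [L [c [[nE c0 cL mc] ci]]] :=
  length_exists mulP gP iq maxP' locP q1 mK mT (fun _ h => h) iN.
have cmono i j : (i <= j <= L)%N -> c i `<=` c j.
  elim: j => [|j IH] /andP[]; first by rewrite leqn0 => /eqP -> _ x.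
  rewrite leq_eqVlt => /predU1P[-> _ x //|ij jL x cx].
  by apply: (ci j jL).1; apply: IH => //; apply/andP; split; [rewrite -ltnS | exact: ltnW].
have lengthE : module_length RR (quot_module
    (localized_ideal P ID `|` localized_ideal P IE)) = (L%:R)%:E.
  apply: (quotient_length (I := I)) => //.
  - exact: sum_generators.
  - exact: sum_fractions.
  move=> d; split=> [[e [eI eS]]|dL].
    rewrite -(leq_exp2l _ _ q1) -nE.
    apply: (chain_length mulP gP iq maxP' locP q1 mT iN mK _ eS).
    by move=> i /eI[].
  exists c; split=> i id.
    split; first exact: mc.
    by rewrite -c0; apply: cmono; rewrite /= (leq_trans id).
  have ciq := ci i (leq_trans id dL); split; first exact: ciq.1.
  move=> sub; have E : c i.+1 = c i by apply/seteqP; split=> //; exact: ciq.1.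
  have gi : subgroup (c i) := submodule_subgroup (mc i).
  rewrite E in ciq; move: q1.
  by rewrite (index_unique gi ciq (index_refl gi)).
rewrite lengthE nE -EFinM; congr (_%:E).
rewrite natrX lnXn ?mulr_natl // ltr0n; lia.
Qed.

(** The quotient of the local ring is zero, hence of length 0. *)
Lemma naive_at_off : ~ (I `<=` prime_set P) -> naive_at RR ID IE P = 0%E.
Proof.
move=> nIP; rewrite /naive_at.
have [s Is sP] : exists2 s, I s & s \notin ideal_of P.
  apply: contrapT => no; apply: nIP => x Ix; apply: contrapT => /negP xP.
  by apply: no; exists x.
have KT x : local_kernel I P x by exists s => //; apply: ideal_mulr.
suff -> : module_length RR (quot_module
    (localized_ideal P ID `|` localized_ideal P IE)) = (0%:R)%:E by rewrite mul0e.
apply: (quotient_length (I := I)) => //.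
- exact: sum_generators.
- exact: sum_fractions.
- by move=> t _; exists 0.
move=> d; split=> [[c [cI cS]]|]; last first.
  by rewrite leqn0 => /eqP ->; exists (fun=> [set: R]).
case: d cI cS => // d cI cS.
have [_ []] := cS 0%N isT; move=> x _; have [_] := cI 0%N isT; exact.
Qed.

End NaiveAt.

(** * Polynomials given by lists *)

Section PolynomialLists.
Variable n : nat.
Local Notation S := {mpoly int[n]}.
Implicit Types (s : tpoly) (f g : S).

Definition mono (e : seq nat) : 'X_{1..n} := [multinom nth 0%N e i | i < n].

Definition pval (s : tpoly) : S := \sum_(t <- s) t.1%:R *: 'X_[mono t.2].

Lemma pval_cons t s : pval (t :: s) = t.1%:R *: 'X_[mono t.2] + pval s.
Proof. exact: big_cons. Qed.

Lemma pval_cat s s' : pval (s ++ s') = pval s + pval s'.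
Proof. exact: big_cat. Qed.

Lemma pval_flatten (ss : seq tpoly) : pval (flatten ss) = \sum_(s <- ss) pval s.
Proof.
elim: ss => [|s ss IH]; first by rewrite /pval !big_nil.
by rewrite /= pval_cat IH big_cons.
Qed.

Lemma mono_mul t u : mono (mul_term n t u).2 = (mono t.2 + mono u.2)%MM.
Proof.
apply/mnmP => i; rewrite mnmDE !mnmE /=.
by rewrite (nth_map 0%N) ?size_iota // nth_iota.
Qed.

Lemma pval_mul s s' : pval (mul_tpoly n s s') = pval s * pval s'.
Proof.
rewrite /mul_tpoly pval_flatten big_map mulr_suml; apply: eq_bigr => t _.
rewrite /pval big_map mulr_sumr; apply: eq_bigr => u _.
by rewrite mono_mul mpolyXD /= natrM -scalerAl -scalerAr scalerA.
Qed.

Lemma pval_const c : pval [:: (c, [::])] = c%:R.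
Proof.
rewrite /pval big_seq1 /=; have -> : mono [::] = 0%MM.
  by apply/mnmP => i; rewrite mnmE mnm0E nth_nil.
by rewrite mpolyX0 scaler_nat.
Qed.

Lemma pval_exp k s : pval (exp_tpoly n k s) = pval s ^+ k.
Proof.
rewrite /exp_tpoly; elim: k => [|k IH]; first by rewrite pval_const.
by rewrite iterS pval_mul IH exprS.
Qed.

Lemma pval_lincomb cs (G : seq tpoly) :
  pval (lincomb n cs G) = \sum_(i < size G) pval (nth [::] cs i) * pval (nth [::] G i).
Proof.
have iotaE : iota 0 (size G) = index_iota 0 (size G) by rewrite /index_iota subn0.
rewrite /lincomb pval_flatten big_map iotaE big_mkord.
by apply: eq_bigr => i _; rewrite pval_mul.
Qed.

Lemma mono_power j k (jn : (j < n)%N) :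
  mono (rcons (nseq j 0%N) k) = (U_(Ordinal jn) *+ k)%MM.
Proof.
apply/mnmP => i; rewrite mnmE mulmnE mnm1E nth_rcons size_nseq nth_nseq.
case: (ltngtP i j) => ij.
- by rewrite -val_eqE /= gtn_eqF ?muln0 // mulnC muln0.
- by rewrite -val_eqE /= ltn_eqF ?mul0n.
- by rewrite -val_eqE /= ij eqxx mul1n.
Qed.

Lemma enum_mono (r : 'X_{1..n}) : mono [seq r i | i <- enum 'I_n] = r.
Proof.
apply/mnmP => i; rewrite mnmE (nth_map i) ?size_enum_ord //.
by rewrite nth_ord_enum.
Qed.

Lemma natr_scale m (c : int) (f : S) : m%:R * (c *: f) = (m%:R * c) *: f.
Proof. by rewrite mulr_natl -scaler_nat scalerA. Qed.

Lemma pval_mod m f : (0 < m)%N -> exists s g, f = pval s + m%:R * g.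
Proof.
move=> m0; exists [seq (`|(f@_e %% m)%Z|%N, [seq e i | i <- enum 'I_n]) | e <- msupp f].
exists (\sum_(e <- msupp f) (f@_e %/ m)%Z *: 'X_[e]).
rewrite /pval big_map mulr_sumr -big_split /= {1}[f]mpolyE; apply: eq_bigr => e _.
rewrite enum_mono natr_scale -scalerDl; congr (_ *: _).
have -> : (`|(f@_e %% m)%Z|%N%:R : int) = (f@_e %% m)%Z.
  by rewrite natz gez0_abs // modz_ge0 // -lt0n.
by rewrite {1}(divz_eq f@_e m) addrC natz [_ * m%:Z]mulrC.
Qed.

Lemma pval_to_tpoly m (s : poly_data) : (0 < m)%N ->
  exists g, poly_of n s = pval (to_tpoly m (raw s)) + m%:R * g.
Proof.
move=> m0; elim: s => [|[c e] s [g E]].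
  by exists 0; rewrite /poly_of /pval !big_nil mulr0 addr0.
have [q qE] : exists q : int, c = (residue m (enc_int c))%:R + m%:R * q.
  rewrite /residue; case: c => k /=.
    by exists 0; rewrite odd_double doubleK mulr0 addr0 natz.
  have mE : m%:R = m.-1%:R + 1 :> int by rewrite natr1 prednK.
  exists (- k.+1%:R); rewrite odd_double /= uphalf_double NegzE natrM mE.
  by rewrite mulrDl mul1r mulrN [k.+1%:R * _]mulrC addNKr natz.
exists (q *: 'X_[mono e] + g).
rewrite /poly_of big_cons -/(poly_of n s) E /= pval_cons /= mulrDr [RHS]addrACA.
by congr (_ + _); rewrite {1}qE scalerDl natr_scale.
Qed.

Section Collapse.
Variables (a b m : nat).

Definition redm (e : 'X_{1..n}) : 'X_{1..n} := [multinom red a b (e i) | i < n].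

(** The coefficient of X ^ r after the reduction of exponents *)
Definition collapse (r : 'X_{1..n}) f : int :=
  \sum_(e <- msupp f | redm e == r) f@_e.

Lemma collapse_wide r f (l : seq 'X_{1..n}) : uniq l -> {subset msupp f <= l} ->
  collapse r f = \sum_(e <- l | redm e == r) f@_e.
Proof.
move=> ul sub; rewrite /collapse.
rewrite [RHS](bigID (fun e => e \in msupp f)) /= addrC [X in X + _]big1 ?add0r; last first.
  by move=> e /andP[_]; rewrite -mcoeff_eq0 => /eqP.
rewrite -big_filter -[RHS]big_filter; apply: perm_big; apply: uniq_perm.
- by apply: filter_uniq.
- exact: filter_uniq.
move=> e; rewrite !mem_filter; case es: (e \in msupp f); last by rewrite !andbF.
by rewrite (sub _ es) !andbT.
Qed.

Lemma collapseD r f g : collapse r (f + g) = collapse r f + collapse r g.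
Proof.
pose l := undup (msupp f ++ msupp g ++ msupp (f + g)).
have ul : uniq l by apply: undup_uniq.
rewrite !(@collapse_wide r _ l) // ?big_split //=; try by
  move=> e es; rewrite mem_undup !mem_cat es ?orbT.
by rewrite -big_split; apply: eq_bigr => e _; rewrite mcoeffD.
Qed.

Lemma collapse0 r : collapse r 0 = 0.
Proof. by rewrite /collapse msupp0 big_nil. Qed.

Lemma collapseN r f : collapse r (- f) = - collapse r f.
Proof.
by apply/eqP; rewrite -addr_eq0 -collapseD addNr collapse0.
Qed.

Lemma collapse_sum r (T : Type) (l : seq T) (F : T -> S) :
  collapse r (\sum_(i <- l) F i) = \sum_(i <- l) collapse r (F i).
Proof.
elim: l => [|x l IH]; first by rewrite !big_nil collapse0.
by rewrite !big_cons collapseD IH.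
Qed.

Lemma collapse_term r c e :
  collapse r (c *: 'X_[e]) = if redm e == r then c else 0.
Proof.
rewrite (@collapse_wide _ _ [:: e]) //.
  by rewrite big_mkcond big_seq1 mcoeffZ mcoeffX eqxx mulr1.
move=> e'; rewrite inE; apply: contraTT => ne.
by rewrite -mcoeff_eq0 mcoeffZ mcoeffX [e == _]eq_sym (negbTE ne) mulr0.
Qed.

Lemma collapse_pval r s :
  collapse r (pval s) = \sum_(t <- s | redm (mono t.2) == r) (t.1%:R : int).
Proof.
rewrite /pval collapse_sum [RHS]big_mkcond; apply: eq_bigr => t _.
by rewrite collapse_term.
Qed.

Lemma same_monE e e' : same_mon n a b e e' = (redm (mono e) == redm (mono e')).
Proof.
apply/allP/eqP => [h|h i].
  apply/mnmP => i; rewrite !mnmE; apply/eqP/h.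
  by rewrite mem_iota add0n ltn_ord.
rewrite mem_iota add0n => /= lt; apply/eqP.
by move/mnmP: h => /(_ (Ordinal lt)); rewrite !mnmE.
Qed.

(** The ideal of the polynomials that become zero modulo m when the exponents
    are reduced. *)
Definition collapsing : set S := [set f | forall r, (m %| collapse r f)%Z].

Lemma vanishesE s : vanishes n m a b s <-> collapsing (pval s).
Proof.
have E e : ((ncoef n a b e s)%:R : int) = collapse (redm (mono e)) (pval s).
  rewrite collapse_pval /ncoef sumnE big_map natr_sum [RHS]big_mkcond.
  by apply: eq_bigr => t _; rewrite same_monE; case: ifP.
split=> [/allP h r|h].
  have [/hasP[t ts /eqP <-]|/hasPn no] :=
    boolP (has (fun t => redm (mono t.2) == r) s).
    by rewrite -E natz; apply: h.
  rewrite collapse_pval big_seq_cond big1 ?dvdz0 // => t /andP[ts].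
  by rewrite (negbTE (no t ts)).
by apply/allP => t _; have := h (redm (mono t.2)); rewrite -E natz.
Qed.

Lemma collapsing_subgroup : subgroup collapsing.
Proof.
split=> [r|f g Kf Kg r]; first by rewrite collapse0 dvdz0.
by rewrite collapseD collapseN rpredB ?Kf ?Kg.
Qed.

Lemma collapsing_sum (T : Type) (l : seq T) (F : T -> S) :
  (forall i, collapsing (F i)) -> collapsing (\sum_(i <- l) F i).
Proof.
move=> KF; apply: big_ind => //; first by case: collapsing_subgroup.
by move=> x y; apply: subgroupD collapsing_subgroup.
Qed.

Lemma collapsing_multiple f : collapsing (m%:R * f).
Proof.
move=> r; rewrite mulr_natl; have -> k : collapse r (f *+ k) = collapse r f *+ k.
  elim: k => [|k IH]; first by rewrite !mulr0n collapse0.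
  by rewrite !mulrS collapseD IH.
by rewrite -mulr_natl natz dvdz_mulr.
Qed.

Lemma red_add x y : red a b (x + red a b y) = red a b (x + y).
Proof.
rewrite {2}/red; case: ltnP => // ay; rewrite /red.
case: (posnP b) => [->|b0]; first by rewrite modn0 subnKC // (leq_trans (leq_addr b a) ay).
have E : (x + (a + (y - a) %% b) = a + (x + (y - a) %% b))%N by rewrite addnCA.
have E2 : (x + y = a + (x + (y - a)))%N.
  by rewrite addnCA subnKC // (leq_trans (leq_addr b a) ay).
have big : (a + b <= x + y)%N by rewrite (leq_trans ay) ?leq_addl.
rewrite [(x + y < _)%N]ltnNge big /= E2 E addKn.
case: ltnP => [lt|ge].
  congr addn; rewrite ltn_add2l in lt; rewrite -[LHS](modn_small lt) modnDmr.
  by rewrite addKn.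
by rewrite addKn modnDmr.
Qed.

Lemma redm_add e e' : redm (e + redm e')%MM = redm (e + e')%MM.
Proof. by apply/mnmP => i; rewrite !mnmE red_add. Qed.

(* Terms are grouped by their reduced exponents. *)
Lemma sum_classes (l : seq 'X_{1..n}) (Q : pred 'X_{1..n}) (F : 'X_{1..n} -> int) :
  \sum_(e <- l | Q (redm e)) F e =
  \sum_(r <- undup (map redm l) | Q r) \sum_(e <- l | redm e == r) F e.
Proof.
rewrite (exchange_big_dep (fun e => Q (redm e))) /=; last first.
  by move=> r e Qr /eqP ->.
rewrite big_seq_cond [RHS]big_seq_cond; apply: eq_bigr => e /andP[el Qe].
rewrite (eq_bigl (fun r => r == redm e)); last first.
  by move=> r; rewrite eq_sym; case: eqP => [->|]; rewrite ?Qe ?andbF.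
by rewrite -big_filter filter_pred1_uniq ?undup_uniq ?mem_undup ?map_f // big_seq1.
Qed.

(** The coefficients of X ^ u f after reduction are sums of those of f, because
   the reduction of u + e only depends on that of e. *)
Lemma collapsing_mul g f : collapsing f -> collapsing (g * f).
Proof.
move=> Kf; rewrite {1}[g]mpolyE mulr_suml; apply: collapsing_sum => u r.
rewrite {1}[f]mpolyE mulr_sumr collapse_sum.
under eq_bigr do rewrite -scalerAl -scalerAr scalerA -mpolyXD collapse_term
  -redm_add.
rewrite -big_mkcond (sum_classes _ (fun e => redm (u + e)%MM == r)).
apply: (big_ind (fun z => (m %| z)%Z)); first exact: dvdz0.
  by move=> y z; apply: rpredD.
by move=> r' _; rewrite -mulr_sumr; apply/dvdz_mull/Kf.
Qed.

Lemma collapsing_exact f : b = 0%N -> collapsing f -> exists g, f = m%:R * g.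
Proof.
move=> b0 Kf.
have redE e : redm e = e.
  apply/mnmP => i; rewrite mnmE /red b0 addn0 modn0.
  by case: ltnP => // h; rewrite subnKC.
have dv e : (m %| f@_e)%Z.
  have := Kf e; rewrite /collapse (eq_bigl (fun e' => e' == e)); last by move=> e'; rewrite redE.
  rewrite -big_filter; case: (boolP (e \in msupp f)) => ef.
    by rewrite filter_pred1_uniq // big_seq1.
  by move=> _; rewrite memN_msupp_eq0 // dvdz0.
exists (\sum_(e <- msupp f) (f@_e %/ m)%Z *: 'X_[e]).
rewrite mulr_sumr {1}[f]mpolyE; apply: eq_bigr => e _.
by rewrite mulr_natl -scaler_nat scalerA natz [_ * _]mulrC divzK.
Qed.

End Collapse.
End PolynomialLists.

(** * Normal forms and membership *)

Lemma choicesP (T : eqType) (x0 : T) (ls : seq (seq T)) (s : seq T) :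
  (s \in choices ls) <->
  size s = size ls /\ forall i, (i < size ls)%N -> nth x0 s i \in nth [::] ls i.
Proof.
elim: ls s => [|l ls IH] s.
  by rewrite inE; split=> [/eqP ->|[/size0nil ->]].
rewrite /= -/(choices ls) -[flatten _]/([seq x :: s | x <- l, s <- choices ls]).
split=> [/allpairsP[[x t] /= [xl /IH[st ht] ->]]|].
  by rewrite /= st; split=> // -[|i] //=; apply: ht.
case: s => [[]//|x t] /= [[st] h].
apply/allpairsP; exists (x, t); split=> //=; first exact: (h 0%N).
by apply/IH; split=> // i il; apply: (h i.+1).
Qed.

Lemma choices_uniq (T : eqType) (ls : seq (seq T)) : all uniq ls -> uniq (choices ls).
Proof.
elim: ls => [//|l ls IH] /= /andP[ul /IH uls].
rewrite -/(choices ls) -[flatten _]/([seq x :: s | x <- l, s <- choices ls]).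
by apply: allpairs_uniq => // -[x s] [y t] _ _ /= [-> ->].
Qed.

Section NormalForms.
Variables (n a b m : nat).
Hypotheses (b_gt0 : (0 < b)%N) (m_gt0 : (0 < m)%N).
Local Notation S := {mpoly int[n]}.
Local Notation redm := (@redm n a b).
Local Notation K := (@collapsing n a b m).

Definition exponents : seq (seq nat) := choices (nseq n (iota 0 (a + b))).

Definition form (c : seq nat -> nat) : tpoly := [seq (c e, e) | e <- exponents].

Lemma exponents_uniq : uniq exponents.
Proof.
apply: choices_uniq; apply/allP => l; rewrite mem_nseq => /andP[_ /eqP ->].
exact: iota_uniq.
Qed.

Lemma exponentsP e : (e \in exponents) <->
  size e = n /\ forall i, (i < n)%N -> (nth 0%N e i < a + b)%N.
Proof.
rewrite (choicesP 0%N) size_nseq.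
split=> -[se h]; split=> // i lt; have := h i lt; by
  rewrite nth_nseq lt mem_iota add0n.
Qed.

Lemma red_lt x : (red a b x < a + b)%N.
Proof. by rewrite /red; case: (ltnP x (a + b)) => // _; rewrite ltn_add2l ltn_pmod. Qed.

Lemma redm_exponents e : e \in exponents -> redm (mono n e) = mono n e.
Proof.
move=> /exponentsP[_ lt]; apply/mnmP => i; rewrite !mnmE /red.
by rewrite lt ?ltn_ord.
Qed.

Lemma mono_exponents_inj : {in exponents &, injective (mono n)}.
Proof.
move=> e e' /exponentsP[se _] /exponentsP[se' _] /mnmP E.
apply: (@eq_from_nth _ 0%N); rewrite ?se ?se' // => i lt.
by have := E (Ordinal lt); rewrite !mnmE.
Qed.

Lemma form_collapse c r :
  collapse a b r (pval n (form c)) =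
  \sum_(e <- exponents | mono n e == r) ((c e)%:R : int).
Proof.
rewrite collapse_pval /form big_map /= big_seq_cond [RHS]big_seq_cond.
apply: eq_bigl => e; case: (boolP (e \in _)) => //= /redm_exponents.
by move=> ->.
Qed.

Lemma form_coef c e : e \in exponents ->
  collapse a b (mono n e) (pval n (form c)) = (c e)%:R.
Proof.
move=> eE; rewrite form_collapse big_seq_cond (eq_bigl (fun e' => e' == e)).
  by rewrite -big_filter filter_pred1_uniq ?exponents_uniq // big_seq1.
move=> e'; case: (boolP (e' \in _)) => /= [e'E|].
  by apply/eqP/eqP => [/mono_exponents_inj ->|->].
by case: eqP => [->|//]; rewrite eE.
Qed.

Lemma normal_formsP q : q \in normal_forms n m a b <->
  exists2 c, (forall e, c e < m)%N & q = form c.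
Proof.
rewrite /normal_forms -/exponents (choicesP (0%N, [::])) size_map.
split=> [[sq h]|[c cm ->]].
  exists (fun e => nth 0%N (map fst q) (index e exponents) %% m)%N.
    by move=> e; rewrite ltn_pmod.
  apply: (@eq_from_nth _ (0%N, [::])); first by rewrite size_map.
  rewrite sq => i lt; rewrite (nth_map [::]) // index_uniq ?exponents_uniq //.
  have := h i lt; rewrite (nth_map [::]) // => /mapP[c]; rewrite mem_iota /= => cm E.
  by rewrite (nth_map (0%N, [::])) ?sq // E /= modn_small.
rewrite /form size_map; split=> // i lt; rewrite !(nth_map [::]) //.
by apply/mapP; exists (c (nth [::] exponents i)) => //; rewrite mem_iota add0n; apply: cm.
Qed.

Lemma normal_forms_uniq : uniq (normal_forms n m a b).
Proof.
apply: choices_uniq; apply/allP => _ /mapP[e _ ->].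
by rewrite map_inj_uniq ?iota_uniq // => x y [->].
Qed.

(** Euclidean division of exponents and coefficients: the normal forms represent
   the classes modulo the collapsing ideal. *)
Lemma normal_forms_reps :
  coset_reps [set: S] K (map (pval n) (normal_forms n m a b)) .
Proof.
have inj : {in normal_forms n m a b &, forall q q', K (pval n q - pval n q') -> q = q'}.
  move=> q q' /normal_formsP[c cm ->] /normal_formsP[c' cm' ->] Kcc.
  apply/eq_in_map => e eE; congr (_, _).
  have := Kcc (mono n e); rewrite collapseD collapseN !form_coef //.
  by rewrite -eqz_mod_dvd !natz !modz_nat !modn_small // => /eqP[].
split=> //.
- rewrite map_inj_in_uniq ?normal_forms_uniq // => q q' qQ qQ' E; apply: inj => //.
  by rewrite E subrr; case: (collapsing_subgroup n a b m).
- move=> _ _ /mapP[q qQ ->] /mapP[q' qQ' ->] /inj -> //.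
- move=> f _; pose c e := `|(collapse a b (mono n e) f %% m)%Z|%N.
  have cE e : ((c e)%:R : int) = (collapse a b (mono n e) f %% m)%Z.
    by rewrite natz gez0_abs // modz_ge0 // -lt0n.
  have cm e : (c e < m)%N.
    by rewrite -ltz_nat -[X in X < _]natz cE ltz_pmod.
  exists (pval n (form c)); first by apply/map_f/normal_formsP; exists c.
  move=> r; rewrite collapseD collapseN.
  have [/hasP[e eE /eqP <-]|/hasPn no] := boolP (has (fun e => mono n e == r) exponents).
    by rewrite form_coef // cE -eqz_mod_dvd modz_mod.
  rewrite form_collapse [X in _ - X]big_seq_cond big1 ?subr0; last first.
    by move=> e /andP[eE]; rewrite (negbTE (no e eE)).
  rewrite /collapse big_seq_cond big1 ?dvdz0 // => e /andP[_ /eqP er].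
  have rE : [seq r i | i <- enum 'I_n] \in exponents.
    apply/exponentsP; rewrite size_map size_enum_ord; split=> // i lt.
    by rewrite (nth_map (Ordinal lt)) ?size_enum_ord // -er mnmE red_lt.
  by have := no _ rE; rewrite enum_mono eqxx.
Qed.

Section Image.
Variables (R : comNzRingType) (phi : {rmorphism S -> R}) (J : set R).
Hypotheses (idealJ : ideal J) (Jm : J m%:R).
Hypothesis cycleJ : forall i, J (phi 'X_i ^+ (a + b) - phi 'X_i ^+ a).

Lemma cycle_power i x : J (phi 'X_i ^+ x - phi 'X_i ^+ red a b x).
Proof.
have gJ := ideal_subgroup idealJ; have [J0 JD JM] := idealJ.
rewrite /red; case: ltnP => [_|le]; first by rewrite subrr.
have ax : (a <= x)%N := leq_trans (leq_addr b a) le.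
rewrite -{1}(subnKC ax) {1}(divn_eq (x - a) b); move: (_ %% b)%N => r.
elim: (_ %/ b)%N => [|q IH]; first by rewrite mul0n add0n subrr.
apply: subgroup_trans IH => //.
have -> : (a + (q.+1 * b + r) = a + b + (q * b + r))%N by lia.
by rewrite !exprD -mulrBl -exprD; apply: ideal_mulr.
Qed.

Lemma cycle_monomial e : J (phi 'X_[e] - phi 'X_[redm e]).
Proof.
have gJ := ideal_subgroup idealJ; have [J0 JD JM] := idealJ.
rewrite !mpolyXE_id !rmorph_prod /=.
apply: (big_ind2 (fun x y => J (x - y))).
- by rewrite subrr.
- move=> x x' y y' Jx Jy; apply: (@subgroup_trans _ _ (x' * y)) => //.
    by rewrite -mulrBl; apply: ideal_mulr.
  by rewrite -mulrBr; apply: JM.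
- by move=> i _; rewrite !rmorphXn mnmE; apply: cycle_power.
Qed.

Lemma phi_scale (c : int) f : phi (c *: f) = c%:~R * phi f.
Proof. by rewrite -mul_mpolyC rmorphM mpolyC_int rmorph_int. Qed.

(** Modulo J a monomial is equal to the one with reduced exponents, so that
   phi f is a combination of monomials whose coefficients are multiples of m. *)
Lemma collapsing_image f : K f -> J (phi f).
Proof.
move=> Kf; have gJ := ideal_subgroup idealJ; have [J0 JD JM] := idealJ.
pose f' := \sum_(e <- msupp f) f@_e *: 'X_[redm e] : S.
rewrite -[phi f](subrK (phi f')); apply: (JD).
  rewrite -rmorphB {1}[f]mpolyE -sumrB rmorph_sum; apply: ideal_sum => // e.
  by rewrite -scalerBr phi_scale; apply: JM; rewrite rmorphB; apply: cycle_monomial.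
rewrite rmorph_sum /=.
under eq_bigr do rewrite phi_scale.
pose F e := (f@_e)%:~R * phi 'X_[redm e].
rewrite -[X in J X]/(\sum_(e <- msupp f) F e).
have -> : \sum_(e <- msupp f) F e =
    \sum_(r <- undup (map redm (msupp f)))
      (collapse a b r f)%:~R * phi 'X_[r].
  have E r : (collapse a b r f)%:~R * phi 'X_[r] = \sum_(e <- msupp f | redm e == r) F e.
    rewrite /collapse rmorph_sum mulr_suml; apply: eq_bigr => e /eqP er.
    by rewrite /F er.
  under [RHS]eq_bigr do rewrite E.
  rewrite (exchange_big_dep xpredT) //= big_seq [RHS]big_seq.
  apply: eq_bigr => e es.
  rewrite (eq_bigl (fun r => r == redm e)); last by move=> r; rewrite eq_sym.
  by rewrite -big_filter filter_pred1_uniq ?undup_uniq ?mem_undup ?map_f // big_seq1.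
apply: ideal_sum => // r; apply: ideal_mulr => //.
have /dvdzP[d ->] := Kf r; rewrite rmorphM; exact: JM.
Qed.

Variable G : seq tpoly.
Hypothesis JE : forall f, J (phi f) <-> exists (C : nat -> S) h,
  f = \sum_(i < size G) C i * pval n (nth [::] G i) + m%:R * h.

Local Notation Q := (normal_forms n m a b).

Lemma combinationsP s : s \in combinations n G Q <-> exists q : nat -> tpoly,
  (forall i, (i < size G)%N -> q i \in Q) /\
  s = flatten [seq mul_tpoly n (q i) (nth [::] G i) | i <- iota 0 (size G)].
Proof.
split=> [/mapP[t /(choicesP [::])[]]|[q [qQ ->]]].
  rewrite size_map => st h ->.
  have /choice [q qP] : forall i, exists q, (i < size G)%N ->
      q \in Q /\ nth [::] t i = mul_tpoly n q (nth [::] G i).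
    move=> i; case: (ltnP i (size G)) => [lt|]; last by exists [::].
    have := h i lt; rewrite (nth_map [::]) // => /mapP[q qQ E].
    by exists q.
  exists q; split=> [i /qP[] //|]; congr flatten.
  apply: (@eq_from_nth _ [::]); first by rewrite size_map size_iota.
  rewrite st => i lt; rewrite (nth_map 0%N) ?size_iota // nth_iota // add0n.
  by have [_ ->] := qP i lt.
apply: map_f; apply/(choicesP [::]); rewrite !size_map size_iota; split=> // i lt.
rewrite !(nth_map 0%N, nth_map [::]) ?size_iota // nth_iota // add0n.
by apply/mapP; exists (q i) => //; apply: qQ.
Qed.

(** The coefficients of a combination of G may be replaced by normal forms,
   because the collapsing polynomials are an ideal. *)
Lemma in_idealP f :
  in_ideal n m a b (combinations n G Q) f <-> J (phi (pval n f)).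
Proof.
have [J0 JD JM] := idealJ.
have valE (q : nat -> tpoly) :
    pval n (flatten [seq mul_tpoly n (q i) (nth [::] G i) | i <- iota 0 (size G)]) =
    \sum_(i < size G) pval n (q i) * pval n (nth [::] G i).
  have iotaE : iota 0 (size G) = index_iota 0 (size G) by rewrite /index_iota subn0.
  rewrite pval_flatten big_map iotaE big_mkord.
  by apply: eq_bigr => i _; rewrite pval_mul.
split=> [/hasP[s /combinationsP[q [_ ->]] /vanishesE]|/JE[C [h fE]]].
  rewrite pval_cat valE => /collapsing_image.
  rewrite rmorphD => Jfs.
  have Js : J (phi (\sum_(i < size G) pval n (q i) * pval n (nth [::] G i))).
    by apply/JE; exists (fun i => pval n (q i)), 0; rewrite mulr0 addr0.
  by rewrite -[phi (pval n f)](addrK (phi (\sum_(i < size G) pval n (q i) * pval n (nth [::] G i)))); apply: idealB.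
have [_ _ _ Qc] := normal_forms_reps.
have /choice [q qP] : forall i, exists q, q \in Q /\ K (- C i - pval n q).
  by move=> i; have [_ /mapP[q qQ ->] Kq] := Qc (- C i) Logic.I; exists q.
apply/hasP; exists (flatten [seq mul_tpoly n (q i) (nth [::] G i) | i <- iota 0 (size G)]).
  by apply/combinationsP; exists q; split=> // i _; have [] := qP i.
apply/vanishesE; rewrite pval_cat valE fE addrAC -big_split /=.
apply: subgroupD (collapsing_subgroup n a b m) _ (collapsing_multiple _ _ _ _).
apply: collapsing_sum => i; rewrite -mulrDl mulrC; apply: collapsing_mul.
have [_ Kq] := qP i; rewrite -[C i + _]opprK opprD.
exact: subgroupN (collapsing_subgroup n a b m) Kq.
Qed.

End Image.
End NormalForms.

(** * The counts of the program *)

Section Counting.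
Variables (n a b p k : nat) (R : comNzRingType) (I : set R).
Variable phi : {rmorphism {mpoly int[n]} -> R}.
Variable G : seq tpoly.
Local Notation S := {mpoly int[n]}.
Local Notation m := (p ^ k.+1)%N.
Local Notation J := (with_power I p k).
Local Notation K := (@collapsing n a b m).
Local Notation Q := (normal_forms n m a b).
Hypotheses (idealI : ideal I) (p_gt0 : (0 < p)%N) (b_gt0 : (0 < b)%N).
Hypothesis onto : forall r, exists f, phi f = r.
Hypothesis cycleJ : forall i, J (phi 'X_i ^+ (a + b) - phi 'X_i ^+ a).
Hypothesis JE : forall f, J (phi f) <-> exists (C : nat -> S) h,
  f = \sum_(i < size G) C i * pval n (nth [::] G i) + m%:R * h.

Let m_gt0 : (0 < m)%N. Proof. by rewrite expn_gt0 p_gt0. Qed.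
Let idealJ : ideal J. Proof. exact: with_power_ideal. Qed.
Let Jm : J m%:R. Proof. by rewrite natrX; apply: with_power_mem. Qed.

Definition pullback (H : set R) : set S := [set f | H (phi f)].

Lemma pullback_subgroup H : subgroup H -> subgroup (pullback H).
Proof.
move=> [H0 HB]; split=> [|f g Hf Hg]; first by rewrite /pullback /= rmorph0.
by rewrite /pullback /= rmorphB; apply: HB.
Qed.

Lemma collapsing_sub_pullback : K `<=` pullback J.
Proof. by move=> f; apply: collapsing_image. Qed.

Lemma pullback_index H N : subgroup H -> J `<=` H ->
  has_index (pullback H) (pullback J) N -> has_index H J N.
Proof.
move=> gH JH iN; have gJ := ideal_subgroup idealJ.
apply: (index_transfer (f := phi)) iN => //.
- by rewrite /pullback /= rmorph0; case: gJ.
- by move=> f g _ _; rewrite /pullback /= rmorphB.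
- move=> y Hy; have [f fy] := onto y; exists f; first by rewrite /pullback /= fy.
  by rewrite fy subrr; case: gJ.
Qed.

Lemma normal_forms_index : has_index [set: S] K (size Q).
Proof.
split=> //; exists (map (pval n) Q); last by rewrite size_map.
exact: normal_forms_reps.
Qed.

Lemma finite_quotient : exists c d, [/\ has_index [set: R] J c,
  has_index (pullback J) K d & (c <= size Q)%N].
Proof.
have gJ := ideal_subgroup idealJ; have gJ' := pullback_subgroup gJ.
have gK := collapsing_subgroup n a b m.
have gT : subgroup [set: S] by [].
have [d id] : exists d, has_index (pullback J) K d.
  by apply: (index_between normal_forms_index) => //; exact: collapsing_sub_pullback.
have [c ic] : exists c, has_index [set: S] (pullback J) c.
  by apply: (index_between normal_forms_index) => //; exact: collapsing_sub_pullback.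
exists c, d; split=> //; first exact: (@pullback_index [set: R]).
rewrite (index_unique gK normal_forms_index (index_mul gT gJ' gK ic id)).
by rewrite leq_pmulr // (index_gt0 gJ' id).
Qed.

(** The normal forms with value in H represent the classes of the preimage of H
   modulo the collapsing ideal. *)
Lemma countE (H : set R) (test : tpoly -> bool) N d : subgroup H -> J `<=` H ->
  (forall q, test q <-> H (phi (pval n q))) ->
  has_index H J N -> has_index (pullback J) K d ->
  count test Q = (N * d)%N.
Proof.
move=> gH JH testE iN id.
have gJ := ideal_subgroup idealJ; have gJ' := pullback_subgroup gJ.
have gK := collapsing_subgroup n a b m; have gH' := pullback_subgroup gH.
have gT : subgroup [set: S] by [].
have JH' : pullback J `<=` pullback H by move=> f; apply: JH.
have KJ := collapsing_sub_pullback.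
have iH : has_index (pullback H) K (count test Q).
  split; first by move=> f /KJ/JH'.
  exists [seq f <- map (pval n) Q | `[< pullback H f >]].
    apply: (coset_reps_filter (H := [set: S])) => //; first by move=> f /KJ/JH'.
    exact: normal_forms_reps.
  rewrite filter_map size_map size_filter; apply: eq_count => q /=.
  by apply/asboolP/idP; rewrite testE.
have [N' iN'] : exists N', has_index (pullback H) (pullback J) N'.
  by apply: (index_between iH).
rewrite (index_unique gK iH (index_mul gH' gJ' gK iN' id)); congr muln.
exact: (index_unique gJ (pullback_index gH JH iN') iN).
Qed.

Hypothesis maxI : forall P : spec R, I `<=` prime_set P -> closed_point P.
Hypothesis stable : exists r, I (p%:R ^+ k * (1 - p%:R * r)).

Definition value (s : tpoly) : R := phi (pval n s).

Lemma torsion_countE (X : seq (spec R)) (w : spec R -> nat) : uniq X ->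
  (forall P, P \in X <-> point_above I p P) ->
  (forall P, P \in X -> has_index [set: R] (local_kernel I P) (w P)) ->
  exists2 d, (0 < d)%N & forall T,
    torsion_count n m a b (combinations n G Q) Q T =
    ((\prod_(P <- X | contained (map value T) P) w P) * d)%N.
Proof.
move=> uX XP wX; have [c [d [ic id cQ]]] := finite_quotient.
have gJ' := pullback_subgroup (ideal_subgroup idealJ).
exists d => [|T]; first exact: index_gt0 id.
have iT := torsion_index idealI maxI stable ic cQ (map value T) uX XP wX.
rewrite /torsion_count; apply: (countE (H := torsion I p k (size Q) (map value T))) iT id.
- have [J0 JD JM] := idealJ; split=> [t _|x y Tx Ty t tT]; first by rewrite mulr0.
  by rewrite mulrBr; apply: idealB => //; [apply: Tx|apply: Ty].
- by move=> x Jx t _; have [_ _ JM] := idealJ; apply: JM.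
- have E t q : in_ideal n m a b (combinations n G Q)
      (mul_tpoly n (exp_tpoly n (size Q) t) q) <->
      J (value t ^+ size Q * phi (pval n q)).
    rewrite (in_idealP b_gt0 m_gt0 idealJ Jm cycleJ JE).
    by rewrite pval_mul pval_exp rmorphM rmorphXn.
  move=> q; split=> [/allP h _ /mapP[t tT ->]|h]; first exact/E/h.
  by apply/allP => t tT; apply/E/h/map_f.
Qed.

Lemma certificate_sound (s : tpoly) cs :
  vanishes n m 0 0 (s ++ lincomb n cs G) -> J (phi (pval n s)).
Proof.
move=> /vanishesE/(collapsing_exact erefl)[g].
rewrite pval_cat pval_lincomb => E; apply/JE.
exists (fun i => - pval n (nth [::] cs i)), g.
rewrite -E addrCA -big_split big1 ?addr0 //= => i _; by rewrite mulNr addNr.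
Qed.

Lemma certificate_complete (s : tpoly) :
  J (phi (pval n s)) -> exists cs, vanishes n m 0 0 (s ++ lincomb n cs G).
Proof.
move=> /JE[C [h E]].
have /choice [q qP] : forall i, exists q, exists g, - C i = pval n q + m%:R * g.
  by move=> i; apply: pval_mod.
have /choice [g gP] := qP.
exists (mkseq q (size G)); apply/vanishesE; rewrite pval_cat pval_lincomb E.
rewrite addrAC -big_split /=.
have -> : \sum_(i < size G) (C i * pval n (nth [::] G i) +
    pval n (nth [::] (mkseq q (size G)) i) * pval n (nth [::] G i)) =
    m%:R * \sum_(i < size G) - g i * pval n (nth [::] G i).
  rewrite mulr_sumr; apply: eq_bigr => i _; rewrite -mulrDl nth_mkseq // mulrA.
  congr (_ * _); rewrite -[C i]opprK gP opprD mulrN addrAC addNr add0r.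
  by [].
by rewrite -mulrDr; apply: collapsing_multiple.
Qed.

End Counting.

(** * Geometry of the divisors and existence of certificates *)

Section Divisors.
Variable R : comNzRingType.
Implicit Types (D E : spec R -> int) (P Q : spec R).

Lemma prime_prod Q (T : eqType) (l : seq T) (F : T -> R) :
  \prod_(t <- l) F t \in ideal_of Q -> exists2 t, t \in l & F t \in ideal_of Q.
Proof.
elim: l => [|t l IH]; first by rewrite big_nil (negbTE (prime1 Q)).
rewrite big_cons prime_mul => /orP[Ft|/IH[u ul Fu]].
  by exists t => //; exact: mem_head.
by exists u => //; rewrite inE ul orbT.
Qed.

(** Otherwise a product of elements of the components, with multiplicities, would
   be in the ideal of D and not in Q. *)
Lemma prime_above_divisor D Q : weil_divisor D -> divisor_ideal D `<=` prime_set Q ->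
  exists2 P, D P != 0 & {subset ideal_of P <= ideal_of Q}.
Proof.
move=> [/finite_seqP[s sE] _] DQ; apply: contrapT => no.
have /choice [f fP] : forall P, exists x, D P != 0 ->
    x \in ideal_of P /\ x \notin ideal_of Q.
  move=> P; have [DP|nDP] := boolP (D P != 0); last by exists 0.
  apply: contrapT => nx; apply: no; exists P => // x xP.
  by apply: contrapT => /negP xQ; apply: nx; exists x.
have sP P : P \in s -> D P != 0.
  by move=> Ps; have : [set` s] P by []; rewrite -sE.
suff /DQ /prime_prod[P Ps] : divisor_ideal D (\prod_(P <- s) f P ^+ `|D P|%N).
  by move=> /prime_exp; have [_ /negP] := fP P (sP P Ps).
move=> P DP; have Ps : P \in s.
  have : [set P | D P != 0] P by rewrite /= gt_eqF.
  by rewrite sE.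
exists 1; rewrite prime1; split=> //; rewrite mul1r (big_rem P) //=.
exists 1%N, (fun=> \prod_(P <- rem P s) f P ^+ `|D P|%N), (fun _ _ => f P).
split=> [_ _|]; first by have [] := fP P (sP P Ps).
by rewrite big_ord1 prodr_const card_ord mulrC.
Qed.

(** A prime above two divisors without common component strictly contains a
   prime of height 1, so that it is maximal in a ring of dimension 2. *)
Lemma intersection_closed D E Q : krull_dim_eq R 2 ->
  weil_divisor D -> weil_divisor E -> (forall P, ~ (D P != 0 /\ E P != 0)) ->
  divisor_ideal D `<=` prime_set Q -> divisor_ideal E `<=` prime_set Q ->
  closed_point Q.
Proof.
move=> [_ dimR] wD wE noDE DQ EQ.
have [P DP PQ] := prime_above_divisor wD DQ.
have [P' EP' P'Q] := prime_above_divisor wE EQ.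
have PP' : P <> P' by move=> E1; apply: (noDE P); rewrite {2}E1.
have [[c cP] hP] := wD.2 P DP; have [[c' cP'] hP'] := wE.2 P' EP'.
have [c01 c1P] := cP 0%N isT; have [c01' c1P'] := cP' 0%N isT.
have ltPQ : psubset (ideal_of P) (ideal_of Q).
  split=> // QP; apply: hP.
  exists (fun i => if i is i'.+1 then if i' is 0%N then P' else P else c' 0%N).
  case=> [|[|//]] _ /=.
    split; last by move=> x /P'Q/QP.
    split; first by move=> x /c01'.1/c1P'.
    by move=> h; apply: c01'.2 => x /c1P'/h.
  split=> //; split; first by move=> x /P'Q/QP.
  move=> PP; apply: PP'; apply: spec_ext => x; apply/idP/idP; first exact: PP.
  by move=> /P'Q/QP.
move=> Q' QQ'; apply: contrapT => ne; apply: dimR.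
exists (fun i => if i is i'.+1 then if i' is i''.+1 then
   if i'' is 0%N then Q else Q' else P else c 0%N).
case=> [|[|[|//]]] _ //=.
  split; first by move=> x /c01.1/c1P.
  by move=> h; apply: c01.2 => x /c1P/h.
split=> // Q'Q; apply: ne; apply: spec_ext => x; apply/idP/idP; first exact: Q'Q.
exact: QQ'.
Qed.

End Divisors.

Section Existence.
Variables (R : comNzRingType) (I : set R) (p : nat).
Hypothesis idealI : ideal I.
Hypothesis maxI : forall P : spec R, I `<=` prime_set P -> closed_point P.
Hypothesis pp : prime p.

(** A prime that contains no p ^ k (1 - p r) does not contain p, while p has no
   inverse modulo it. *)
Lemma stable_exists : exists k r, I (p%:R ^+ k * (1 - p%:R * r)).
Proof.
pose S : set R := [set x | exists k r, x = p%:R ^+ k * (1 - p%:R * r)].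
apply: contrapT => no.
have [| | |P [IP PS]] := @prime_avoidance R I S idealI.
- by exists 0%N, 0; rewrite mulr0 subr0 mulr1.
- move=> _ _ [k [r ->]] [l [s ->]]; exists (k + l)%N, (r + s - r * (p%:R * s)).
  rewrite mulrACA -exprD; congr (_ * _).
  rewrite mulrBl mul1r [p%:R * r * _]mulrBr mulr1.
  rewrite [p%:R * (_ - _)]mulrBr mulrDr [p%:R * (r * _)]mulrA -addrA -opprD; congr (1 - _).
  by rewrite addrA [_ + p%:R * r]addrC.
- by move=> x Ix [k [r xE]]; apply: no; exists k, r; rewrite -xE.
have pP : (p%:R : R) \notin ideal_of P.
  by apply: PS; exists 1%N, 0; rewrite mulr0 subr0 mulr1 expr1.
have [y yP] := closed_maximal (maxI IP) pP.
have : 1 - p%:R * y \notin ideal_of P by apply: PS; exists 0%N, y; rewrite expr0 mul1r.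
by rewrite yP.
Qed.

Variable k : nat.
Local Notation m := (p ^ k.+1)%N.
Local Notation J := (with_power I p k).

Let idealJ : ideal J. Proof. exact: with_power_ideal. Qed.
Let Jm : J m%:R. Proof. by rewrite natrX; apply: with_power_mem. Qed.
Let m_gt0 : (0 < m)%N. Proof. by rewrite expn_gt0 prime_gt0. Qed.

Lemma zpoly_atE (q : {poly int}) (x : R) d : (size q <= d)%N ->
  zpoly_at q x = \sum_(i < d) (q`_i)%:~R * x ^+ i.
Proof.
move=> sq; rewrite /zpoly_at (@horner_coef_wide _ d); last first.
  by apply: leq_trans sq; exact: size_poly.
by apply: eq_bigr => i _; rewrite coef_map.
Qed.

Definition digits d (q : {poly int}) : {ffun 'I_d -> 'I_m.-1.+1} :=
  [ffun i : 'I_d => inord `|(q`_i %% m)%Z|%N].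

Lemma digits_eq d (q q' : {poly int}) x : (size q <= d)%N -> (size q' <= d)%N ->
  digits d q = digits d q' -> J (zpoly_at q x - zpoly_at q' x).
Proof.
move=> sq sq' E; rewrite !(@zpoly_atE _ _ d) // -sumrB.
apply: ideal_sum => // i; rewrite -mulrBl -rmorphB; apply: ideal_mulr => //.
have lt c : (`|(c %% m)%Z| < m.-1.+1)%N.
  rewrite prednK // -ltz_nat gez0_abs ?modz_ge0 -?lt0n //.
  by rewrite ltz_pmod.
have /(congr1 val) := congr1 (fun f : {ffun 'I_d -> 'I_m.-1.+1} => f i) E.
rewrite !ffunE /= !inordK // => /(congr1 Posz).
rewrite !gez0_abs ?modz_ge0 -?lt0n // => /eqP.
rewrite eqz_mod_dvd => /dvdzP[c ->]; rewrite rmorphM /= -[m%:Z%:~R]/(m%:R).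
by have [_ _ JM] := idealJ; apply: JM.
Qed.

(** The powers of finitely many elements that are integral modulo J become
   periodic, by the pigeonhole principle on remainders. *)
Lemma cycle_exists n (x : 'I_n -> R) :
  (forall i, exists2 q : {poly int}, q \is monic & J (zpoly_at q (x i))) ->
  exists a b, (0 < b)%N /\ forall i, J (x i ^+ (a + b) - x i ^+ a).
Proof.
move=> intx.
have /choice [q qP] : forall i, exists q : {poly int}, q \is monic /\ J (zpoly_at q (x i)).
  by move=> i; have [q mq Jq] := intx i; exists q.
pose d := (\max_i size (q i))%N.
pose code e : {ffun 'I_n -> {ffun 'I_d -> 'I_m.-1.+1}} :=
  [ffun i => digits d (Pdiv.CommonRing.rmodp 'X^e (q i))].
have codeP e e' : code e = code e' -> forall i, J (x i ^+ e - x i ^+ e').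
  move=> E i; have [mq Jq] := qP i.
  have gJ := ideal_subgroup idealJ.
  have rem_cong f : J (x i ^+ f - zpoly_at (Pdiv.CommonRing.rmodp 'X^f (q i)) (x i)).
    have {1}-> : x i ^+ f = zpoly_at 'X^f (x i).
      by rewrite /zpoly_at map_polyXn hornerXn.
    rewrite {1}(Pdiv.RingMonic.rdivp_eq mq 'X^f) /zpoly_at rmorphD hornerD addrK.
    by rewrite rmorphM hornerM; have [_ _ JM] := idealJ; apply: JM.
  have sz f : (size (Pdiv.CommonRing.rmodp 'X^f (q i)) <= d)%N.
    apply: leq_trans (leq_bigmax i); apply: ltnW.
    by rewrite Pdiv.CommonRing.ltn_rmodp monic_neq0.
  apply: subgroup_trans (rem_cong e) _ => //.
  apply: (@subgroup_trans _ _ (zpoly_at (Pdiv.CommonRing.rmodp 'X^e' (q i)) (x i))) => //.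
    apply: digits_eq (sz _) (sz _) _.
    by have := congr1 (fun f : {ffun 'I_n -> {ffun 'I_d -> 'I_m.-1.+1}} => f i) E; rewrite !ffunE.
  exact: subgroup_sym.
pose N := #|{ffun 'I_n -> {ffun 'I_d -> 'I_m.-1.+1}}|.
have [e [e' [lt E]]] : exists e e' : 'I_N.+1, (e < e')%N /\ code e = code e'.
  apply: contrapT => no.
  have inj : injective (fun e : 'I_N.+1 => code e).
    move=> e e' E; apply/val_inj/eqP; rewrite eqn_leq leqNgt [(e' <= e)%N]leqNgt.
    by apply/andP; split; apply/negP => lt; apply: no; [exists e', e|exists e, e'].
  by have := leq_card _ inj; rewrite card_ord ltnn.
exists e, (e' - e)%N; rewrite subn_gt0; split=> // i.
by rewrite subnKC ?(ltnW lt) //; apply: codeP.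
Qed.

Lemma bezout_mod (z : int) j : ~~ (p %| z)%Z ->
  exists t s : int, t * z + s * (p ^ j)%N%:Z = 1.
Proof.
move=> pz; have cop : coprimez z (p ^ j)%N.
  rewrite coprimezE /= coprime_sym coprimeXl //.
  by rewrite prime_coprime.
by have [[t s] /= E] := coprimezP _ _ cop; exists t, s.
Qed.

(** The component is a finite module over the integers killed by a power of p,
   and the residue field of the integers at p has p elements. *)
Lemma local_index_power (P : spec R) w : J `<=` local_kernel I P ->
  has_index [set: R] (local_kernel I P) w -> exists d, w = (p ^ d)%N.
Proof.
move=> JK iw; pose B : set (zmodule R) := local_kernel I P.
have iK := local_kernel_ideal idealI P.
pose pZ : set int := [set z | (p %| z)%Z].
have gpZ : subgroup pZ by split; [exact: dvdz0 | move=> x y; apply: rpredB].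
have mulP a b : pZ b -> pZ (a * b) by apply: dvdz_mull.
have ip : has_index [set: int] pZ p.
  split=> //; exists (map Posz (iota 0 p)); last by rewrite size_map size_iota.
  split=> //.
  - by rewrite map_inj_uniq ?iota_uniq // => x y [].
  - move=> _ _ /mapP[x + ->] /mapP[y + ->]; rewrite !mem_iota /= => xp yp.
    by rewrite /pZ /= -eqz_mod_dvd !modz_nat !modn_small // => /eqP[->].
  - move=> z _; exists (z %% p)%Z; last by rewrite /pZ /= -eqz_mod_dvd modz_mod.
    have z0 : (0 <= z %% p)%Z by rewrite modz_ge0 // -lt0n prime_gt0.
    apply/mapP; exists `|(z %% p)%Z|%N; last by rewrite gez0_abs.
    by rewrite mem_iota /= -ltz_nat gez0_abs // ltz_pmod // ltz_nat prime_gt0.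
have maxP a : ~ pZ a -> exists t, pZ (1 - a * t).
  move=> /negP /(bezout_mod 1)[t [s E]]; exists t; rewrite /pZ /=.
  by rewrite -E [a * t]mulrC addrC addKr dvdz_mull // expn1.
have locB a : pZ a -> exists t, forall x : (zmodule R), B (x - (t * (1 - a)) *: x).
  move=> pa; have na : ~~ (p %| 1 - a)%Z.
    apply/negP => p1a; have : (p %| (1 - a) + a)%Z by rewrite rpredD.
    by rewrite subrK dvdzE /= dvdn1 => /eqP p1; move: pp; rewrite p1.
  have [t [s E]] := bezout_mod k.+1 na; exists t => x.
  have -> : x - (t * (1 - a)) *: x = (s * m%:Z) *: x.
    by rewrite -[X in X - _]scale1r -scalerBl -[X in X - _]E addrC addKr.
  rewrite -[_ *: x]/((x : R) *~ (s * m%:Z)) -mulrzr rmorphM /=.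
  apply: JK; rewrite mulrA; have [_ _ JM] := idealJ; apply: JM.
  by rewrite -[m%:Z%:~R]/(m%:R).
have mB : @submodule int (zmodule R) B.
  have [B0 BD BM] := iK; split=> // c x Bx.
  by rewrite -[c *: x]/((x : R) *~ c) -mulrzr; apply: ideal_mulr.
have mT : @submodule int (zmodule R) [set: (zmodule R)] by [].
have [d [c [[-> _ _ _] _]]] := length_exists mulP gpZ ip maxP locB (prime_gt1 pp)
  mB mT (fun _ h => h) (iw : has_index [set: (zmodule R)] B w).
by exists d.
Qed.

End Existence.

(** * The naive intersection number on a set of points *)

Section NaiveSum.
Variables (RR : realType) (R : idomainType) (p : nat) (ID IE : set R).
Local Notation I := (ideal_add ID IE).
Hypotheses (pp : prime p) (idD : ideal ID) (idE : ideal IE).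
Hypothesis maxI : forall P : spec R, I `<=` prime_set P -> closed_point P.

Lemma lies_overE (P : spec R) : (p%:R \in ideal_of P) <-> lies_over p P.
Proof.
have iP := prime_set_ideal P; have [_ PD PM] := iP.
split=> [pP z|h]; last by have := h p; rewrite -[p%:Z%:~R]/(p%:R) dvdzz => ->.
apply/idP/idP => [zP|/dvdzP[d ->]]; last first.
  by rewrite rmorphM /= -[p%:Z%:~R]/(p%:R); apply: PM.
apply: contrapT => /negP /(bezout_mod pp 1)[t [s E]].
have /negP := prime1 P; apply.
rewrite -[1]/(1%:~R) -E expn1 rmorphD !rmorphM /= -[p%:Z%:~R]/(p%:R).
by apply: PD; apply: PM.
Qed.

Lemma ln_prod (T : Type) (l : seq T) (Q : pred T) (F : T -> nat) :
  (forall t, 0 < F t)%N ->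
  ln ((\prod_(t <- l | Q t) F t)%N%:R : RR) = \sum_(t <- l | Q t) ln ((F t)%:R : RR).
Proof.
move=> F0; elim: l => [|t l IH]; first by rewrite !big_nil ln1.
rewrite !big_cons; case: ifP => // _; rewrite natrM lnM ?IH // posrE ltr0n //.
by apply: prodn_gt0.
Qed.

(** Closed points of W over p that do not contain I contribute 0. *)
Lemma naive_on_sum (W : set (spec R)) (X : seq (spec R)) (w : spec R -> nat) :
  uniq X -> (forall P, P \in X <-> point_above I p P) ->
  (forall P, P \in X -> naive_at RR ID IE P = (ln ((w P)%:R : RR))%:E) ->
  (forall P, 0 < w P)%N ->
  naive_on RR p W ID IE = (\sum_(P <- X | `[< W P >]) ln ((w P)%:R : RR))%:E.
Proof.
move=> uX XP Xw w0; rewrite /naive_on.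
have iI : ideal I by exact: idealD.
pose Y := [seq P <- X | `[< W P >]].
have memY P : P \in Y <-> W P /\ P \in X.
  by rewrite mem_filter; split=> [/andP[/asboolP]|[/asboolP -> ->]].
transitivity (\esum_(P in [set` Y]) naive_at RR ID IE P)%E.
  rewrite [LHS]esum_mkcond [RHS]esum_mkcond; apply: eq_esum => P _.
  have -> : (P \in [set` Y]) = (P \in Y) by apply/idP/idP => [/set_mem|h]; last exact: mem_set.
  case: (boolP (P \in Y)) => [/memY[WP /XP aP]|nY].
    rewrite ifT //; apply: mem_set; split=> //; first exact: maxI aP.1.
    exact/lies_overE/aP.2.
  case: ifPn => // /set_mem[WP cP /lies_overE pP].
  apply: naive_at_off => // IP; move/negP: nY; apply; apply/memY; split=> //.
  exact/XP.
rewrite esum_fset; last first.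
- move=> P /set_mem/memY[_ /Xw ->]; rewrite lee_fin ln_ge0 // ler1n.
  exact: w0.
- exact: finite_seq.
rewrite -fsbig_seq ?filter_uniq // big_filter -sumEFin.
rewrite big_seq_cond [RHS]big_seq_cond; apply: eq_bigr => P /andP[PX _].
exact: Xw.
Qed.

Lemma naive_at_component k c P w :
  (exists r, I (p%:R ^+ k * (1 - p%:R * r))) ->
  has_index [set: R] (with_power I p k) c -> point_above I p P ->
  has_index [set: R] (local_kernel I P) w ->
  naive_at RR ID IE P = (ln (w%:R : RR))%:E.
Proof.
move=> stable ic aP iw; have iI : ideal I by exact: idealD.
have cP : closed_point P by apply: maxI aP.1.
have [q iq] : exists q, has_index [set: R] (prime_set P) q.
  apply: (index_between ic) => //; first exact: ideal_subgroup (prime_set_ideal P).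
  by move=> x /(with_power_local iI stable aP); apply: local_kernel_sub; exact: aP.1.
apply: naive_at_above (closed_maximal cP) iq iw _ => // s.
exact: (local_unit iI stable ic (leqnn c) aP).
Qed.

End NaiveSum.

(** * Correctness of the program *)

Lemma ideal_gen_ideal (R : comNzRingType) (gs : seq R) : ideal (ideal_gen gs).
Proof.
split.
- by exists (fun=> 0); rewrite big1 // => i _; rewrite mul0r.
- move=> _ _ [c ->] [d ->]; exists (fun i => c i + d i).
  by rewrite -big_split; apply: eq_bigr => i _; rewrite mulrDl.
- move=> a _ [c ->]; exists (fun i => a * c i).
  by rewrite mulr_sumr; apply: eq_bigr => i _; rewrite mulrA.
Qed.

Lemma ideal_gen_mem (R : comNzRingType) (gs : seq R) x : x \in gs -> ideal_gen gs x.
Proof.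
move=> /(nthP 0)[i lt <-]; exists (fun j => (j == Ordinal lt)%:R).
rewrite (bigD1 (Ordinal lt)) //= eqxx mul1r big1 ?addr0 // => j ne.
by rewrite (negbTE ne) mul0r.
Qed.

Lemma foldr_prodn (T : Type) (l : seq T) (F : T -> nat) :
  foldr muln 1%N (map F l) = (\prod_(t <- l) F t)%N.
Proof. by elim: l => [|t l /= ->]; rewrite ?big_nil ?big_cons. Qed.

Section Correctness.
Variables (RR : realType) (p n : nat) (rels gD gE : seq poly_data).
Variable V : seq (seq poly_data * seq poly_data).
Variables (R : idomainType) (phi : {rmorphism {mpoly int[n]} -> R}) (ID IE : set R).
Local Notation S := {mpoly int[n]}.
Local Notation I := (ideal_add ID IE).
Definition elements (s : seq poly_data) : seq R := [seq phi (poly_of n f) | f <- s].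
Hypothesis pp : prime p.
Hypothesis presR : presents [seq poly_of n f | f <- rels] phi.
Hypothesis genD : ideal_gen (elements gD) = ID.
Hypothesis genE : ideal_gen (elements gE) = IE.
Hypothesis maxI : forall P : spec R, I `<=` prime_set P -> closed_point P.

Local Notation x := (raw_input p n rels gD gE V).

Let idD : ideal ID. Proof. by rewrite -genD; apply: ideal_gen_ideal. Qed.
Let idE : ideal IE. Proof. by rewrite -genE; apply: ideal_gen_ideal. Qed.
Let idealI : ideal I. Proof. exact: idealD. Qed.

Lemma generatorsE m :
  generators m x = [seq to_tpoly m (raw s) | s <- rels ++ (gD ++ gE)].
Proof. by rewrite /generators /= -!map_cat -map_comp. Qed.

Lemma nth_generators m i : (i < size (rels ++ (gD ++ gE)))%N ->
  nth [::] (generators m x) i = to_tpoly m (raw (nth [::] (rels ++ (gD ++ gE)) i)).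
Proof. by move=> lt; rewrite generatorsE (nth_map [::]). Qed.

Section Exponent.
Variable k : nat.
Local Notation m := (p ^ k.+1)%N.
Local Notation J := (with_power I p k).
Local Notation G := (generators m x).

Let m_gt0 : (0 < m)%N. Proof. by rewrite expn_gt0 prime_gt0. Qed.
Let idealJ : ideal J. Proof. exact: with_power_ideal. Qed.
Let Jm : J m%:R. Proof. by rewrite natrX; apply: with_power_mem. Qed.

Definition lin_combination : set S := [set f | exists (C : nat -> S) h,
  f = \sum_(i < size G) C i * pval n (nth [::] G i) + m%:R * h].

Lemma lin_combination_ideal : ideal lin_combination.
Proof.
split.
- exists (fun=> 0), 0; rewrite mulr0 addr0 big1 // => i _; exact: mul0r.
- move=> _ _ [C [h ->]] [C' [h' ->]]; exists (fun i => C i + C' i), (h + h').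
  rewrite addrACA -big_split mulrDr; congr (_ + _).
  by apply: eq_bigr => i _; rewrite mulrDl.
- move=> f _ [C [h ->]]; exists (fun i => f * C i), (f * h).
  rewrite mulrDr mulr_sumr mulrCA; congr (_ + _).
  by apply: eq_bigr => i _; rewrite mulrA.
Qed.

Lemma lin_combination_mem s : s \in rels ++ (gD ++ gE) -> lin_combination (poly_of n s).
Proof.
move=> /(nthP [::])[i]; set l := rels ++ _ => lt sE.
have sG : size G = size l by rewrite generatorsE size_map.
have [g gE'] := pval_to_tpoly n s m_gt0.
have lt' : (i < size G)%N by rewrite sG.
exists (fun j => (j == i)%:R), g; rewrite gE'; congr (_ + _).
rewrite (bigD1 (Ordinal lt')) //= eqxx mul1r big1 ?addr0.
  by rewrite nth_generators // sE.
move=> j ne; rewrite -val_eqE /= in ne; by rewrite (negbTE ne) mul0r.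
Qed.

Lemma lift_ideal_gen (gs : seq poly_data) y : {subset gs <= rels ++ (gD ++ gE)} ->
  ideal_gen (elements gs) y -> exists2 f, phi f = y & lin_combination f.
Proof.
move=> sub [c ->]; have [onto _] := presR.
have /choice [F FE] : forall i, exists f, phi f = c i by move=> i; apply: onto.
exists (\sum_(i < size (elements gs)) F i * poly_of n (nth [::] gs i)).
  rewrite rmorph_sum; apply: eq_bigr => i _; rewrite rmorphM FE (nth_map [::]) //.
  by rewrite -(size_map (fun f => phi (poly_of n f))).
elim/big_ind: _ => //.
- by case: lin_combination_ideal.
- by case: lin_combination_ideal => _ h _; apply: h.
- move=> i _; case: lin_combination_ideal => _ _; apply.
  apply: lin_combination_mem; apply: sub; apply: mem_nth.
  by rewrite -(size_map (fun f => phi (poly_of n f))).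
Qed.

(** The relations of the presentation are among the generators, which accounts
   for the kernel of phi. *)
Lemma lin_combinationE f : J (phi f) <-> lin_combination f.
Proof.
have [L0 LD LM] := lin_combination_ideal; have [J0 JD JM] := idealJ.
have [onto ker] := presR.
split=> [[y [z [[u [v [Du Ev ->]]] [a ->] E]]]|[C [h ->]]].
  have [fu fuE Lu] : exists2 f, phi f = u & lin_combination f.
    apply: (@lift_ideal_gen gD) => [s sD|]; last by rewrite genD.
    by rewrite !mem_cat sD orbT.
  have [fv fvE Lv] : exists2 f, phi f = v & lin_combination f.
    apply: (@lift_ideal_gen gE) => [s sE|]; last by rewrite genE.
    by rewrite !mem_cat sE !orbT.
  have [h hE] := onto a.
  have : phi (f - (fu + fv + m%:R * h)) = 0.
    by rewrite rmorphB !rmorphD rmorphM rmorph_nat fuE fvE hE E natrX mulrC subrr.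
  move/ker => [c cE].
  rewrite -[f](subrK (fu + fv + m%:R * h)); apply: (LD).
    rewrite cE; elim/big_ind: _ => // i _; apply: LM.
    have lt : (i < size rels)%N by rewrite -(size_map (poly_of n)).
    by rewrite (nth_map [::]) //; apply: lin_combination_mem; rewrite mem_cat mem_nth.
  apply: (LD); first exact: LD.
  by exists (fun=> 0), h; rewrite big1 ?add0r // => i _; exact: mul0r.
rewrite rmorphD rmorphM rmorph_nat rmorph_sum; apply: (JD); last first.
  by apply: ideal_mulr idealJ Jm.
apply: ideal_sum => // i; rewrite rmorphM; apply: JM.
have lt : (i < size (rels ++ (gD ++ gE)))%N.
  by rewrite -(size_map (fun s => to_tpoly m (raw s))) -generatorsE.
rewrite nth_generators //; set s := nth _ _ _.
have [g gE'] := pval_to_tpoly n s m_gt0.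
have -> : pval n (to_tpoly m (raw s)) = poly_of n s - m%:R * g by rewrite gE' addrK.
rewrite rmorphB rmorphM rmorph_nat; apply: idealB => //; last exact: ideal_mulr idealJ Jm.
have : s \in rels ++ (gD ++ gE) by apply: mem_nth.
rewrite !mem_cat => /orP[sr|/orP[sD|sE]].
- have -> : phi (poly_of n s) = 0; last by [].
  by apply/ker; apply: ideal_gen_mem; apply: map_f.
- apply: sub_with_power; apply: ideal_addl => //; rewrite -genD.
  by apply: ideal_gen_mem; apply/mapP; exists s.
- apply: sub_with_power; apply: ideal_addr => //; rewrite -genE.
  by apply: ideal_gen_mem; apply/mapP; exists s.
Qed.

Variables (a b : nat).
Hypothesis b_gt0 : (0 < b)%N.
Local Notation Q := (normal_forms n m a b).

Lemma pval_cycle (j : 'I_n) :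
  pval n [:: (1, rcons (nseq j 0) (a + b)); (m.-1, rcons (nseq j 0) a)]%N =
  'X_j ^+ (a + b) + m.-1%:R * 'X_j ^+ a.
Proof.
rewrite /pval !big_cons big_nil addr0 /= !(mono_power _ (ltn_ord j)).
have -> : Ordinal (ltn_ord j) = j by apply: val_inj.
by rewrite -!mpolyXn scale1r scaler_nat mulr_natl.
Qed.

Lemma phi_cycle (j : 'I_n) :
  J (phi (pval n [:: (1, rcons (nseq j 0) (a + b)); (m.-1, rcons (nseq j 0) a)]%N)) <->
  J (phi 'X_j ^+ (a + b) - phi 'X_j ^+ a).
Proof.
have [J0 JD JM] := idealJ.
rewrite pval_cycle rmorphD rmorphM rmorph_nat !rmorphXn.
set u := phi 'X_j ^+ (a + b); set v := phi 'X_j ^+ a.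
have mv : J (m%:R * v) by apply: ideal_mulr.
have E : u + m.-1%:R * v = u - v + m%:R * v.
  have -> : m%:R = 1 + m.-1%:R :> R by rewrite -[1]/(1%:R) -natrD add1n prednK.
  by rewrite mulrDl mul1r addrA subrK.
rewrite E; split=> h; last exact: JD.
by rewrite -[u - v](addrK (m%:R * v)); apply: idealB.
Qed.

Lemma finite_indexE :
  (exists cof, finite_index n m a b k p cof G) <->
  J (p%:R ^+ k) /\ forall j, J (phi 'X_j ^+ (a + b) - phi 'X_j ^+ a).
Proof.
have phi_p : phi (pval n [:: (p ^ k, [::])]%N) = p%:R ^+ k.
  by rewrite pval_const rmorph_nat natrX.
have sound s cs := certificate_sound lin_combinationE (s := s) (cs := cs).
have complete s := certificate_complete (prime_gt0 pp) lin_combinationE (s := s).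
split=> [[cof /andP[c0 /allP cj]]|[Jp Jc]].
  split; first by rewrite -phi_p; apply: (sound [:: (p ^ k, [::])]%N) c0.
  move=> j; apply/phi_cycle; apply: (sound [:: _; _]).
  by apply: cj; rewrite mem_iota add0n ltn_ord.
have [c0 c0P] : exists cs, vanishes n m 0 0 ([:: (p ^ k, [::])]%N ++ lincomb n cs G).
  by apply: complete; rewrite phi_p.
have /choice [c cP] : forall j : 'I_n, exists cs, vanishes n m 0 0
    ([:: (1, rcons (nseq j 0) (a + b)); (m.-1, rcons (nseq j 0) a)]%N ++ lincomb n cs G).
  by move=> j; apply: complete; apply/phi_cycle.
exists (c0 :: map c (enum 'I_n)); apply/andP; split; first exact: c0P.
apply/allP => j; rewrite mem_iota add0n /= => lt.
have := cP (Ordinal lt).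
by rewrite (nth_map (Ordinal lt)) ?size_enum_ord // (nth_ord_enum (Ordinal lt) (Ordinal lt)).
Qed.

Hypothesis Jpk : J (p%:R ^+ k).
Hypothesis cycleJ : forall j, J (phi 'X_j ^+ (a + b) - phi 'X_j ^+ a).

Lemma stable_of_power : exists r, I (p%:R ^+ k * (1 - p%:R * r)).
Proof.
have [y [z [Iy [r ->] E]]] := Jpk; exists r.
by rewrite mulrBr mulr1 mulrA -exprSr {1}E [_ * r]mulrC addrK.
Qed.

Definition piece (i : nat) : set (spec R) :=
  locally_closed (elements (nth ([::], [::]) V i).1,
                  elements (nth ([::], [::]) V i).2).
Definition constructible : set (spec R) :=
  [set P | exists2 i, (i < size V)%N & piece i P].

Definition in_piece (t : seq poly_data * seq poly_data) (P : spec R) : bool :=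
  contained (elements t.1) P && ~~ contained (elements t.2) P.

Lemma containedE (T : seq R) (P : spec R) : contained T P <-> zero_locus T P.
Proof. by split=> [/allP|h]; [|apply/allP]. Qed.

Lemma in_pieceE i P : in_piece (nth ([::], [::]) V i) P <-> piece i P.
Proof.
split=> [/andP[/containedE cA /negP ncB]|[/containedE cA ncB]].
  by split=> // /containedE.
by apply/andP; split=> //; apply/negP => /containedE.
Qed.

Lemma contained_value P (T : seq poly_data) : p%:R \in ideal_of P ->
  contained (map (value phi) (map (to_tpoly m) (map raw T))) P =
  contained (elements T) P.
Proof.
move=> pP; have iP := prime_set_ideal P; have [_ PD _] := iP.
rewrite /contained !all_map; apply: eq_all => s /=; rewrite /value.
have [g ->] := pval_to_tpoly n s m_gt0; rewrite rmorphD rmorphM rmorph_nat.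
have mgP : prime_set P (m%:R * phi g).
  by apply: (ideal_mulr _ iP); rewrite natrX exprS; apply: ideal_mulr.
apply/idP/idP => h; first exact: PD.
by rewrite -[phi _](addrK (m%:R * phi g)); apply: (idealB iP).
Qed.

Hypothesis disjoint_pieces : forall i j, (i < size V)%N -> (j < size V)%N ->
  i != j -> piece i `&` piece j = set0.

(** A point of V is in exactly one of the disjoint pieces. *)
Lemma sum_pieces (X : seq (spec R)) (f : spec R -> RR) :
  \sum_(P <- X | `[< constructible P >]) f P =
  \sum_(t <- V) \sum_(P <- X | in_piece t P) f P.
Proof.
rewrite (big_nth ([::], [::])) big_mkord.
under [RHS]eq_bigr do rewrite big_mkcond.
rewrite exchange_big big_mkcond /=; apply: eq_bigr => P _.
rewrite -big_mkcond /=; case: asboolP => [[i lt Pi]|no].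
  rewrite (bigD1 (Ordinal lt)) /=; last exact/in_pieceE.
  rewrite big1 ?addr0 // => j /andP[/in_pieceE Pj ne].
  have : (piece i `&` piece j) P by [].
  by rewrite disjoint_pieces // eq_sym.
rewrite big1 // => i /in_pieceE Pi; case: no; by exists i.
Qed.

(** The two counts of a piece differ by the order of the component of R / I at the
   piece, up to the same factor d in both, the number of normal forms with value
   in J. *)
Lemma counts_correct :
  let counts N := counts_agree n m a b p N (combinations n G Q) Q
    (map (fun t => map (fun T => map (to_tpoly m) T) t) x.2.2.2.2.2) in
  (exists N, counts N) /\
  forall N, counts N ->
    naive_on RR p constructible ID IE = (N%:R * ln (p%:R : RR))%:E.
Proof.
have stable := stable_of_power; have [onto _] := presR.
have p_gt0 := prime_gt0 pp.
have [c [_ [ic _ _]]] := finite_quotient idealI p_gt0 b_gt0 onto cycleJ.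
have [X uX XP] := finite_points idealI stable ic.
have /choice [w wP] : forall P, exists w, (0 < w)%N /\
    (point_above I p P -> has_index [set: R] (local_kernel I P) w).
  move=> P; have [aP|] := pselect (point_above I p P); last by exists 1%N.
  have [w iw] := local_index idealI stable ic aP; exists w; split=> //.
  exact: index_gt0 iw.
have wX P : P \in X -> has_index [set: R] (local_kernel I P) (w P).
  by move=> /XP; case: (wP P).
have w_gt0 P : (0 < w P)%N by case: (wP P).
have [d d_gt0 tE] := torsion_countE idealI p_gt0 b_gt0 onto cycleJ
  lin_combinationE maxI stable uX XP wX.
pose A (t : seq poly_data * seq poly_data) := (\prod_(P <- X | contained (elements t.1) P) w P)%N.
pose B (t : seq poly_data * seq poly_data) := (\prod_(P <- X | contained (elements t.1) P && contained (elements t.2) P) w P)%N.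
pose C (t : seq poly_data * seq poly_data) := (\prod_(P <- X | in_piece t P) w P)%N.
have AE t : A t = (B t * C t)%N by rewrite /A (bigID (contained (elements t.2))).
have countsE N : counts_agree n m a b p N (combinations n G Q) Q
    (map (fun t => map (fun T => map (to_tpoly m) T) t) x.2.2.2.2.2) =
    ((\prod_(t <- V) C t)%N == (p ^ N)%N).
  rewrite /counts_agree /= !foldr_prodn !big_map /=.
  have cE T : torsion_count n m a b (combinations n G Q) Q
      (map (to_tpoly m) (map raw T)) =
      ((\prod_(P <- X | contained (elements T) P) w P) * d)%N.
    rewrite tE; congr (_ * _)%N; rewrite big_seq_cond [RHS]big_seq_cond.
    apply: eq_bigl => P; case PX: (P \in X) => //=.
    by apply: contained_value; have /XP[] := PX.
  under eq_bigr do rewrite cE.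
  under [X in _ == (_ * X)%N]eq_bigr do rewrite -!map_cat cE.
  have BE t : (\prod_(P <- X | contained (elements (t.1 ++ t.2)) P) w P)%N = B t.
    by apply: eq_bigl => P; rewrite /elements map_cat /contained all_cat.
  under [X in _ == (_ * X)%N]eq_bigr do rewrite BE.
  under eq_bigr do rewrite -/(A _) AE mulnAC.
  rewrite big_split /= mulnC eqn_pmul2r //.
  by apply: prodn_gt0 => t; rewrite muln_gt0 d_gt0 andbT; apply: prodn_gt0.
have C_gt0 t : (0 < C t)%N by apply: prodn_gt0.
split=> [|N].
  suff [N NE] : exists N, (\prod_(t <- V) C t)%N = (p ^ N)%N.
    by exists N; rewrite countsE NE.
  elim/big_ind: _ => [|_ _ [i ->] [j ->]|t _]; first by exists 0%N.
    by exists (i + j)%N; rewrite expnD.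
  rewrite /C big_seq_cond; elim/big_ind: _ => [|_ _ [i ->] [j ->]|P /andP[PX _]].
  - by exists 0%N.
  - by exists (i + j)%N; rewrite expnD.
  - apply: (local_index_power idealI pp (k := k)) (wX P PX).
    by apply: with_power_local => //; apply/XP.
rewrite countsE => /eqP NE.
rewrite (naive_on_sum pp idD idE maxI _ uX XP (w := w)) //; last first.
  move=> P PX; apply: (naive_at_component RR idD idE maxI stable ic); last exact: wX.
  exact/XP.
congr (_%:E); rewrite sum_pieces.
under eq_bigr do rewrite -ln_prod //.
by rewrite -ln_prod // NE natrX lnXn ?mulr_natl // ltr0n.
Qed.

End Exponent.

Hypothesis disjoint_pieces : forall i j, (i < size V)%N -> (j < size V)%N ->
  i != j -> piece i `&` piece j = set0.

Lemma verify_sound c : verify x c ->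
  naive_on RR p constructible ID IE = (c.1%:R * ln (p%:R : RR))%:E.
Proof.
case: c => N [k [a [b cof]]] /andP[b0 /andP[fi ca]].
have [|Jp Jc] := (finite_indexE k a b).1; first by exists cof.
by have [_] := counts_correct b0 Jp Jc disjoint_pieces; apply.
Qed.

Lemma verify_complete : exists c, verify x c.
Proof.
have [onto _] := presR.
have [k [r Ik]] := stable_exists p idealI maxI.
have [J0 JD JM] := with_power_ideal p k idealI.
have Jp : with_power I p k (p%:R ^+ k).
  have -> : p%:R ^+ k = p%:R ^+ k * (1 - p%:R * r) + r * p%:R ^+ k.+1 :> R.
    by rewrite mulrBr mulr1 mulrA -exprSr [_ * r]mulrC subrK.
  by apply: JD; [exact: sub_with_power | apply: JM; exact: with_power_mem].
have [i|a [b [b0 Jc]]] := @cycle_exists R I p idealI pp k n (fun j => phi 'X_j).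
  apply: (integral_mod_ideal _ onto pp (with_power_ideal p k idealI)
    (with_power_mem p k idealI)).
  by move=> P JP; apply/closed_maximal/maxI => y /(sub_with_power p k)/JP.
have [cof fi] := (finite_indexE k a b).2 (conj Jp Jc).
have [[N cN] _] := counts_correct b0 Jp Jc disjoint_pieces.
by exists (N, (k, (a, (b, cof)))); apply/andP; split=> //; apply/andP.
Qed.

End Correctness.

Theorem mainTheorem1 :
  exists F : 1.-tuple nat -> nat -> Prop, partial_recursive F /\
  forall (RR : realType) (p n : nat) (rels gD gE : seq poly_data)
    (V : seq (seq poly_data * seq poly_data))
    (R : idomainType) (phi : {rmorphism {mpoly int[n]} -> R})
    (D E : spec R -> int),
  let elts (s : seq poly_data) : seq R := [seq phi (poly_of n f) | f <- s] in
  let piece (i : nat) : set (spec R) :=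
    locally_closed (elts (nth ([::], [::]) V i).1,
                    elts (nth ([::], [::]) V i).2) in
  let VC : set (spec R) := [set P | exists2 i, (i < size V)%N & piece i P] in
  prime p ->
  presents [seq poly_of n f | f <- rels] phi ->
  krull_dim_eq R 2 ->
  flat_over_Z R ->
  weil_divisor D -> effective D ->
  weil_divisor E -> effective E ->
  (forall P, ~ (D P != 0 /\ E P != 0)) ->
  ideal_gen (elts gD) = divisor_ideal D ->
  ideal_gen (elts gE) = divisor_ideal E ->
  (forall i j, (i < size V)%N -> (j < size V)%N -> i != j ->
    piece i `&` piece j = set0) ->
  exists N : nat, F [tuple enc_input p n rels gD gE V] N /\
    naive_on RR p VC (divisor_ideal D) (divisor_ideal E) =
      (N%:R * ln p%:R)%:E.
Proof.
have [F [prF FE]] := intersection_algorithm; exists F; split=> //.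
move=> RR p n rels gD gE V R phi D E elts piece VC pp presR dimR _ wD _ wE _ noDE
  gDE gEE disj.
have idD : ideal (divisor_ideal D) by rewrite -gDE; apply: ideal_gen_ideal.
have idE : ideal (divisor_ideal E) by rewrite -gEE; apply: ideal_gen_ideal.
have maxI (P : spec R) : ideal_add (divisor_ideal D) (divisor_ideal E) `<=`
    prime_set P -> closed_point P.
  move=> IP; apply: (intersection_closed dimR wD wE noDE) => y Dy; apply: IP.
    exact: ideal_addl.
  exact: ideal_addr.
have [c vc Fc] := FE p n rels gD gE V
  (verify_complete RR pp presR gDE gEE maxI disj).
exists c.1; split=> //.
exact: (verify_sound RR pp presR gDE gEE maxI disj vc).
Qed.
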